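(* Let $\phi,\psi$ be the scaling function and wavelet of an orthonormal multiresolution analysis of $L^2(\mathbb{R})$ with low-pass filter $u$, let $N\in\mathbb{N}$, $N\ge2$, be the number of vanishing moments of $\psi$, let $h_1,h_2:\mathbb{R}\to\mathbb{C}$ (with $h_1$ measurable) and let $d\in\mathbb{R}$. Suppose the following. (1) $h_1(x)=\overline{h_1(-x)}$, and $h_1,h_1^{-1}$ are bounded on every compact interval of $\mathbb{R}$. (2) $h_2(x)=\overline{h_2(-x)}$ and $h_2,h_2^{-1}\in C^2(\mathbb{R})$; and for any $\epsilon>0$ there are constants $C_2\ge C_1>0$ and $C_3>0$ (depending on $\epsilon$) such that $$C_1|x|^{-d}\le |h_2(x)|\le C_2|x|^{-d},\quad |x|>\epsilon,$$ $$\Big|\frac{d^k}{dx^k}(h_2)^p(x)\Big|\le C_3|x|^{-pd-k},\quad p=-1,1,\ k=1,2,\ |x|>\epsilon,$$ $$\max_{p=-1,1}\ \max_{k=0,1,2}\ \frac{1}{2^{-pjd}}\,2^{jk}\Big|\frac{d^k}{dx^k}(h_2)^p(2^jx)\Big|\le \frac{C_3}{|x|^{N-2}},\quad j\ge 1,\ |x|\le\epsilon.$$ (3) The function $h_2/h_1$ is periodic with period $2\pi$. (4) $|\phi(t)|=O((1+t^2)^{-N/2-1})$, $|\psi(t)|=O((1+t^2)^{-N/2-1})$, $\int_{\mathbb{R}}t^\nu\psi(t)\,dt=0$ for $\nu=0,1,\dots,N-1$, and $N\ge\max\{2,-\tfrac12+|d|\}$. (5) $\widehat\phi,\widehat\psi\in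 C^N(\mathbb{R})$ and $\widehat u\in C^N[-\pi,\pi)$. (6) For some compact set $K$ congruent to $[-\pi,\pi]$ modulo $2\pi$, $\inf_{x\in K}|\widehat\phi(x)|>0$. (7) There exist $\zeta,\eta>0$ and $C>0$ such that for all $x\in\mathbb{R}$, $|\widehat\phi(x)|\le \frac{C}{(1+|x|)^{|d|+1/2+\zeta}}$ and $\max_{k=0,1,2}\big|\frac{d^k}{dx^k}\widehat\psi(x)\big|\le \frac{C}{(1+|x|)^{|d|+(2+\eta)}}$. Then both families of functions $$\{\Phi_0(t-k),\ \eta_j(t-2^{-j}k),\ j\ge0,\ k\in\mathbb{Z}\}\quad\text{and}\quad \{\Phi^0(t-k),\ \eta^j(t-2^{-j}k),\ j\ge0,\ k\in\mathbb{Z}\}$$ are Riesz bases of $L^2(\mathbb{R})$.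
   Context: Fourier transform convention: $\widehat f(x)=\int_{\mathbb{R}}e^{-ixt}f(t)\,dt$. $\|\cdot\|$ is the $L^2(\mathbb{R})$ norm. $\phi_{j,k}(t)=2^{j/2}\phi(2^jt-k)$, $\psi_{j,k}(t)=2^{j/2}\psi(2^jt-k)$. MRA: $\{\phi(t-k),\,2^{j/2}\psi(2^jt-k),\ j\ge0,\ k\in\mathbb{Z}\}$ is an orthonormal basis of $L^2(\mathbb{R})$; there is a filter $u\in l^2(\mathbb{Z})$ with $\widehat u(x)=\sum_n u_ne^{-inx}$, $|\widehat u(x)|^2+|\widehat u(x+\pi)|^2=2$, $\widehat\phi(x)=\frac1{\sqrt2}\widehat u(x/2)\widehat\phi(x/2)$, and $\widehat\psi(x)=\frac1{\sqrt2}\widehat v(x/2)\widehat\phi(x/2)$ where $\widehat v(x)=e^{-ix}\overline{\widehat u(x+\pi)}$. A compact set $K$ is congruent to $[-\pi,\pi]$ modulo $2\pi$ if $|K|=2\pi$ and for every $x\in[-\pi,\pi]$ there is $l\in\mathbb{Z}$ with $x+2l\pi\in K$. Define $\widehat\Phi^{\#}_{j,k}=h_1\widehat\phi_{j,k}$, $\widehat\Psi^{\#}_{j,k}=h_2\widehat\psi_{j,k}$, $\widehat\Phi_{\#}^{j,k}=\overline{h_1^{-1}}\,\widehat\phi_{j,k}$, $\widehat\Psi_{\#}^{j,k}=\overline{h_2^{-1}}\,\widehat\psi_{j,k}$, and $\Phi_j=\Phi^{\#}_{j,0}/\|\Phi^{\#}_{j,0}\|$, $\Phi^j=\Phi_{\#}^{j,0}/\|\Phi_{\#}^{j,0}\|$,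 $\eta_j=\Psi^{\#}_{j,0}/\|\Psi^{\#}_{j,0}\|$, $\eta^j=\Psi_{\#}^{j,0}/\|\Psi_{\#}^{j,0}\|$. In hypothesis (2), $\frac{d^k}{dx^k}(h_2)^p(2^jx)$ means the $k$-th derivative of $(h_2)^p$ evaluated at $2^jx$; when $N>2$ the right-hand side $C_3/|x|^{N-2}$ at $x=0$ is read as $+\infty$. A family $\{e_l\}$ in a Hilbert space $\mathcal{H}$ is a Riesz basis if (i) there are constants $C_2\ge C_1>0$ such that $C_1(\sum_l|a_l|^2)^{1/2}\le\|\sum_l a_le_l\|_{\mathcal{H}}\le C_2(\sum_l|a_l|^2)^{1/2}$ for all square-summable $\{a_l\}$, and (ii) $\mathrm{span}\{e_l\}$ is dense in $\mathcal{H}$. *)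

(* Defs.v *)
From HB Require Import structures.
From mathcomp Require Import all_boot all_order all_algebra.
From mathcomp Require Import finmap.
From mathcomp Require Import all_classical all_reals all_analysis.
From mathcomp Require Import complex.
Set Implicit Arguments.
Unset Strict Implicit.
Unset Printing Implicit Defensive.
Import Order.TTheory GRing.Theory Num.Theory.
Import numFieldNormedType.Exports.
Import ComplexField.Normc.
Local Open Scope classical_set_scope.
Local Open Scope ring_scope.

Section Complex_analysis.
Context {R : realType}.
Local Notation C := (complex R).
Local Notation mu := (@lebesgue_measure R).

Definition rpart (f : R -> C) : R -> R := fun x => complex.Re (f x).
Definition ipart (f : R -> C) : R -> R := fun x => complex.Im (f x).
Definition expi (x : R) : C := Complex (cos x) (sin x).

Definition cmeasurable (f : R -> C) : Prop :=
  measurable_fun setT (rpart f) /\ measurable_fun setT (ipart f).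

Definition cint (D : set R) (f : R -> C) : C :=
  Complex (\int[mu]_(x in D) rpart f x) (\int[mu]_(x in D) ipart f x).

Definition cderiven (k : nat) (f : R -> C) (x : R) : C :=
  Complex (derive1n k (rpart f) x) (derive1n k (ipart f) x).

Definition Cn_real (n : nat) (f : R -> R) : Prop :=
  (forall (k : nat) (x : R), (k < n)%N -> derivable (derive1n k f) x 1) /\
  continuous (derive1n n f).

Definition Cn (n : nat) (f : R -> C) : Prop :=
  Cn_real n (rpart f) /\ Cn_real n (ipart f).

(* C^n on an interval D that need not be open: the successive derivatives g i
   are taken within D, hence are one-sided at an endpoint belonging to D, and
   nothing is required at an endpoint outside D. *)
Definition Cn_real_on (D : set R) (n : nat) (f : R -> R) : Prop :=
  exists g : nat -> R -> R,
    [/\ forall x : R, D x -> g 0%N x = f x,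
        forall (i : nat) (x : R), (i < n)%N -> D x ->
          (fun y => (g i y - g i x) / (y - x)) @ within D (dnbhs x)
            --> g i.+1 x &
        {within D, continuous (g n)}].

Definition Cn_on (D : set R) (n : nat) (f : R -> C) : Prop :=
  Cn_real_on D n (rpart f) /\ Cn_real_on D n (ipart f).

(* f(t) = O(g(t)) as |t| -> oo *)
Definition bigO_infty (f : R -> C) (g : R -> R) : Prop :=
  exists M A : R, forall t : R, A <= `|t| -> normc (f t) <= M * g t.

(* The L^2 norm of a measurable function as an extended real; convergence in
   L^2 is always expressed with it, because [fine] sends +oo to 0. *)
Definition L2norme (f : R -> C) : \bar R :=
  Lnorm mu 2%:E (fun x => (normc (f x))%:E).

Definition L2diste (f g : R -> C) : \bar R := L2norme (fun x => f x - g x).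

Definition L2norm (f : R -> C) : R := fine (L2norme f).

Definition L2 (f : R -> C) : Prop := cmeasurable f /\ (L2norme f < +oo)%E.

Definition inner (f g : R -> C) : C := cint setT (fun t => f t * conjc (g t)).

Definition fourier_on (D : set R) (f : R -> C) (x : R) : C :=
  cint D (fun t => expi (- (x * t)) * f t).

(* Meaningful for integrable f. *)
Definition fourier (f : R -> C) : R -> C := fourier_on setT f.

(* g is the Fourier transform of f in the L^2 (Plancherel) sense. *)
Definition L2_fourier (f g : R -> C) : Prop :=
  [/\ L2 f, L2 g &
      (fun n : nat =>
         L2diste g (fourier_on `[- n%:R, n%:R] f))
        @ \oo --> 0%E].

(* The inverse is determined only up to a null set: one representative is
   chosen, and the zero function is used when there is none. *)
Definition inv_fourier (g : R -> C) : R -> C :=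
  xget (fun _ => 0) [set f | L2_fourier f g].

End Complex_analysis.

Section Bases.
Context {R : realType} {I : choiceType}.
Local Notation C := (complex R).

Definition sq_summable (a : I -> C) : Prop :=
  (\esum_(l in [set: I]) (normc (a l) ^+ 2)%:E < +oo)%E.

Definition l2norm (a : I -> C) : R :=
  Num.sqrt (fine (\esum_(l in [set: I]) (normc (a l) ^+ 2)%:E)%E).

Definition fin_comb (e : I -> R -> C) (a : I -> C) (F : {fset I}) : R -> C :=
  fun t => \sum_(l <- F) a l * e l t.

(* f = \sum_l a_l e_l, with unconditional convergence in L^2(R). *)
Definition has_L2sum (e : I -> R -> C) (a : I -> C) (f : R -> C) : Prop :=
  forall eps : R, 0 < eps -> exists F0 : {fset I}, forall F : {fset I},
    (F0 `<=` F)%fset ->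
    (L2diste f (fin_comb e a F) < eps%:E)%E.

Definition dense_span (e : I -> R -> C) : Prop :=
  forall f : R -> C, L2 f -> forall eps : R, 0 < eps ->
    exists (F : {fset I}) (a : I -> C),
      (L2diste f (fin_comb e a F) < eps%:E)%E.

Definition orthonormal_basis (e : I -> R -> C) : Prop :=
  [/\ forall l, L2 (e l),
      forall l m, inner (e l) (e m) = (l == m)%:R &
      dense_span e].

Definition riesz_basis (e : I -> R -> C) : Prop :=
  [/\ forall l, L2 (e l),
      exists C1 C2 : R, [/\ 0 < C1, C1 <= C2 &
        forall a : I -> C, sq_summable a ->
          exists f : R -> C,
            [/\ L2 f, has_L2sum e a f &
                C1 * l2norm a <= L2norm f <= C2 * l2norm a]] &
      dense_span e].

End Bases.

Section Wavelets.
Context {R : realType}.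
Local Notation C := (complex R).
Local Notation mu := (@lebesgue_measure R).

Definition dil (f : R -> C) (j : nat) (k : int) : R -> C :=
  fun t => (2 `^ (j%:R / 2))%:C%C * f (2 ^+ j * t - k%:~R).

Definition wavelet_system (phi psi : R -> C) (l : int + nat * int) : R -> C :=
  match l with
  | inl k => fun t => phi (t - k%:~R)
  | inr (j, k) => dil psi j k
  end.

Definition translates (Phi : R -> C) (eta : nat -> R -> C)
    (l : int + nat * int) : R -> C :=
  match l with
  | inl k => fun t => Phi (t - k%:~R)
  | inr (j, k) => fun t => eta j (t - 2 ^- j * k%:~R)
  end.

Definition trig_sum (u : int -> C) (m : nat) (x : R) : C :=
  \sum_(i < m.*2.+1)
     u (i%:Z - m%:Z) * expi (- ((i%:Z - m%:Z)%:~R * x)).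

(* uhat is a 2 pi-periodic representative of the sum \sum_n u_n e^{-inx}, which
   for u in l^2 converges in L^2 of a period. *)
Definition fourier_series (u : int -> C) (uhat : R -> C) : Prop :=
  [/\ cmeasurable uhat,
      forall x, uhat (x + 2 * pi) = uhat x &
      (fun m : nat => (\int[mu]_(x in `[(- pi)%R, pi])
           (normc (uhat x - trig_sum u m x)%R ^+ 2)%:E)%E) @ \oo --> 0%E].

Definition highpass (uhat : R -> C) : R -> C :=
  fun x => expi (- x) * conjc (uhat (x + pi)).

(* Identities between Fourier transforms of square-integrable objects hold
   almost everywhere. *)
Definition MRA (phi psi : R -> C) (u : int -> C) (uhat : R -> C) : Prop :=
  [/\ orthonormal_basis (wavelet_system phi psi),
      sq_summable u /\ fourier_series u uhat,
      {ae mu, forall x : R,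
         normc (uhat x) ^+ 2 + normc (uhat (x + pi)) ^+ 2 = 2},
      {ae mu, forall x : R, fourier phi x =
         (Num.sqrt 2)^-1%:C%C * uhat (x / 2) * fourier phi (x / 2)} &
      {ae mu, forall x : R, fourier psi x =
         (Num.sqrt 2)^-1%:C%C * highpass uhat (x / 2) * fourier phi (x / 2)}].

Definition congruent_to_period (K : set R) : Prop :=
  [/\ compact K, mu K = (2 * pi)%:E &
      forall x : R, - pi <= x <= pi ->
        exists l : int, K (x + 2 * l%:~R * pi)].

(* The function whose Fourier transform is h times that of f_{j,k}. *)
Definition filtered (h f : R -> C) (j : nat) (k : int) : R -> C :=
  inv_fourier (fun x => h x * fourier (dil f j k) x).

Definition dual_filter (h : R -> C) : R -> C := fun x => conjc (h x)^-1.

Definition normalized (f : R -> C) : R -> C :=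
  fun t => (L2norm f)^-1%:C%C * f t.

(* With h, these are Phi_j and eta_j; with [dual_filter h], Phi^j and eta^j. *)
Definition atom (h f : R -> C) (j : nat) : R -> C :=
  normalized (filtered h f j 0).

End Wavelets.

(* Main.v *)
Require Import Defs.
From HB Require Import structures.
From mathcomp Require Import all_boot all_order all_algebra.
From mathcomp Require Import finmap.
From mathcomp Require Import all_classical all_reals all_analysis.
From mathcomp Require Import complex.
From mathcomp Require Import measurable_realfun ring lra.
Set Implicit Arguments.
Unset Strict Implicit.
Unset Printing Implicit Defensive.
Import Order.TTheory GRing.Theory Num.Theory.
Import numFieldNormedType.Exports.
Import ComplexField.Normc.
Local Open Scope classical_set_scope.
Local Open Scope ring_scope.

(** The proof takes place on the frequency side, where multiplying by [h1] and [h2] is a pointwise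
    operation.  The transforms of the functions [phi_(0,k)] and [psi_(j,k)] are orthogonal with
    squared norm [2 pi] and their span is dense.  Let [G] be this family after multiplication by
    [h1] on the low-pass functions and by [h2] on the wavelets, and [D] the family obtained in the
    same way from the inverse conjugate filters.  Up to normalization the inverse transforms of [G]
    and [D] are the two families of the theorem.

    Two biorthogonal families of dense span that both satisfy an upper bound
    [|\sum_l a_l G_l|^2 <= B \sum_l om_l^2 |a_l|^2] (with the inverse weights for [D]) become Riesz
    bases once normalized: testing a combination of [G] against a combination of [D] turns the upper
    bound of one family into the lower bound of the other, and also shows that the norm of [G_l] is
    comparable to [om_l] ([riesz_of_dual_systems]).  Here [om_l] is 1 on the low-pass functions and
    [2^(-jd)] at scale [j].

    The upper bound ([filtered_system_synthesis]) is a bound of sizes.  At scale [j] the combination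
    is a dilate of [P_j th_j], with [P_j] a trigonometric polynomial and
    [th_j y = 2^(jd) h2 (2^j y) fourier psi y].  The vanishing moments and the hypotheses on [h2] near
    the origin, the decay of [fourier psi] and the size of [h2] away from it, give a bound of [th_j]
    by a constant times [min (y^2) (y^-2)] that does not depend on [j] ([dominated_of_bounds]).  The
    values [th_j (2^-j x)] are then summable over [j], uniformly in [x], so that a weighted
    Cauchy-Schwarz inequality separates the scales.  At each scale a periodic function is integrated
    against a weight with bounded periodization, which costs at most a constant times its norm on one
    period ([periodic_weight]).

    Biorthogonality is obvious inside each group of indices.  Across the groups it rests on the
    periodicity of [h2 / h1]: multiplying the low-pass functions by a bounded periodic function
    keeps them in their closed span, because trigonometric polynomials are dense on a period
    ([periodic_multiplier]), and that span is orthogonal to the wavelets.  For density the same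
    remark reduces the problem to the family filtered by [h2] at all frequencies.  There the
    orthogonal expansion of [f / h2], for [f] of bounded support, is multiplied by [h2]; the upper
    bounds for [D] and for [G] make it converge in norm, and its limit is [f]
    ([dense_filtered_same]).

    The Fourier transform on L2 is built from the Poisson kernel: Plancherel's identity is proved for
    bounded continuous functions by Abel summation, extended by approximation to the intersection
    of L1 and L2, and then to L2 by completeness.  The density of trigonometric polynomials follows
    from it: averaging over [x] the squared samples of a transform at the points [x + k] gives its
    whole norm, so that Parseval's identity on a period holds up to an arbitrarily small error for
    arbitrarily small modulations. *)

(** * Complex numbers and complex-valued measurable functions *)

Section Complex_numbers.
Context {R : realType}.
Local Notation C := (complex R).
Implicit Types (z w : C) (x y : R).

(** The squared modulus is used instead of [normc], because it avoids square roots and is polynomial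
    in the real and imaginary parts. *)
Definition nsq z : R := complex.Re z ^+ 2 + complex.Im z ^+ 2.

Lemma nsq_ge0 z : 0 <= nsq z.
Proof. by rewrite addr_ge0 ?sqr_ge0. Qed.

Lemma normcE z : normc z = Num.sqrt (nsq z).
Proof. by case: z. Qed.

Lemma normc_ge0 z : 0 <= normc z.
Proof. by rewrite normcE sqrtr_ge0. Qed.

Lemma normc_sqr z : normc z ^+ 2 = nsq z.
Proof. by rewrite normcE sqr_sqrtr ?nsq_ge0. Qed.

Lemma nsq0 : nsq 0 = 0.
Proof. by rewrite /nsq /= expr0n/= addr0. Qed.

Lemma nsqM z w : nsq (z * w) = nsq z * nsq w.
Proof. by case: z w => [a b] [c d]; rewrite /nsq /=; ring. Qed.

Lemma nsqN z : nsq (- z) = nsq z.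
Proof. by case: z => a b; rewrite /nsq /=; ring. Qed.

Lemma nsq_conj z : nsq (conjc z) = nsq z.
Proof. by case: z => a b; rewrite /nsq /=; ring. Qed.

Lemma nsq_real x : nsq x%:C%C = x ^+ 2.
Proof. by rewrite /nsq /= expr0n addr0. Qed.

Lemma nsq_expi x : nsq (expi x) = 1.
Proof. by rewrite /nsq /= cos2Dsin2. Qed.

Lemma normc_expi x : normc (expi x) = 1.
Proof. by rewrite normcE nsq_expi sqrtr1. Qed.

Lemma nsqD z w : nsq (z + w) <= 2 * nsq z + 2 * nsq w.
Proof.
case: z w => [a b] [c d]; rewrite /nsq /= -subr_ge0.
rewrite (_ : _ - _ = (a - c) ^+ 2 + (b - d) ^+ 2); last by ring.
by rewrite addr_ge0 ?sqr_ge0.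
Qed.

Lemma conjcM z w : conjc (z * w) = conjc z * conjc w.
Proof. exact: rmorphM. Qed.

Lemma conjcD z w : conjc (z + w) = conjc z + conjc w.
Proof. exact: rmorphD. Qed.

Lemma mul_conjc z : z * conjc z = (nsq z)%:C%C.
Proof. by case: z => a b; rewrite /nsq /=; apply/eqP; rewrite eq_complex /=; apply/andP; split; apply/eqP; ring. Qed.

Lemma nsq_eq0 z : nsq z = 0 -> z = 0.
Proof. by move=> h; apply: eq0_normc; rewrite normcE h sqrtr0. Qed.

Lemma nsq_gt0 z : z != 0 -> 0 < nsq z.
Proof. by move=> z0; rewrite lt_def nsq_ge0 andbT; apply: contra z0 => /eqP/nsq_eq0 ->. Qed.

Lemma expiD x y : expi (x + y) = expi x * expi y.
Proof. by rewrite /expi cosD sinD; apply/eqP; rewrite eq_complex /=; apply/andP; split; apply/eqP; ring. Qed.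

Lemma expi0 : expi 0 = 1 :> C.
Proof. by rewrite /expi cos0 sin0. Qed.

Lemma conj_expi x : conjc (expi x) = expi (- x).
Proof. by rewrite /expi /= cosN sinN. Qed.

Lemma normr_Re z : `|complex.Re z| <= normc z.
Proof. by rewrite normcE -sqrtr_sqr ler_wsqrtr// lerDl sqr_ge0. Qed.

Lemma normr_Im z : `|complex.Im z| <= normc z.
Proof. by rewrite normcE -sqrtr_sqr ler_wsqrtr// lerDr sqr_ge0. Qed.

Lemma normc_le_ReIm z : normc z <= `|complex.Re z| + `|complex.Im z|.
Proof.
rewrite normcE -[leRHS]ger0_norm ?addr_ge0// -sqrtr_sqr ler_wsqrtr//.
by rewrite sqrrD /nsq !real_normK ?num_real// -addrA lerD2l lerDr mulrn_wge0// mulr_ge0.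
Qed.

Lemma normc_real x : normc x%:C%C = `|x|.
Proof. by rewrite normcE nsq_real sqrtr_sqr. Qed.

Lemma normc_conj z : normc (conjc z) = normc z.
Proof. by rewrite !normcE nsq_conj. Qed.

Lemma ReM_real x z : complex.Re (x%:C%C * z) = x * complex.Re z.
Proof. by case: z => a b /=; rewrite mul0r subr0. Qed.

Lemma ImM_real x z : complex.Im (x%:C%C * z) = x * complex.Im z.
Proof. by case: z => a b /=; rewrite mul0r addr0. Qed.

Lemma complexE z : z = Complex (complex.Re z) (complex.Im z).
Proof. by case: z. Qed.

Lemma ReD z w : complex.Re (z + w) = complex.Re z + complex.Re w.
Proof. by case: z w => [a b] [c d]. Qed.
Lemma ImD z w : complex.Im (z + w) = complex.Im z + complex.Im w.
Proof. by case: z w => [a b] [c d]. Qed.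
Lemma ReM z w : complex.Re (z * w) = complex.Re z * complex.Re w - complex.Im z * complex.Im w.
Proof. by case: z w => [a b] [c d]. Qed.
Lemma ImM z w : complex.Im (z * w) = complex.Re z * complex.Im w + complex.Im z * complex.Re w.
Proof. by case: z w => [a b] [c d]. Qed.
Lemma ReN z : complex.Re (- z) = - complex.Re z.
Proof. by case: z. Qed.
Lemma ImN z : complex.Im (- z) = - complex.Im z.
Proof. by case: z. Qed.
Lemma ReR x : complex.Re x%:C%C = x.
Proof. by []. Qed.
Lemma ReC z : complex.Re (conjc z) = complex.Re z.
Proof. by case: z. Qed.
Lemma ImC z : complex.Im (conjc z) = - complex.Im z.
Proof. by case: z. Qed.

Lemma eq_ReIm z w : complex.Re z = complex.Re w -> complex.Im z = complex.Im w -> z = w.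
Proof. by case: z w => [a b] [c d] /= -> ->. Qed.

End Complex_numbers.

Section Complex_measurability.
Context {R : realType}.
Local Notation C := (complex R).
Local Notation mu := (@lebesgue_measure R).
Implicit Types (f g : R -> C).

Lemma cmeas_add f g : cmeasurable f -> cmeasurable g -> cmeasurable (fun x => f x + g x).
Proof.
move=> [f1 f2] [g1 g2]; split.
- by rewrite (_ : rpart _ = rpart f \+ rpart g)//; [exact: measurable_funD|apply/funext=> x; rewrite /rpart ReD].
- by rewrite (_ : ipart _ = ipart f \+ ipart g)//; [exact: measurable_funD|apply/funext=> x; rewrite /ipart ImD].
Qed.

Lemma cmeas_mul f g : cmeasurable f -> cmeasurable g -> cmeasurable (fun x => f x * g x).
Proof.
move=> [f1 f2] [g1 g2]; split.
- rewrite (_ : rpart _ = (rpart f \* rpart g) \- (ipart f \* ipart g)).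
    by apply: measurable_funB; apply: measurable_funM.
  by apply/funext=> x; rewrite /rpart ReM.
- rewrite (_ : ipart _ = (rpart f \* ipart g) \+ (ipart f \* rpart g)).
    by apply: measurable_funD; apply: measurable_funM.
  by apply/funext=> x; rewrite /ipart ImM.
Qed.

Lemma cmeas_conj f : cmeasurable f -> cmeasurable (fun x => conjc (f x)).
Proof.
move=> [f1 f2]; split.
- by rewrite (_ : rpart _ = rpart f)//; apply/funext=> x; rewrite /rpart ReC.
- rewrite (_ : ipart _ = (fun x => - ipart f x)); first exact: measurable_funN.
  by apply/funext=> x; rewrite /ipart ImC.
Qed.

Lemma cmeas_cst (c : C) : cmeasurable (fun _ => c).
Proof. by split; exact: measurable_cst. Qed.

Lemma cmeas_real (h : R -> R) : measurable_fun setT h -> cmeasurable (fun x => (h x)%:C%C).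
Proof. by move=> mh; split => //; exact: measurable_cst. Qed.

Lemma cmeas_expi (h : R -> R) : measurable_fun setT h -> cmeasurable (fun x => expi (h x)).
Proof.
move=> mh; split; apply: measurableT_comp => //; apply: continuous_measurable_fun.
- exact: continuous_cos.
- exact: continuous_sin.
Qed.

Lemma cmeas_comp f (h : R -> R) : measurable_fun setT h -> cmeasurable f ->
  cmeasurable (fun x => f (h x)).
Proof.
move=> mh [f1 f2]; split.
- by rewrite (_ : rpart _ = rpart f \o h)//; exact: measurableT_comp.
- by rewrite (_ : ipart _ = ipart f \o h)//; exact: measurableT_comp.
Qed.

Lemma cmeas_opp f : cmeasurable f -> cmeasurable (fun x => - f x).
Proof.
move=> mf; rewrite (_ : (fun x => _) = (fun x => (-1) * f x)).
  exact: cmeas_mul (cmeas_cst _) mf.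
by apply/funext => x; rewrite mulN1r.
Qed.

Lemma cmeas_sub f g : cmeasurable f -> cmeasurable g -> cmeasurable (fun x => f x - g x).
Proof. by move=> mf mg; apply: cmeas_add => //; apply: cmeas_opp. Qed.

Lemma cmeas_sum (I : Type) (s : seq I) (F : I -> R -> C) :
  (forall i, cmeasurable (F i)) -> cmeasurable (fun x => \sum_(i <- s) F i x).
Proof.
move=> mF; elim: s => [|i s IH].
  by under eq_fun do rewrite big_nil; exact: cmeas_cst.
by under eq_fun do rewrite big_cons; exact: cmeas_add.
Qed.

Lemma measurable_nsq f : cmeasurable f -> measurable_fun setT (fun x => nsq (f x)).
Proof.
by move=> [f1 f2]; apply: measurable_funD; apply: measurable_funX.
Qed.

Lemma measurable_normc f : cmeasurable f -> measurable_fun setT (fun x => normc (f x)).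
Proof.
move=> mf; rewrite (_ : (fun _ => _) = (fun x => nsq (f x) `^ (2^-1))).
  by apply: (@measurableT_comp _ _ _ _ _ _ (fun x : R => x `^ _)); [exact: measurable_powR|exact: measurable_nsq].
by apply/funext => x; rewrite normcE -powR12_sqrt ?nsq_ge0.
Qed.

Lemma cmeas_inv f : cmeasurable f -> cmeasurable (fun x => (f x)^-1).
Proof.
move=> mf; rewrite (_ : (fun _ => _) = (fun x => conjc (f x) * ((nsq (f x)) `^ (-1))%:C%C)).
  apply: cmeas_mul; first exact: cmeas_conj.
  apply: cmeas_real.
  by apply: (@measurableT_comp _ _ _ _ _ _ (fun x : R => x `^ _)); [exact: measurable_powR|exact: measurable_nsq].
apply/funext => x; rewrite powR_inv1 ?nsq_ge0//.
have [->|f0] := eqVneq (f x) 0; first by rewrite invr0 conjc0 mul0r.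
apply: (mulfI f0); rewrite mulfV// mulrA mul_conjc -rmorphM/= mulfV//.
by rewrite gt_eqF// nsq_gt0.
Qed.

End Complex_measurability.

(** * Complex integrals and the space L2 *)

Section Complex_integral.
Context {R : realType}.
Local Notation C := (complex R).
Local Notation mu := (@lebesgue_measure R).
Implicit Types (f g : R -> C) (p q : R -> R).

Definition rintegrable p := mu.-integrable setT (EFin \o p).
Definition cintegrable f := rintegrable (rpart f) /\ rintegrable (ipart f).

Lemma rintegrable_meas p : rintegrable p -> measurable_fun setT p.
Proof. by move=> /integrableP[/measurable_EFinP]. Qed.

Lemma rintegrable_le p q : measurable_fun setT p ->
  (forall x, `|p x| <= q x) -> rintegrable q -> rintegrable p.
Proof.
move=> mp pq iq; apply: (le_integrable _ _ _ iq) => //; first exact/measurable_EFinP.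
by move=> x _ /=; rewrite lee_fin (le_trans (pq x))// ler_norm.
Qed.

Lemma rintegrableD p q : rintegrable p -> rintegrable q -> rintegrable (fun x => p x + q x).
Proof. by move=> ip iq; exact: (integrableD measurableT ip iq). Qed.

Lemma rintegrableZ (k : R) p : rintegrable p -> rintegrable (fun x => k * p x).
Proof. by move=> ip; exact: (integrableZl measurableT k ip). Qed.

Lemma rintegrableN p : rintegrable p -> rintegrable (fun x => - p x).
Proof. by move=> ip; exact: (integrableN ip). Qed.

Lemma rintegrableB p q : rintegrable p -> rintegrable q -> rintegrable (fun x => p x - q x).
Proof. by move=> ip iq; apply: rintegrableD => //; exact: rintegrableN. Qed.

Lemma rintegrable_abs p : rintegrable p -> rintegrable (fun x => `|p x|).
Proof. by move=> ip; exact: (integrable_abse ip). Qed.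

Lemma ge0_rintegrable p : measurable_fun setT p -> (forall x, 0 <= p x) ->
  (\int[mu]_x (p x)%:E < +oo)%E -> rintegrable p.
Proof.
move=> mp p0 fin; apply/integrableP; split; first exact/measurable_EFinP.
by under eq_integral do rewrite /= ger0_norm//.
Qed.

Lemma EFin_Rint p : rintegrable p -> (\int[mu]_x p x)%:E = (\int[mu]_x (p x)%:E)%E.
Proof. by move=> ip; rewrite fineK//; exact: (integrable_fin_num _ ip). Qed.

Lemma RintZ (k : R) p : rintegrable p -> \int[mu]_x (k * p x) = k * \int[mu]_x p x.
Proof. by move=> ip; rewrite RintegralZl. Qed.

Lemma RintD p q : rintegrable p -> rintegrable q ->
  \int[mu]_x (p x + q x) = \int[mu]_x p x + \int[mu]_x q x.
Proof. by move=> ip iq; rewrite RintegralD. Qed.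

Lemma RintB p q : rintegrable p -> rintegrable q ->
  \int[mu]_x (p x - q x) = \int[mu]_x p x - \int[mu]_x q x.
Proof. by move=> ip iq; rewrite RintegralB. Qed.

Lemma RintN p : rintegrable p -> \int[mu]_x (- p x) = - \int[mu]_x p x.
Proof. by move=> ip; under eq_Rintegral do rewrite -mulN1r; rewrite RintZ// mulN1r. Qed.

Lemma le_Rint p q : rintegrable p -> rintegrable q -> (forall x, p x <= q x) ->
  \int[mu]_x p x <= \int[mu]_x q x.
Proof. by move=> ip iq pq; apply: le_Rintegral => // x _. Qed.

Lemma Rint_ge0 p : (forall x, 0 <= p x) -> 0 <= \int[mu]_x p x.
Proof. by move=> p0; apply: Rintegral_ge0. Qed.

Lemma cintegrable_meas f : cintegrable f -> cmeasurable f.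
Proof. by move=> [/rintegrable_meas f1 /rintegrable_meas f2]. Qed.

Lemma cintegrable_le f q : cmeasurable f -> (forall x, normc (f x) <= q x) ->
  rintegrable q -> cintegrable f.
Proof.
move=> [f1 f2] fq iq; split; apply: rintegrable_le iq => // x.
- exact: le_trans (normr_Re _) (fq x).
- exact: le_trans (normr_Im _) (fq x).
Qed.

Lemma cintegrable_norm f : cintegrable f -> rintegrable (fun x => normc (f x)).
Proof.
move=> cf; have [i1 i2] := cf.
apply: rintegrable_le (rintegrableD (rintegrable_abs i1) (rintegrable_abs i2)).
  exact: measurable_normc (cintegrable_meas cf).
by move=> x; rewrite ger0_norm ?normc_ge0// normc_le_ReIm.
Qed.

Lemma cintegrableD f g : cintegrable f -> cintegrable g -> cintegrable (fun x => f x + g x).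
Proof.
move=> cf cg; apply: cintegrable_le (rintegrableD (cintegrable_norm cf) (cintegrable_norm cg)).
  by apply: cmeas_add; exact: cintegrable_meas.
by move=> x; exact: le_normcD.
Qed.

Lemma cintegrableM f (b : R -> C) (M : R) : cmeasurable b -> (forall x, normc (b x) <= M) ->
  cintegrable f -> cintegrable (fun x => b x * f x).
Proof.
move=> mb bM cf; apply: cintegrable_le (rintegrableZ M (cintegrable_norm cf)).
  by apply: cmeas_mul => //; exact: cintegrable_meas.
by move=> x; rewrite normcM ler_wpM2r ?normc_ge0.
Qed.

Lemma cintegrableZ f (c : C) : cintegrable f -> cintegrable (fun x => c * f x).
Proof. by apply: (@cintegrableM f (fun _ => c) (normc c)) => //; exact: cmeas_cst. Qed.

Lemma cintegrable_conj f : cintegrable f -> cintegrable (fun x => conjc (f x)).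
Proof.
move=> cf; apply: cintegrable_le (cintegrable_norm cf).
  by apply: cmeas_conj; exact: cintegrable_meas.
by move=> x; rewrite normc_conj.
Qed.

Lemma cintegrable0 : cintegrable (fun _ => 0).
Proof. by split; exact: integrable0. Qed.

Lemma cintegrable_sum (I : Type) (s : seq I) (F : I -> R -> C) :
  (forall i, cintegrable (F i)) -> cintegrable (fun x => \sum_(i <- s) F i x).
Proof.
move=> iF; elim: s => [|i s IH].
  by under eq_fun do rewrite big_nil; exact: cintegrable0.
by under eq_fun do rewrite big_cons; exact: cintegrableD.
Qed.

Lemma eq_cint (D : set R) f g : (forall x, f x = g x) -> cint D f = cint D g.
Proof. by move=> fg; congr cint; apply/funext. Qed.

Lemma cintD f g : cintegrable f -> cintegrable g ->
  cint setT (fun x => f x + g x) = cint setT f + cint setT g.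
Proof.
move=> [f1 f2] [g1 g2]; apply: eq_ReIm => /=; rewrite -RintD//.
- by apply: eq_Rintegral => x _; rewrite /rpart ReD.
- by apply: eq_Rintegral => x _; rewrite /ipart ImD.
Qed.

Lemma cintZ f (c : C) : cintegrable f -> cint setT (fun x => c * f x) = c * cint setT f.
Proof.
move=> [f1 f2]; apply: eq_ReIm; rewrite ?ReM ?ImM /=.
- rewrite -!RintZ// -RintB; [|exact: rintegrableZ|exact: rintegrableZ].
  by apply: eq_Rintegral => x _; rewrite /rpart ReM.
- rewrite -!RintZ// -RintD; [|exact: rintegrableZ|exact: rintegrableZ].
  by apply: eq_Rintegral => x _; rewrite /ipart ImM.
Qed.

Lemma cint0 : cint setT (fun _ : R => 0 : C) = 0.
Proof. by apply/eq_ReIm; rewrite /= /Rintegral integral0. Qed.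

Lemma cint_sum (I : Type) (s : seq I) (F : I -> R -> C) :
  (forall i, cintegrable (F i)) ->
  cint setT (fun x => \sum_(i <- s) F i x) = \sum_(i <- s) cint setT (F i).
Proof.
move=> iF; elim: s => [|i s IH].
  by rewrite big_nil; under eq_cint do rewrite big_nil; exact: cint0.
rewrite big_cons -IH -cintD//; last exact: cintegrable_sum.
by apply: eq_cint => x; rewrite big_cons.
Qed.

Lemma cint_conj f : cintegrable f -> cint setT (fun x => conjc (f x)) = conjc (cint setT f).
Proof.
move=> [f1 f2]; apply: eq_ReIm => /=.
- by apply: eq_Rintegral => x _; rewrite /rpart ReC.
- by rewrite -RintN//; apply: eq_Rintegral => x _; rewrite /ipart ImC.
Qed.

(** Bounding the real and imaginary parts separately costs a factor 2 but needs no choice of phase.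
    *)
Lemma cint_le f q : cintegrable f -> rintegrable q -> (forall x, normc (f x) <= q x) ->
  normc (cint setT f) <= 2 * \int[mu]_x q x.
Proof.
move=> [f1 f2] iq fq; rewrite (le_trans (normc_le_ReIm _))//= mulr2n mulrDl !mul1r.
apply: lerD; (rewrite (le_trans (le_normr_Rintegral _ _))//; last first).
- apply: le_Rint => //; [exact: rintegrable_abs|move=> x].
  exact: le_trans (normr_Re _) (fq x).
- apply: le_Rint => //; [exact: rintegrable_abs|move=> x].
  exact: le_trans (normr_Im _) (fq x).
Qed.

End Complex_integral.

Section L2_space.
Context {R : realType}.
Local Notation C := (complex R).
Local Notation mu := (@lebesgue_measure R).
Implicit Types (f g h : R -> C) (p q : R -> R).

Definition n2 f : R := \int[mu]_x nsq (f x).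

Lemma n2_ge0 f : 0 <= n2 f.
Proof. by apply: Rint_ge0 => x; exact: nsq_ge0. Qed.

Lemma L2normeE f : L2norme f = sqrte (\int[mu]_x (nsq (f x))%:E)%E.
Proof.
rewrite /L2norme unlock poweR12_sqrt; last first.
  by apply: integral_ge0 => x _; exact: poweR_ge0.
congr sqrte; apply: eq_integral => x _.
by rewrite /= ger0_norm ?normc_ge0// powR_mulrn ?normc_ge0// normc_sqr.
Qed.

Lemma L2P f : L2 f <-> cmeasurable f /\ rintegrable (fun x => nsq (f x)).
Proof.
have i0 : (0 <= \int[mu]_x (nsq (f x))%:E)%E by apply: integral_ge0 => x _; rewrite lee_fin nsq_ge0.
split => -[mf h]; split => //.
  apply: ge0_rintegrable; [exact: measurable_nsq|by move=> x; exact: nsq_ge0|].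
  move: h; rewrite L2normeE; case: (\int[mu]_x _)%E i0 => //= r _ _; by rewrite ltry.
by rewrite L2normeE -EFin_Rint//= ltry.
Qed.

Lemma L2normE f : L2 f -> L2norm f = Num.sqrt (n2 f).
Proof. by move=> /L2P[mf h]; rewrite /L2norm L2normeE -EFin_Rint. Qed.

Lemma L2normeE_fin f : L2 f -> L2norme f = (Num.sqrt (n2 f))%:E.
Proof. by move=> /L2P[mf h]; rewrite L2normeE -EFin_Rint. Qed.

Lemma n2E f : L2 f -> (\int[mu]_x (nsq (f x))%:E)%E = (n2 f)%:E.
Proof. by move=> /L2P[mf h]; rewrite EFin_Rint. Qed.

Lemma L2_meas f : L2 f -> cmeasurable f.
Proof. by case. Qed.

Lemma L2_int f : L2 f -> rintegrable (fun x => nsq (f x)).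
Proof. by move=> /L2P[]. Qed.

Lemma L2_le f q : cmeasurable f -> rintegrable q -> (forall x, nsq (f x) <= q x) -> L2 f.
Proof.
move=> mf iq fq; apply/L2P; split => //; apply: rintegrable_le iq; first exact: measurable_nsq.
by move=> x; rewrite ger0_norm ?nsq_ge0.
Qed.

Lemma L2_fin f : cmeasurable f -> (\int[mu]_x (nsq (f x))%:E < +oo)%E -> L2 f.
Proof.
move=> mf fin; apply/L2P; split => //.
by apply: ge0_rintegrable; [exact: measurable_nsq|by move=> x; exact: nsq_ge0|].
Qed.

Lemma n2_le f q : rintegrable q -> L2 f -> (forall x, nsq (f x) <= q x) -> n2 f <= \int[mu]_x q x.
Proof. by move=> iq /L2_int lf fq; exact: le_Rint. Qed.

Lemma L2D f g : L2 f -> L2 g -> L2 (fun x => f x + g x).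
Proof.
move=> /L2P[mf lf] /L2P[mg lg].
apply: (L2_le (cmeas_add mf mg) (rintegrableD (rintegrableZ 2 lf) (rintegrableZ 2 lg))) => x.
exact: nsqD.
Qed.

Lemma L2M f (b : R -> C) (M : R) : cmeasurable b -> (forall x, nsq (b x) <= M) ->
  L2 f -> L2 (fun x => b x * f x).
Proof.
move=> mb bM /L2P[mf lf]; apply: (L2_le (cmeas_mul mb mf) (rintegrableZ M lf)) => x.
by rewrite nsqM ler_wpM2r ?nsq_ge0.
Qed.

Lemma n2M f (b : R -> C) (M : R) : cmeasurable b -> (forall x, nsq (b x) <= M) ->
  L2 f -> n2 (fun x => b x * f x) <= M * n2 f.
Proof.
move=> mb bM lf; rewrite -RintZ; last exact: L2_int.
apply: n2_le; [exact/rintegrableZ/L2_int|exact: L2M bM lf|move=> x].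
by rewrite nsqM ler_wpM2r ?nsq_ge0.
Qed.

Lemma L2Z (c : C) f : L2 f -> L2 (fun x => c * f x).
Proof. by apply: (@L2M f (fun _ => c) (nsq c)) => //; exact: cmeas_cst. Qed.

Lemma n2Z (c : C) f : L2 f -> n2 (fun x => c * f x) = nsq c * n2 f.
Proof.
by move=> lf; rewrite -RintZ ?(L2_int lf)//; apply: eq_Rintegral => x _; rewrite nsqM.
Qed.

Lemma L20 : L2 (fun _ => 0 : C).
Proof.
apply/L2P; split; first exact: cmeas_cst.
by under eq_fun do rewrite nsq0; exact: integrable0.
Qed.

Lemma n20 : n2 (fun _ => 0 : C) = 0.
Proof. by rewrite /n2 /Rintegral; under eq_integral do rewrite nsq0; rewrite integral0. Qed.

Lemma L2N f : L2 f -> L2 (fun x => - f x).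
Proof.
move=> lf; rewrite (_ : (fun x => _) = (fun x => (-1) * f x)); first exact: L2Z.
by apply/funext => x; rewrite mulN1r.
Qed.

Lemma L2B f g : L2 f -> L2 g -> L2 (fun x => f x - g x).
Proof. by move=> lf lg; apply: L2D => //; apply: L2N. Qed.

Lemma L2_sum (I : Type) (s : seq I) (F : I -> R -> C) :
  (forall i, L2 (F i)) -> L2 (fun x => \sum_(i <- s) F i x).
Proof.
move=> lF; elim: s => [|i s IH].
  by under eq_fun do rewrite big_nil; exact: L20.
by under eq_fun do rewrite big_cons; exact: L2D.
Qed.

Lemma L2_cintegrable f g : L2 f -> L2 g -> cintegrable (fun x => f x * conjc (g x)).
Proof.
move=> /L2P[mf lf] /L2P[mg lg].
apply: (cintegrable_le _ _ (rintegrableD lf lg)).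
  by apply: cmeas_mul => //; exact: cmeas_conj.
move=> x; rewrite normcM normc_conj -!normc_sqr -subr_ge0.
set a := normc (f x); set b := normc (g x).
have a0 : 0 <= a by exact: normc_ge0.
have b0 : 0 <= b by exact: normc_ge0.
by have := sqr_ge0 (a - b); have := mulr_ge0 a0 b0; nra.
Qed.

Lemma innerE f g : inner f g = cint setT (fun t => f t * conjc (g t)).
Proof. by []. Qed.

Lemma n2I f : n2 f = \int[mu]_x nsq (f x).
Proof. by []. Qed.

Lemma innerDl f g h : L2 f -> L2 g -> L2 h ->
  inner (fun x => f x + g x) h = inner f h + inner g h.
Proof.
move=> lf lg lh; rewrite /inner -cintD; [|exact: L2_cintegrable|exact: L2_cintegrable].
by apply: eq_cint => x; rewrite mulrDl.
Qed.

Lemma innerZl (c : C) f g : L2 f -> L2 g -> inner (fun x => c * f x) g = c * inner f g.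
Proof.
move=> lf lg; rewrite /inner -cintZ; last exact: L2_cintegrable.
by apply: eq_cint => x; rewrite mulrA.
Qed.

Lemma inner_conj f g : L2 f -> L2 g -> inner g f = conjc (inner f g).
Proof.
move=> lf lg; rewrite /inner -cint_conj; last exact: L2_cintegrable.
by apply: eq_cint => x; rewrite conjcM conjcK mulrC.
Qed.

Lemma innerDr f g h : L2 f -> L2 g -> L2 h ->
  inner h (fun x => f x + g x) = inner h f + inner h g.
Proof.
move=> lf lg lh; by rewrite (inner_conj (L2D lf lg) lh) innerDl// conjcD -(inner_conj lf lh) -(inner_conj lg lh).
Qed.

Lemma innerZr (c : C) f g : L2 f -> L2 g -> inner g (fun x => c * f x) = conjc c * inner g f.
Proof.
move=> lf lg; by rewrite (inner_conj (L2Z c lf) lg) innerZl// conjcM -(inner_conj lf lg).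
Qed.

Lemma inner_suml (I : Type) (s : seq I) (F : I -> R -> C) g :
  (forall i, L2 (F i)) -> L2 g ->
  inner (fun x => \sum_(i <- s) F i x) g = \sum_(i <- s) inner (F i) g.
Proof.
move=> lF lg; rewrite /inner -cint_sum; last by move=> i; exact: L2_cintegrable.
by apply: eq_cint => x; rewrite mulr_suml.
Qed.

Lemma inner_sumr (I : Type) (s : seq I) (F : I -> R -> C) g :
  (forall i, L2 (F i)) -> L2 g ->
  inner g (fun x => \sum_(i <- s) F i x) = \sum_(i <- s) inner g (F i).
Proof.
move=> lF lg; rewrite (inner_conj (L2_sum s lF) lg).
by rewrite inner_suml// (big_morph _ conjcD (conjc0 R)); apply: eq_bigr => i _; rewrite -(inner_conj (lF i) lg).
Qed.

Lemma inner_n2 f : L2 f -> inner f f = (n2 f)%:C%C.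
Proof.
move=> lf; rewrite /inner; under eq_cint do rewrite mul_conjc.
by apply: eq_ReIm => //=; rewrite /Rintegral integral0.
Qed.

Opaque inner n2.

Lemma inner_sym_Re f g : L2 f -> L2 g -> complex.Re (inner g f) = complex.Re (inner f g).
Proof. by move=> lf lg; rewrite (inner_conj lf lg) ReC. Qed.

Lemma n2D f g : L2 f -> L2 g ->
  n2 (fun x => f x + g x) = n2 f + n2 g + 2 * complex.Re (inner f g).
Proof.
move=> lf lg; have lfg := L2D lf lg.
have := inner_n2 lfg; rewrite innerDl// !innerDr// !inner_n2//.
move=> /(congr1 (@complex.Re R)); rewrite !ReD (inner_sym_Re lf lg) (ReR (n2 f)) (ReR (n2 g)) (ReR (n2 _)) => <-.
by move: (complex.Re _) (n2 f) (n2 g) => a b c; ring.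
Qed.

Lemma n2N f : n2 (fun x => - f x) = n2 f.
Proof. by rewrite !n2I; apply: eq_Rintegral => x _; rewrite nsqN. Qed.

Lemma innerNr f g : L2 f -> L2 g -> inner f (fun x => - g x) = - inner f g.
Proof.
move=> lf lg; rewrite (_ : (fun x => _) = (fun x => (-1) * g x)).
  by rewrite innerZr// rmorphN1 mulN1r.
by apply/funext => x; rewrite mulN1r.
Qed.

Lemma n2B f g : L2 f -> L2 g ->
  n2 (fun x => f x - g x) = n2 f + n2 g - 2 * complex.Re (inner f g).
Proof. by move=> lf lg; rewrite n2D// ?n2N ?innerNr ?ReN ?mulrN//; exact: L2N. Qed.

Lemma n2_sub_sym f g : n2 (fun x => f x - g x) = n2 (fun x => g x - f x).
Proof. by rewrite !n2I; apply: eq_Rintegral => x _; rewrite -nsqN opprB. Qed.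

Lemma n2_Zreal (c : R) f : L2 f -> n2 (fun x => c%:C%C * f x) = c ^+ 2 * n2 f.
Proof. by move=> lf; rewrite n2Z// nsq_real. Qed.

(** Cauchy-Schwarz, read off the nonnegative quadratic function of [s] given by the squared norm of
    [f - s <f, g> g]. *)
Lemma nsq_inner f g : L2 f -> L2 g -> nsq (inner f g) <= n2 f * n2 g.
Proof.
move=> lf lg; set c := inner f g.
have key (s : R) : 0 <= n2 f + s ^+ 2 * (nsq c * n2 g) - 2 * (s * nsq c).
  have := n2_ge0 (fun x => f x - s%:C%C * c * g x).
  rewrite n2B//; last exact: L2Z.
  have -> : complex.Re (inner f (fun x => s%:C%C * c * g x)) = s * nsq c.
    by rewrite innerZr// -/c conjcM conjc_real -mulrA ReM_real mulrC [X in complex.Re X]mulrC mul_conjc ReR mulrC.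
  rewrite n2Z// nsqM nsq_real => h.
  by rewrite mulrA.
have c0 := nsq_ge0 c; have f0 := n2_ge0 f; have g0 := n2_ge0 g.
have [->|cn0] := eqVneq (nsq c) 0; first by rewrite mulr_ge0.
have cp : 0 < nsq c by rewrite lt_def cn0.
have [g00|gn0] := eqVneq (n2 g) 0.
  have := key ((n2 f + 1) / (2 * nsq c)); rewrite g00 mulr0 mulr0 addr0.
  rewrite (_ : 2 * _ = n2 f + 1); last by move: (n2 f) (nsq c) cn0 => a e e0; field.
  by rewrite opprD addrA subrr add0r oppr_ge0 ler10.
have gp : 0 < n2 g by rewrite lt_def gn0.
have := key (n2 g)^-1; rewrite (_ : _ - _ = n2 f - nsq c / n2 g); last by move: (n2 f) (n2 g) (nsq c) gn0 => a b e b0; field.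
by rewrite subr_ge0 ler_pdivrMr.
Qed.

Lemma normc_inner f g : L2 f -> L2 g -> normc (inner f g) <= L2norm f * L2norm g.
Proof.
move=> lf lg; rewrite normcE !L2normE// -sqrtrM ?n2_ge0// ler_wsqrtr//.
exact: nsq_inner.
Qed.

Lemma L2norm_ge0 f : 0 <= L2norm f.
Proof. by rewrite /L2norm fine_ge0// L2normeE sqrte_ge0. Qed.

Lemma L2norm_sqr f : L2 f -> L2norm f ^+ 2 = n2 f.
Proof. by move=> lf; rewrite L2normE// sqr_sqrtr// n2_ge0. Qed.

Lemma L2normD f g : L2 f -> L2 g -> L2norm (fun x => f x + g x) <= L2norm f + L2norm g.
Proof.
move=> lf lg; rewrite -(@ler_pXn2r _ 2%N)//; last 2 first.
- by rewrite nnegrE L2norm_ge0.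
- by rewrite nnegrE addr_ge0 ?L2norm_ge0.
have h : complex.Re (inner f g) <= L2norm f * L2norm g.
  by rewrite (le_trans (ler_norm _))// (le_trans (normr_Re _))// normc_inner.
rewrite L2norm_sqr; last exact: L2D.
rewrite n2D// sqrrD !L2norm_sqr//.
by move: (n2 f) (n2 g) (complex.Re _) (L2norm f * L2norm g) h => a b e k h; lra.
Qed.

Lemma L2norm_sub_sym f g : L2 f -> L2 g ->
  L2norm (fun x => f x - g x) = L2norm (fun x => g x - f x).
Proof. by move=> lf lg; rewrite (L2normE (L2B lf lg)) (L2normE (L2B lg lf)) n2_sub_sym. Qed.

Lemma L2norm_le_sub f g : L2 f -> L2 g -> L2norm f <= L2norm g + L2norm (fun x => f x - g x).
Proof.
move=> lf lg; have := @L2normD g (fun x => f x - g x) lg (L2B lf lg).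
by under eq_fun do rewrite addrC subrK.
Qed.

Lemma L2diste_lt f g (e : R) : L2 f -> L2 g ->
  (L2diste f g < e%:E)%E = (L2norm (fun x => f x - g x) < e).
Proof. by move=> lf lg; rewrite /L2diste L2normeE_fin ?lte_fin ?L2normE//; exact: L2B. Qed.

End L2_space.

(** * Affine substitutions *)

Section Affine_substitution.
Context {R : realType}.
Local Notation C := (complex R).
Local Notation mu := (@lebesgue_measure R).

Lemma measurable_affine (a b : R) : measurable_fun setT (fun x : R => a * x + b).
Proof. by apply: measurable_funD => //; apply: measurable_funM. Qed.

Let aff (a b : R) : measurableTypeR R -> measurableTypeR R := fun x => a * x + b.

Let maff a b : measurable_fun setT (aff a b).
Proof. exact: measurable_affine. Qed.

HB.instance Definition _ a b := isMeasurableFun.Build _ _ _ _ (aff a b) (maff a b).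

(** The right-hand side is a measure of [A] with the same values on half-open intervals as Lebesgue
    measure. *)
Lemma lebesgue_measure_affine (a b : R) (A : set R) : 0 < a -> measurable A ->
  mu A = (a%:E * mu ((fun x => a * x + b)%R @^-1` A))%E.
Proof.
move=> a0 mA; pose m' := mscale (NngNum (ltW a0)) (pushforward mu (aff a b)); pose m := m' (maff a b).
rewrite -[RHS]/(m A); apply: lebesgue_measure_unique => //= _ [[c d]] _ <-.
rewrite -[RHS]/(a%:E * mu (aff a b @^-1` `]c, d]))%E.
have -> : aff a b @^-1` `]c, d] = `]((c - b) / a), ((d - b) / a)]%classic.
  apply/seteqP; split => x /=; rewrite !in_itv/= /aff.
    by move=> /andP[h1 h2]; rewrite ltr_pdivrMr// ler_pdivlMr// !(mulrC x) ltrBlDr lerBrDr h1.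
  by rewrite ltr_pdivrMr// ler_pdivlMr// !(mulrC x) ltrBlDr lerBrDr.
rewrite !lebesgue_measure_itv/= !lte_fin ltr_pM2r ?invr_gt0// ltrD2r.
case: ifPn => cd; last by rewrite mule0.
by rewrite -!EFinB -EFinM -mulrBl mulrC divfK ?gt_eqF//; congr (_%:E); ring.
Qed.

Lemma ge0_integral_affine (a b : R) (f : R -> \bar R) : 0 < a ->
  measurable_fun setT f -> (forall x, 0 <= f x)%E ->
  (\int[mu]_x f x = a%:E * \int[mu]_x f (a * x + b)%R)%E.
Proof.
move=> a0 mf f0; pose m' := mscale (NngNum (ltW a0)) (pushforward mu (aff a b)); pose m := m' (maff a b).
have -> : (\int[mu]_x f x = \int[m]_x f x)%E.
  by apply: eq_measure_integral => A mA _; exact: lebesgue_measure_affine.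
rewrite ge0_integral_mscale//; congr (_ * _)%E.
rewrite (ge0_integral_pushforward (maff a b))//.
Qed.

Lemma ge0_integral_opp (f : R -> \bar R) :
  measurable_fun setT f -> (forall x, 0 <= f x)%E ->
  (\int[mu]_x f x = \int[mu]_x f (- x)%R)%E.
Proof.
move=> mf f0.
have -> : (\int[mu]_x f x = \int[pushforward mu (-%R : _ -> measurableTypeR R)]_x f x)%E.
  by apply: eq_measure_integral => //= A mA _; exact/esym/lebesgue_measureN.
by rewrite ge0_integral_pushforward.
Qed.

Lemma rintegrable_affine (a b : R) (p : R -> R) : 0 < a -> rintegrable p ->
  rintegrable (fun x => p (a * x + b)).
Proof.
move=> a0 ip; have mp := rintegrable_meas ip.
have [_ fin] := integrableP _ _ _ ip.
apply/integrableP; split.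
  apply/measurable_EFinP.
  by apply: (@measurableT_comp _ _ _ _ _ _ p) => //; exact: measurable_affine.
move: fin; rewrite (ge0_integral_affine b a0)//; last first.
  by apply: measurableT_comp => //; apply/measurable_EFinP.
rewrite /=; set I := (\int[mu]_x _)%E => h.
rewrite -[X in (X < _)%E]/I; have : (0 <= I)%E by apply: integral_ge0.
by case: I h => [r _ _|+ _|//]; rewrite ?ltry// gt0_muley ?lte_fin.
Qed.

Lemma rintegrable_opp (p : R -> R) : rintegrable p -> rintegrable (fun x => p (- x)).
Proof.
move=> ip; have mp := rintegrable_meas ip.
have mo : measurable_fun setT (fun x : R => p (- x)) by exact: (@measurableT_comp _ _ _ _ _ _ p).
have [_ fin] := integrableP _ _ _ ip.
apply/integrableP; split; first exact/measurable_EFinP.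
by move: fin; rewrite ge0_integral_opp//; apply: measurableT_comp => //; exact/measurable_EFinP.
Qed.

(** A linear substitution rule for nonnegative functions extends to integrable
    ones by splitting into positive and negative parts. *)
Let Rint_subst (s : R -> R) (c : R) :
  (forall p, rintegrable p -> rintegrable (p \o s)) ->
  (forall p, rintegrable p -> (forall x, 0 <= p x) ->
    \int[mu]_x p x = c * \int[mu]_x p (s x)) ->
  forall p, rintegrable p -> \int[mu]_x p x = c * \int[mu]_x p (s x).
Proof.
move=> is_ key p ip; have mp := rintegrable_meas ip.
have ipos : rintegrable (fun x => Num.max (p x) 0).
  apply: rintegrable_le (rintegrable_abs ip); first exact: measurable_maxr.
  by move=> x; rewrite ger0_norm ?le_max ?lexx ?orbT// ge_max ler_norm normr_ge0.
have ineg : rintegrable (fun x => Num.max (- p x) 0).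
  apply: rintegrable_le (rintegrable_abs ip).
    by apply: measurable_maxr => //; exact: measurable_funN.
  by move=> x; rewrite ger0_norm ?le_max ?lexx ?orbT// ge_max -normrN ler_norm normr_ge0.
have pE x : p x = Num.max (p x) 0 - Num.max (- p x) 0.
  by have [h|h] := leP (p x) 0; [rewrite max_l ?oppr_ge0// sub0r opprK|rewrite max_r ?oppr_le0 ?(ltW h)// subr0].
under eq_Rintegral do rewrite pE.
under [in RHS]eq_Rintegral do rewrite pE.
rewrite !RintB//; last 2 first.
- exact: (is_ _ ipos).
- exact: (is_ _ ineg).
by rewrite mulrBr (key _ ipos)// ?(key _ ineg)// => x; rewrite le_max lexx orbT.
Qed.

Lemma Rint_affine (a b : R) (p : R -> R) : 0 < a -> rintegrable p ->
  \int[mu]_x p x = a * \int[mu]_x p (a * x + b).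
Proof.
move=> a0; apply: Rint_subst => [q iq|q iq q0]; first exact: (rintegrable_affine b a0 iq).
apply: EFin_inj; rewrite EFinM !EFin_Rint//; last exact: rintegrable_affine.
apply: (ge0_integral_affine b a0 (f := EFin \o q)).
- by apply/measurable_EFinP; exact: (rintegrable_meas iq).
- by move=> x; rewrite lee_fin.
Qed.

Lemma Rint_opp (p : R -> R) : rintegrable p -> \int[mu]_x p (- x) = \int[mu]_x p x.
Proof.
move=> ip; apply/esym; rewrite -[RHS]mul1r; move: p ip.
apply: (@Rint_subst -%R) => [q iq|q iq q0]; first exact: rintegrable_opp.
rewrite mul1r; apply: EFin_inj; rewrite !EFin_Rint//; last exact: rintegrable_opp.
apply: (ge0_integral_opp (f := EFin \o q)).
- by apply/measurable_EFinP; exact: (rintegrable_meas iq).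
- by move=> x; rewrite lee_fin.
Qed.

Lemma cmeas_affine (a b : R) (f : R -> C) : cmeasurable f -> cmeasurable (fun x => f (a * x + b)).
Proof. by move=> mf; exact: (cmeas_comp (measurable_affine a b) mf). Qed.

Lemma cintegrable_affine (a b : R) (f : R -> C) : 0 < a -> cintegrable f ->
  cintegrable (fun x => f (a * x + b)).
Proof. by move=> a0 [f1 f2]; split; [exact: (rintegrable_affine b a0 f1)|exact: (rintegrable_affine b a0 f2)]. Qed.

Lemma cint_affine (a b : R) (f : R -> C) : 0 < a -> cintegrable f ->
  cint setT f = a%:C%C * cint setT (fun x => f (a * x + b)).
Proof.
move=> a0 [f1 f2]; apply: eq_ReIm; rewrite ?ReM_real ?ImM_real /=.
- by rewrite (Rint_affine b a0 f1).
- by rewrite (Rint_affine b a0 f2).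
Qed.

Lemma L2_affine (a b : R) (f : R -> C) : 0 < a -> L2 f -> L2 (fun x => f (a * x + b)).
Proof.
move=> a0 /L2P[mf lf]; apply/L2P; split; first exact: cmeas_affine.
exact: (rintegrable_affine b a0 lf).
Qed.

Lemma n2_affine (a b : R) (f : R -> C) : 0 < a -> L2 f ->
  n2 f = a * n2 (fun x => f (a * x + b)).
Proof. by move=> a0 lf; rewrite !n2I (Rint_affine b a0 (L2_int lf)). Qed.

End Affine_substitution.

(** * Limits of integrals and completeness of L2 *)

Section Limit_theorems.
Context {R : realType}.
Local Notation C := (complex R).
Local Notation mu := (@lebesgue_measure R).

Lemma fatou_bound (g_ : nat -> R -> R) (g : R -> R) (c : \bar R) (n0 : nat) :
  (forall n, measurable_fun setT (g_ n)) -> (forall n x, 0 <= g_ n x) ->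
  (forall x, g_ n x @[n --> \oo] --> g x) ->
  (forall n, (n0 <= n)%N -> (\int[mu]_x (g_ n x)%:E <= c)%E) ->
  (\int[mu]_x (g x)%:E <= c)%E.
Proof.
move=> mg g0 gcvg gc.
have h := @fatou _ _ _ mu setT measurableT (fun n x => (g_ (n + n0)%N x)%:E).
have {h} := h (fun n => proj2 (measurable_EFinP _ _) (mg _)) (fun n x _ => (g0 _ x : (0 <= (g_ (n + n0)%N x)%:E)%E)).
rewrite (_ : (fun x => limn_einf _) = (fun x => (g x)%:E)); last first.
  apply/funext => x; apply: (cvg_limn_einf_sup _).1.
  apply: cvg_EFin; first exact: nearW.
  by rewrite (_ : _ \o _ = fun n => g_ (n + n0)%N x)//; rewrite (cvg_shiftn _ (fun n => g_ n x)).
move=> h; apply: (le_trans h).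
rewrite limn_einf_lim; apply: lime_le; first exact: is_cvg_einfs.
apply: nearW => n; apply: le_trans (gc (n + n0)%N (leq_addl _ _)).
by apply: ereal_inf_lbound; exists n => //=.
Qed.

Lemma Rint_dct (f_ : nat -> R -> R) (f g : R -> R) :
  (forall n, measurable_fun setT (f_ n)) ->
  (forall x, f_ n x @[n --> \oo] --> f x) ->
  rintegrable g -> (forall n x, `|f_ n x| <= g x) ->
  rintegrable f /\ \int[mu]_x f_ n x @[n --> \oo] --> \int[mu]_x f x.
Proof.
move=> mf fcvg ig fg.
have mlim : measurable_fun setT f.
  by apply: (measurable_fun_cvg mf) => x _; exact: fcvg.
have cE x : (f_ n x)%:E @[n --> \oo] --> (f x)%:E.
  by apply: cvg_EFin; [exact: nearW|exact: fcvg].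
have [|||||intf _ cv] := @dominated_convergence _ _ _ mu setT measurableT
   (fun n => EFin \o f_ n) (EFin \o f) (EFin \o g).
- by move=> n; apply/measurable_EFinP; exact: mf.
- exact/measurable_EFinP.
- by apply: aeW => x _; exact: cE.
- exact: ig.
- by apply: aeW => x n _; rewrite /= lee_fin.
split; first exact: intf.
by apply: fine_cvg; rewrite fineK//; exact: (integrable_fin_num measurableT intf).
Qed.

Lemma measurable_EFin_nsq (f : R -> C) : cmeasurable f ->
  measurable_fun setT (fun x => (nsq (f x))%:E).
Proof. by move=> mf; apply/measurable_EFinP; exact: measurable_nsq. Qed.

Lemma cvg_nsq (u : nat -> C) (z : C) :
  complex.Re (u n) @[n --> \oo] --> complex.Re z ->
  complex.Im (u n) @[n --> \oo] --> complex.Im z ->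
  nsq (u n) @[n --> \oo] --> nsq z.
Proof.
move=> h1 h2; rewrite /nsq; under eq_cvg do rewrite !expr2.
by rewrite !expr2; apply: cvgD; apply: cvgM.
Qed.

Lemma cvgn_geometric_increments (u : nat -> R) (M : R) :
  (forall i, `|u i.+1 - u i| <= M * 2^-1 ^+ i) -> cvgn u.
Proof.
move=> h; have M0 : 0 <= M by have := le_trans (normr_ge0 _) (h 0%N); rewrite expr0 mulr1.
rewrite (_ : u = (fun n => u 0%N + series (fun i => u i.+1 - u i) n)); last first.
  by apply/funext => n; rewrite seriesEnat/= telescope_sumr// addrC subrK.
apply: is_cvgD; first exact: is_cvg_cst.
apply: normed_cvg; apply: (@series_le_cvg _ _ (geometric M 2^-1)) => //.
- by move=> n /=.
- by move=> n; rewrite /= mulr_ge0// exprn_ge0// invr_ge0.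
- by apply: is_cvg_geometric_series; rewrite ger0_norm ?invr_ge0// invf_lt1// ltr1n.
Qed.

Lemma measurable_lt_pinfty (T : R -> \bar R) : measurable_fun setT T ->
  measurable [set x | (T x < +oo)%E].
Proof. by move=> mT; rewrite -[X in measurable X]setTI; exact: emeasurable_fun_infty_o. Qed.

End Limit_theorems.

Section Indicator.
Context {R : realType}.
Local Notation C := (complex R).
Local Notation mu := (@lebesgue_measure R).

Definition cind (D : set R) : R -> C := fun x => (\1_D x)%:C%C.

Lemma cind_in (D : set R) x : D x -> cind D x = 1.
Proof. by move=> Dx; rewrite /cind indicE mem_set. Qed.

Lemma cind_out (D : set R) x : ~ D x -> cind D x = 0.
Proof. by move=> Dx; rewrite /cind indicE memNset. Qed.

Lemma nsq_cind (D : set R) x : nsq (cind D x) <= 1.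
Proof. by rewrite nsq_real indicE; case: (x \in D); rewrite /= ?expr1n ?expr0n. Qed.

Lemma normc_cind (D : set R) x : normc (cind D x) <= 1.
Proof. by rewrite normc_real indicE; case: (x \in D); rewrite /= ?normr1 ?normr0. Qed.

Lemma cmeas_cind (D : set R) : measurable D -> cmeasurable (cind D).
Proof. by move=> mD; apply: cmeas_real; exact: measurable_indic. Qed.

Lemma L2_cind (D : set R) (f : R -> C) : measurable D -> L2 f -> L2 (fun x => cind D x * f x).
Proof. by move=> mD; apply: L2M (cmeas_cind mD) (nsq_cind D). Qed.

End Indicator.

Section L2_completeness.
Context {R : realType}.
Local Notation C := (complex R).
Local Notation mu := (@lebesgue_measure R).

(** Riesz-Fischer: along a fast subsequence the weighted series of squared increments has finite
    integral, hence is finite almost everywhere, and there the subsequence converges pointwise;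
    Fatou's lemma turns the pointwise limit into a limit in the mean. *)
Lemma L2_complete (f : nat -> R -> C) : (forall n, L2 (f n)) ->
  (forall e : R, 0 < e -> exists n0, forall m n, (n0 <= m)%N -> (n0 <= n)%N ->
     n2 (fun x => f m x - f n x) <= e) ->
  exists2 g, L2 g & forall e : R, 0 < e -> exists n0, forall n, (n0 <= n)%N ->
     n2 (fun x => f n x - g x) <= e.
Proof.
move=> lf fC.
have [N HN] : {N : nat -> nat | forall i m n, (N i <= m)%N -> (N i <= n)%N ->
    n2 (fun x => f m x - f n x) <= 8^-1 ^+ i}.
  have h i : {n0 | forall m n, (n0 <= m)%N -> (n0 <= n)%N ->
      n2 (fun x => f m x - f n x) <= 8^-1 ^+ i}.
    by apply: cid; apply: fC; rewrite exprn_gt0// invr_gt0.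
  by exists (fun i => projT1 (h i)) => i; exact: projT2 (h i).
pose k i := (\sum_(j < i.+1) N j + i)%N.
have kN i : (N i <= k i)%N by rewrite /k big_ord_recr/= -addnA addnCA leq_addr.
have kN1 i : (N i <= k i.+1)%N.
  by rewrite /k big_ord_recr/= big_ord_recr/= -!addnA addnCA leq_addr.
have ki i : (i <= k i)%N by rewrite /k leq_addl.
pose D i x := f (k i.+1) x - f (k i) x.
have lD i : L2 (D i) by apply: L2B.
have nD i : n2 (D i) <= 8^-1 ^+ i by apply: HN.
(* the weight 4^i leaves a convergent series of integrals while making each
   increment at most a constant times 2^-i wherever the series is finite *)
pose t i x := 4 ^+ i * nsq (D i x).
have t0 i x : 0 <= t i x by rewrite mulr_ge0 ?exprn_ge0 ?nsq_ge0.
have mt i : measurable_fun setT (t i).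
  by apply: measurable_funM => //; exact: measurable_nsq (L2_meas (lD i)).
pose T x := (\sum_(i <oo) (t i x)%:E)%E.
have mT : measurable_fun setT T.
  apply: ge0_emeasurable_sum => //; first by move=> i x _ _; rewrite lee_fin.
  by move=> i _; apply/measurable_EFinP.
have T0 x : (0 <= T x)%E by apply: nneseries_ge0 => i _ _; rewrite lee_fin.
have iT : mu.-integrable setT T.
  apply/integrableP; split => //; under eq_integral do rewrite gee0_abs//.
  rewrite /T integral_nneseries//; last 2 first.
  - by move=> i; apply/measurable_EFinP; exact: mt.
  - by move=> i x _; rewrite lee_fin.
  apply: (@le_lt_trans _ _ (\sum_(i <oo) (2 / (2 ^ i.+1)%:R)%:E)%E).
    apply: lee_nneseries => [i _ _|i _]; first by apply: integral_ge0 => x _; rewrite lee_fin.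
    have -> : (\int[mu]_x (t i x)%:E = (4 ^+ i * n2 (D i))%:E)%E.
      rewrite n2I -RintZ ?EFin_Rint//; first exact/rintegrableZ/L2_int.
      exact: (L2_int (lD i)).
    rewrite lee_fin natrX exprS invfM mulrA mulfV ?mul1r// -exprVn.
    apply: (@le_trans _ _ (4 ^+ i * 8^-1 ^+ i)); first by rewrite ler_wpM2l ?exprn_ge0.
    by rewrite -exprMn (_ : 4 * 8^-1 = 2^-1)//; field.
  exact: le_lt_trans (epsilon_trick0 _ (ler0n _ 2)) (ltry 2).
pose E := [set x | (T x < +oo)%E].
have mE : measurable E by exact: measurable_lt_pinfty.
have aeE : {ae mu, forall x, E x}.
  have := integrable_ae measurableT iT; apply: filterS => x /(_ I) h.
  by rewrite /E /= ltey_eq h.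
have inc x i : E x -> nsq (D i x) <= fine (T x) * 4^-1 ^+ i.
  move=> Ex; have fT : T x \is a fin_num by rewrite ge0_fin_numE.
  rewrite exprVn ler_pdivlMr ?exprn_gt0// mulrC -lee_fin fineK//.
  rewrite -/(t i x) /T (@nneseriesD1 _ _ i)//; last by move=> j _; rewrite lee_fin.
  by rewrite leeDl// nneseries_ge0// => j _ _; rewrite lee_fin.
pose fE i x := cind E x * f (k i) x.
have mfE i : cmeasurable (fE i) by apply: cmeas_mul; [exact: cmeas_cind|exact: L2_meas].
have normD x i : E x -> normc (D i x) <= Num.sqrt (fine (T x)) * 2^-1 ^+ i.
  move=> Ex; rewrite -(@ler_pXn2r _ 2%N) ?nnegrE ?normc_ge0 ?mulr_ge0 ?sqrtr_ge0 ?exprn_ge0 ?invr_ge0//.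
  rewrite normc_sqr exprMn sqr_sqrtr ?fine_ge0// -exprM mulnC exprM.
  by rewrite (_ : 2^-1 ^+ 2 = 4^-1) ?inc//; field.
have cvRe x : cvgn (fun i => complex.Re (fE i x)).
  have [Ex|nEx] := pselect (E x); last first.
    rewrite (_ : (fun _ => _) = fun _ => 0); first exact: is_cvg_cst.
    by apply/funext => i; rewrite /fE cind_out// mul0r.
  apply: (@cvgn_geometric_increments _ _ (Num.sqrt (fine (T x)))) => i.
  rewrite /fE cind_in// !mul1r; apply: le_trans (normD x i Ex).
  by rewrite -ReN -ReD; exact: normr_Re.
have cvIm x : cvgn (fun i => complex.Im (fE i x)).
  have [Ex|nEx] := pselect (E x); last first.
    rewrite (_ : (fun _ => _) = fun _ => 0); first exact: is_cvg_cst.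
    by apply/funext => i; rewrite /fE cind_out// mul0r.
  apply: (@cvgn_geometric_increments _ _ (Num.sqrt (fine (T x)))) => i.
  rewrite /fE cind_in// !mul1r; apply: le_trans (normD x i Ex).
  by rewrite -ImN -ImD; exact: normr_Im.
pose g x := Complex (limn (fun i => complex.Re (fE i x))) (limn (fun i => complex.Im (fE i x))).
have mg : cmeasurable g.
  split.
  - apply: (@measurable_fun_cvg _ _ _ _ (fun i => rpart (fE i))) => [i|x _]; first by case: (mfE i).
    exact: (cvRe x).
  - apply: (@measurable_fun_cvg _ _ _ _ (fun i => ipart (fE i))) => [i|x _]; first by case: (mfE i).
    exact: (cvIm x).
have bound n c n0 : (forall i, (n0 <= i)%N -> n2 (fun x => f n x - f (k i) x) <= c) ->
    (\int[mu]_x (nsq (cind E x * f n x - g x))%:E <= c%:E)%E.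
  move=> hc; apply: (@fatou_bound _ (fun i x => nsq (cind E x * f n x - fE i x)) _ _ n0).
  - move=> i; apply: (@measurable_nsq _ (fun x => cind E x * f n x - fE i x)); apply: cmeas_sub => //.
    by apply: cmeas_mul; [exact: cmeas_cind|exact: L2_meas].
  - by move=> i x; exact: nsq_ge0.
  - move=> x; apply: (@cvg_nsq _ (fun i => cind E x * f n x - fE i x)).
    + under eq_cvg do rewrite ReD ReN.
      by rewrite ReD ReN; apply: cvgB; [exact: cvg_cst|exact: (cvRe x)].
    + under eq_cvg do rewrite ImD ImN.
      by rewrite ImD ImN; apply: cvgB; [exact: cvg_cst|exact: (cvIm x)].
  - move=> i ni; have lB : L2 (fun x => f n x - f (k i) x) by apply: L2B.
    apply: (@le_trans _ _ (\int[mu]_x (nsq (f n x - f (k i) x))%:E)%E); last first.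
      by rewrite n2E// lee_fin hc.
    apply: ge0_le_integral => //.
    + by move=> x _; rewrite lee_fin nsq_ge0.
    + apply: measurable_EFin_nsq; apply: cmeas_sub => //.
      by apply: cmeas_mul; [exact: cmeas_cind|exact: L2_meas].
    + by apply: measurable_EFin_nsq; apply: L2_meas.
    + move=> x _; rewrite lee_fin /fE -mulrBr nsqM.
      by rewrite -[leRHS]mul1r ler_wpM2r ?nsq_ge0// nsq_cind.
have lg : L2 g.
  have [n0 h0] := fC 1 ltr01.
  have lBg : L2 (fun x => cind E x * f n0 x - g x).
    apply: L2_fin; first by apply: cmeas_sub => //; apply: cmeas_mul; [exact: cmeas_cind|exact: L2_meas].
    apply: le_lt_trans (ltry 1); apply: (bound n0 1 n0) => i i0.
    by apply: h0 => //; exact: leq_trans (ki i).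
  rewrite (_ : g = fun x => cind E x * f n0 x - (cind E x * f n0 x - g x)).
    by apply: L2B => //; exact: L2_cind.
  by apply/funext => x; rewrite opprB addrC subrK.
exists g => // e e0; have [n0 h0] := fC e e0; exists n0 => n nn0.
rewrite -lee_fin -n2E; last exact: L2B.
rewrite (_ : (\int[mu]_x _)%E = (\int[mu]_x (nsq (cind E x * f n x - g x))%:E)%E).
  apply: (bound n e n0) => i i0; apply: h0 => //; exact: leq_trans (ki i).
apply: ge0_ae_eq_integral => //.
- by apply: measurable_EFin_nsq; apply: L2_meas; exact: L2B.
- apply: measurable_EFin_nsq; apply: cmeas_sub => //.
  by apply: cmeas_mul; [exact: cmeas_cind|exact: L2_meas].
- by move=> x _; rewrite lee_fin nsq_ge0.
- by move=> x _; rewrite lee_fin nsq_ge0.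
- have [Z [mZ Z0 sub]] := aeE; exists Z; split => // x /= h; apply: sub => /= Ex.
  by apply: h => _; rewrite cind_in// mul1r.
Qed.

End L2_completeness.

(** * Unconditional sums and a criterion for Riesz bases *)

Section Unconditional_sums.
Context {R : realType} {I : choiceType}.
Local Notation C := (complex R).
Local Notation mu := (@lebesgue_measure R).
Implicit Types (a : I -> C) (F G : {fset I}) (e : I -> R -> C).

Lemma big_fset_diff (V : nmodType) (f : I -> V) F0 F : (F0 `<=` F)%fset ->
  \sum_(l <- F) f l = \sum_(l <- F0) f l + \sum_(l <- (F `\` F0)%fset) f l.
Proof.
move=> sub; rewrite (big_fsetID _ (mem F0)); congr (_ + _).
- apply: eq_fbigl => i; rewrite !inE/= andbC; case: (boolP (i \in F0)) => //= iF0.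
  exact: (fsubsetP sub).
- by apply: eq_fbigl => i; rewrite !inE/= andbC.
Qed.

(** Take [F0] whose sum is within [eps] of the supremum of all finite sums. *)
Lemma bounded_sums_tail (p : I -> R) (M : R) : (forall l, 0 <= p l) ->
  (forall F, \sum_(l <- F) p l <= M) ->
  forall eps : R, 0 < eps -> exists F0, forall F, (F0 `<=` F)%fset ->
    \sum_(l <- (F `\` F0)%fset) p l <= eps.
Proof.
move=> p0 pM eps eps0; pose S := [set \sum_(l <- F) p l | F in [set: {fset I}]].
have hS : has_sup S.
  split; first by exists (\sum_(l <- fset0) p l); exists fset0.
  by exists M => _ [F _ <-].
have [_ [F0 _ <-] hF0] := sup_adherent eps0 hS.
exists F0 => F sub.
have : \sum_(l <- F) p l <= sup S by apply: sup_upper_bound => //; exists F.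
by rewrite (big_fset_diff p sub) => h; rewrite -(lerD2l (\sum_(l <- F0) p l)) (le_trans h)// -lerBlDr ltW.
Qed.

Lemma L2_fin_comb e a F : (forall l, L2 (e l)) -> L2 (fin_comb e a F).
Proof. by move=> le; apply: L2_sum => l; exact: L2Z. Qed.

Lemma fin_comb_diff e a F0 F : (F0 `<=` F)%fset ->
  (fun t => fin_comb e a F t - fin_comb e a F0 t) = fin_comb e a (F `\` F0)%fset.
Proof.
move=> sub; apply/funext => t; rewrite /fin_comb.
by rewrite (big_fset_diff _ sub) addrC addKr.
Qed.

Lemma n2_tri2 (f g h : R -> C) : L2 f -> L2 g -> L2 h ->
  n2 (fun x => f x - h x) <= 2 * n2 (fun x => f x - g x) + 2 * n2 (fun x => g x - h x).
Proof.
move=> lf lg lh; rewrite (_ : (fun x => f x - h x) = (fun x => (f x - g x) + (g x - h x))).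
  have l1 := L2B lf lg; have l2 := L2B lg lh.
  rewrite !n2I -!RintZ ?(L2_int l1) ?(L2_int l2)// -RintD.
  - apply: le_Rint => [||x]; last exact: nsqD.
    + exact: (L2_int (L2D l1 l2)).
    + by apply: rintegrableD; apply: rintegrableZ; [exact: (L2_int l1)|exact: (L2_int l2)].
  - exact/rintegrableZ/(L2_int l1).
  - exact/rintegrableZ/(L2_int l2).
by apply/funext => x; rewrite addrA subrK.
Qed.

(** The partial sums along finite sets that exhaust [\sum_l |a_l|^2] are Cauchy, because the
    synthesis bound controls their differences by the tails of that sum. *)
Lemma unconditional_sum e a (B M : R) : 0 <= B -> (forall l, L2 (e l)) ->
  (forall F, n2 (fin_comb e a F) <= B * \sum_(l <- F) nsq (a l)) ->
  (forall F, \sum_(l <- F) nsq (a l) <= M) ->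
  exists2 f, L2 f & forall eps : R, 0 < eps -> exists F0, forall F, (F0 `<=` F)%fset ->
    n2 (fun x => f x - fin_comb e a F x) <= eps.
Proof.
move=> B0 le eB aM.
have lc F : L2 (fin_comb e a F) by exact: L2_fin_comb.
have tail := @bounded_sums_tail (fun l => nsq (a l)) M (fun l => nsq_ge0 _) aM.
have etail eps : 0 < eps -> exists F0, forall F, (F0 `<=` F)%fset ->
    n2 (fun x => fin_comb e a F x - fin_comb e a F0 x) <= eps.
  move=> e0; have B1 : 0 < B + 1 by rewrite ltr_wpDl.
  have [F0 h] := tail (eps / (B + 1)) (divr_gt0 e0 B1); exists F0 => F sub.
  rewrite (fin_comb_diff _ _ sub); apply: le_trans (eB _) _.
  apply: (@le_trans _ _ ((B + 1) * (eps / (B + 1)))).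
    by apply: ler_pM; rewrite ?h ?sumr_ge0// ?lerDl// => l _; exact: nsq_ge0.
  by rewrite mulrC divfK// gt_eqF.
have [F_ hF] : {F_ : nat -> {fset I} | forall i F, (F_ i `<=` F)%fset ->
    n2 (fun x => fin_comb e a F x - fin_comb e a (F_ i) x) <= i.+1%:R^-1}.
  have h i : {F0 : {fset I} | forall F, (F0 `<=` F)%fset ->
      n2 (fun x => fin_comb e a F x - fin_comb e a F0 x) <= i.+1%:R^-1}.
    by apply: cid; apply: etail; rewrite invr_gt0.
  by exists (fun i => projT1 (h i)) => i; exact: projT2 (h i).
pose fix G n : {fset I} := if n is m.+1 then (G m `|` F_ n)%fset else F_ 0%N.
have FG i n : (i <= n)%N -> (F_ i `<=` G n)%fset.
  elim: n => [|n IH]; first by rewrite leqn0 => /eqP ->.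
  rewrite leq_eqVlt => /predU1P[->|]; first by case: n {IH} => [|n]; exact: fsubsetUr.
  by rewrite ltnS => /IH h; exact: fsubset_trans h (fsubsetUl _ _).
have GG m n : (m <= n)%N -> (G m `<=` G n)%fset.
  elim: n => [|n IH]; first by rewrite leqn0 => /eqP ->.
  rewrite leq_eqVlt => /predU1P[->//|].
  by rewrite ltnS => /IH h; exact: fsubset_trans h (fsubsetUl _ _).
have close i F F' : (F_ i `<=` F)%fset -> (F_ i `<=` F')%fset ->
    n2 (fun x => fin_comb e a F x - fin_comb e a F' x) <= 4 * i.+1%:R^-1.
  move=> h h'; apply: le_trans (n2_tri2 (lc F) (lc (F_ i)) (lc F')) _.
  rewrite [X in _ + 2 * X]n2_sub_sym.
  have h1 := hF i F h; have h2 := hF i F' h'.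
  by move: (n2 _) (n2 _) i.+1%:R^-1 h1 h2 => A A' c; lra.
have small (eps : R) : 0 < eps -> exists i : nat, i.+1%:R^-1 <= eps.
  move=> e0; exists (Num.truncn eps^-1); rewrite invf_ple ?posrE//.
  by rewrite ltW// truncnS_gt.
have [|f lf hf] := @L2_complete _ (fun n => fin_comb e a (G n)) (fun n => lc _).
  move=> eps e0; have [i hi] := small (eps / 4) (divr_gt0 e0 (ltr0n _ 4)).
  exists i => m n im jn; apply: le_trans (close i _ _ (FG _ _ im) (FG _ _ jn)) _.
  by move: i.+1%:R^-1 hi => c; lra.
exists f => // eps e0; have e4 : 0 < eps / 4 by rewrite divr_gt0.
have [n0 h0] := hf _ e4; have e16 : 0 < eps / 16 by rewrite divr_gt0.
have [i hi] := small _ e16.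
pose n := maxn i n0; exists (G n) => F sub.
apply: le_trans (n2_tri2 lf (lc (G n)) (lc F)) _.
rewrite [X in 2 * X + _]n2_sub_sym.
have h1 := h0 n (leq_maxr _ _).
have h2 := close i (G n) F (FG _ _ (leq_maxl _ _)) (fsubset_trans (FG _ _ (leq_maxl _ _)) sub).
by move: (n2 _) (n2 _) i.+1%:R^-1 h1 h2 hi => A B' c; lra.
Qed.

Lemma sq_summableP a : sq_summable a ->
  let s := fine (\esum_(l in [set: I]) (normc (a l) ^+ 2)%:E)%E in
  (forall F, \sum_(l <- F) nsq (a l) <= s) /\
  (forall eps : R, 0 < eps -> exists F, s - eps < \sum_(l <- F) nsq (a l)).
Proof.
move=> sa s; move: (sa); rewrite /sq_summable => fin.
have sf : (\esum_(l in [set: I]) (normc (a l) ^+ 2)%:E)%E \is a fin_num.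
  by rewrite ge0_fin_numE// esum_ge0// => l _; rewrite lee_fin sqr_ge0.
split.
- move=> F; rewrite -lee_fin fineK//; apply: esum_ge.
  exists [set` F]; first by split => //; exact: finite_fset.
  rewrite -fsbig_seq ?fset_uniq//= -sumEFin; apply: lee_sum => l _.
  by rewrite lee_fin normc_sqr.
- move=> eps e0; have [_ [X [fX _] <-]] := ub_ereal_sup_adherent e0 sf.
  rewrite fsbig_finite//= => h; exists (fset_set X).
  rewrite -lte_fin EFinB fineK//; apply: lt_le_trans h _.
  rewrite -sumEFin; apply: lee_sum => l _.
  by rewrite lee_fin normc_sqr.
Qed.

(** Both bounds pass to the limit of an unconditional sum, since the norm is continuous. *)
Lemma riesz_of_bounds e (c1 c2 : R) : 0 < c1 -> c1 <= c2 -> (forall l, L2 (e l)) ->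
  (forall a F, c1 ^+ 2 * \sum_(l <- F) nsq (a l) <= n2 (fin_comb e a F)
                <= c2 ^+ 2 * \sum_(l <- F) nsq (a l)) ->
  dense_span e -> riesz_basis e.
Proof.
move=> c10 c12 le eb dens; split => //; exists c1, c2; split => // a sa.
have [aM aS] := sq_summableP sa.
set s := fine _ in aM aS.
have c20 : 0 < c2 by exact: lt_le_trans c12.
have lc F : L2 (fin_comb e a F) by exact: L2_fin_comb.
have [f lf hf] := @unconditional_sum e a (c2 ^+ 2) s (sqr_ge0 _) le (fun F => (andP (eb a F)).2) aM.
have hf' (eps : R) : 0 < eps -> exists F0, forall F, (F0 `<=` F)%fset ->
    L2norm (fun x => f x - fin_comb e a F x) <= eps.
  move=> e0; have [F0 h] := hf _ (exprn_gt0 2 e0); exists F0 => F /h.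
  rewrite -L2norm_sqr; last exact: L2B.
  by rewrite ler_pXn2r// nnegrE ?L2norm_ge0// ltW.
have s0 : 0 <= s by have := aM fset0; rewrite big_seq_fset0.
exists f; split => //.
- move=> eps e0; have e2 : 0 < eps / 2 by rewrite divr_gt0.
  have [F0 h] := hf' _ e2; exists F0 => F /h {}h.
  by rewrite L2diste_lt//; apply: (le_lt_trans h); lra.
have bn F : c1 * Num.sqrt (\sum_(l <- F) nsq (a l)) <= L2norm (fin_comb e a F) <=
    c2 * Num.sqrt (\sum_(l <- F) nsq (a l)).
  have S0 : 0 <= \sum_(l <- F) nsq (a l) by apply: sumr_ge0 => l _; exact: nsq_ge0.
  have /andP[h1 h2] := eb a F.
  by apply/andP; split; rewrite -(@ler_pXn2r _ 2%N) ?nnegrE ?mulr_ge0 ?sqrtr_ge0 ?L2norm_ge0 ?(ltW c10) ?(ltW c20)//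
    exprMn sqr_sqrtr// L2norm_sqr.
rewrite /l2norm -/s; apply/andP; split; apply/ler_addgt0Pr => eps e0.
- have d0 : 0 < eps / (2 * c1) by rewrite divr_gt0 ?mulr_gt0.
  have e2 : 0 < eps / 2 by rewrite divr_gt0.
  have [F0 h0] := hf' _ e2; have [F1 h1] := aS _ (exprn_gt0 2 d0).
  pose F := (F0 `|` F1)%fset.
  have hF := h0 F (fsubsetUl _ _); have /andP[hb _] := bn F.
  set S := \sum_(l <- F) nsq (a l) in hb.
  have S1 : \sum_(l <- F1) nsq (a l) <= S.
    rewrite /S (big_fset_diff _ (fsubsetUr F0 F1)) lerDl sumr_ge0// => l _; exact: nsq_ge0.
  have S0 : 0 <= S by apply: sumr_ge0 => l _; exact: nsq_ge0.
  have ss : Num.sqrt s <= Num.sqrt S + eps / (2 * c1).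
    rewrite -(@ler_pXn2r _ 2%N) ?nnegrE ?addr_ge0 ?sqrtr_ge0 ?(ltW d0)//.
    rewrite sqr_sqrtr// sqrrD sqr_sqrtr//.
    have : 0 <= Num.sqrt S * (eps / (2 * c1)) by rewrite mulr_ge0 ?sqrtr_ge0// ltW.
    by move: (_ * _) ((eps / _) ^+ 2) h1 S1 => u v h1 S1 u0; lra.
  have hn := L2norm_le_sub (lc F) lf.
  rewrite L2norm_sub_sym// in hn.
  have hc : c1 * Num.sqrt s <= c1 * Num.sqrt S + eps / 2.
    rewrite (_ : eps / 2 = c1 * (eps / (2 * c1))) -?mulrDr ?ler_pM2l//.
    by field; rewrite gt_eqF.
  by move: (L2norm f) (L2norm _) (L2norm _) (c1 * _) (c1 * _) hF hb hn hc => *; lra.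
- have [F h] := hf' _ e0.
  have hF := h F (fsubset_refl _); have /andP[_ hb] := bn F.
  have hn := L2norm_le_sub lf (lc F).
  have hs : c2 * Num.sqrt (\sum_(l <- F) nsq (a l)) <= c2 * Num.sqrt s.
    by rewrite ler_pM2l// ler_wsqrtr.
  by move: (L2norm f) (L2norm _) (L2norm _) (c2 * _) (c2 * _) hF hb hn hs => *; lra.
Qed.

End Unconditional_sums.

(** * Fubini and the Fourier transform on L1 *)

Section Fubini.
Context {R : realType}.
Local Notation C := (complex R).
Local Notation mu := (@lebesgue_measure R).

Let Rint_fubini1 (K : R * R -> R) (p q : R -> R) : measurable_fun setT K ->
  rintegrable p -> rintegrable q -> (forall x t, `|K (x, t)| <= p x * q t) ->
  rintegrable (fun x => \int[mu]_t K (x, t)) /\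
  \int[mu]_x (\int[mu]_t K (x, t)) = \int[mu]_t (\int[mu]_x K (x, t)).
Proof.
move=> mK ip iq Kpq.
have mK1 x : measurable_fun setT (fun t => K (x, t)) by exact: measurableT_comp.
have mK2 t : measurable_fun setT (fun x => K (x, t)) by exact: measurableT_comp.
have i1 x : rintegrable (fun t => K (x, t)).
  by apply: (rintegrable_le (mK1 x) _ (rintegrableZ (p x) iq)) => t; exact: Kpq.
have i2 t : rintegrable (fun x => K (x, t)).
  by apply: (rintegrable_le (mK2 t) _ (rintegrableZ (q t) ip)) => x; rewrite mulrC; exact: Kpq.
have mKE : measurable_fun setT (EFin \o K) by exact/measurable_EFinP.
have iK : (mu \x mu)%E.-integrable setT (EFin \o K).
  apply/integrable12ltyP => //.
  apply: (@le_lt_trans _ _ (\int[mu]_x (`|p x| * \int[mu]_t `|q t|)%:E)%E).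
    apply: ge0_le_integral => //.
    - by move=> x _; apply: integral_ge0.
    - have mA : measurable_fun setT (abse \o (EFin \o K)) by exact: measurableT_comp.
      exact: (@measurable_fun_fubini_tonelli_F _ _ _ _ _ mu (abse \o (EFin \o K)) mA (fun _ => abse_ge0 _)).
    - apply/measurable_EFinP; apply: measurable_funM => //.
      exact: rintegrable_meas (rintegrable_abs ip).
    - move=> x _; have iabs := rintegrable_abs iq.
      rewrite -RintZ ?EFin_Rint//; last exact: rintegrableZ.
      apply: ge0_le_integral => //.
      + by apply: measurableT_comp => //; apply/measurable_EFinP; exact: mK1.
      + by apply/measurable_EFinP; exact: rintegrable_meas (rintegrableZ _ iabs).
      + by move=> t _; rewrite lee_fin (le_trans (Kpq x t))// -normrM ler_norm.
  rewrite -EFin_Rint ?ltry//.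
  under eq_fun do rewrite mulrC; exact/rintegrableZ/rintegrable_abs.
have j1 : rintegrable (fun x => \int[mu]_t K (x, t)).
  rewrite /rintegrable (_ : EFin \o _ = fubini_F mu (EFin \o K)); first exact: integrable_fubini_F.
  by apply/funext => x; rewrite /= EFin_Rint.
split; [exact: j1|rewrite /Rintegral; congr fine].
under eq_integral do rewrite EFin_Rint//.
under [in RHS]eq_integral do rewrite EFin_Rint//.
exact: (@Fubini _ _ _ _ _ mu mu (EFin \o K)).
Qed.

Lemma Rint_fubini (K : R * R -> R) (p q : R -> R) : measurable_fun setT K ->
  rintegrable p -> rintegrable q -> (forall x t, `|K (x, t)| <= p x * q t) ->
  [/\ rintegrable (fun x => \int[mu]_t K (x, t)),
      rintegrable (fun t => \int[mu]_x K (x, t)) &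
      \int[mu]_x (\int[mu]_t K (x, t)) = \int[mu]_t (\int[mu]_x K (x, t))].
Proof.
move=> mK ip iq Kpq; have [i1 e] := Rint_fubini1 mK ip iq Kpq; split; [exact: i1| |exact: e].
have mS : measurable_fun setT (fun z : R * R => K (z.2, z.1)).
  by apply: (measurableT_comp mK); apply/measurable_fun_pairP; split; [exact: measurable_snd|exact: measurable_fst].
by have [] := Rint_fubini1 mS iq ip (fun t x => eq_ind_r (fun r => _ <= r) (Kpq x t) (mulrC _ _)).
Qed.

(** Joint measurability is stated on the real and imaginary parts, as for functions of one variable.
    *)
Definition cmeasurable2 (K : R * R -> C) : Prop :=
  measurable_fun setT (fun z => complex.Re (K z)) /\
  measurable_fun setT (fun z => complex.Im (K z)).

Lemma cmeas2_mul (K L : R * R -> C) : cmeasurable2 K -> cmeasurable2 L ->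
  cmeasurable2 (fun z => K z * L z).
Proof.
move=> [f1 f2] [g1 g2]; split.
- by under eq_fun do rewrite ReM; apply: measurable_funB; apply: measurable_funM.
- by under eq_fun do rewrite ImM; apply: measurable_funD; apply: measurable_funM.
Qed.

Lemma cmeas2_fst (f : R -> C) : cmeasurable f -> cmeasurable2 (fun z => f z.1).
Proof.
move=> [f1 f2]; split.
- exact: (measurableT_comp f1 measurable_fst).
- exact: (measurableT_comp f2 measurable_fst).
Qed.

Lemma cmeas2_snd (f : R -> C) : cmeasurable f -> cmeasurable2 (fun z => f z.2).
Proof.
move=> [f1 f2]; split.
- exact: (measurableT_comp f1 measurable_snd).
- exact: (measurableT_comp f2 measurable_snd).
Qed.

Lemma cmeas2_expi (h : R * R -> R) : measurable_fun setT h -> cmeasurable2 (fun z => expi (h z)).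
Proof.
move=> mh; split; apply: (@measurableT_comp _ _ _ _ _ _ _ _ h) => //.
- by apply: continuous_measurable_fun; exact: continuous_cos.
- by apply: continuous_measurable_fun; exact: continuous_sin.
Qed.

Lemma cint_fubini (K : R * R -> C) (p q : R -> R) : cmeasurable2 K ->
  rintegrable p -> rintegrable q -> (forall x t, normc (K (x, t)) <= p x * q t) ->
  [/\ cintegrable (fun x => cint setT (fun t => K (x, t))),
      cintegrable (fun t => cint setT (fun x => K (x, t))) &
      cint setT (fun x => cint setT (fun t => K (x, t))) =
      cint setT (fun t => cint setT (fun x => K (x, t)))].
Proof.
move=> [mK1 mK2] ip iq Kpq.
have [a1 a2 a3] := Rint_fubini mK1 ip iq (fun x t => le_trans (normr_Re _) (Kpq x t)).
have [b1 b2 b3] := Rint_fubini mK2 ip iq (fun x t => le_trans (normr_Im _) (Kpq x t)).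
split; [by split|by split|apply: eq_ReIm; [exact: a3|exact: b3]].
Qed.

End Fubini.

Section Fourier_L1.
Context {R : realType}.
Local Notation C := (complex R).
Local Notation mu := (@lebesgue_measure R).
Implicit Types (f g : R -> C).

(** The factor [1 / (2 pi)] of the inverse transform is left out: with this choice [ifourier] is
    exactly the adjoint of [fourier]. *)
Definition ifourier f (t : R) : C := cint setT (fun x => expi (x * t) * f x).

Lemma fourierE f x : fourier f x = cint setT (fun t => expi (- (x * t)) * f t).
Proof. by []. Qed.

Lemma cintegrable_expi f (h : R -> R) : measurable_fun setT h -> cintegrable f ->
  cintegrable (fun t => expi (h t) * f t).
Proof.
move=> mh; apply: (@cintegrableM _ f (fun t => expi (h t)) 1); first exact: cmeas_expi.
by move=> x; rewrite normc_expi.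
Qed.

Lemma cintegrable_fourier_kernel f x : cintegrable f ->
  cintegrable (fun t => expi (- (x * t)) * f t).
Proof.
by apply: cintegrable_expi; apply: measurable_funN; apply: measurable_funM.
Qed.

Lemma fourier_bound f x : cintegrable f -> normc (fourier f x) <= 2 * \int[mu]_t normc (f t).
Proof.
move=> cf; rewrite fourierE; apply: cint_le.
- exact: cintegrable_fourier_kernel.
- exact: cintegrable_norm.
- by move=> t; rewrite normcM normc_expi mul1r.
Qed.

Let kernel f g : cintegrable f -> cintegrable g ->
  let K z := expi (- (z.1 * z.2)) * f z.2 * conjc (g z.1) in
  cmeasurable2 K /\ forall x t, normc (K (x, t)) <= normc (g x) * normc (f t).
Proof.
move=> cf cg K; split.
  apply: cmeas2_mul; first apply: cmeas2_mul.
  - by apply: cmeas2_expi; apply: measurable_funN; apply: measurable_funM.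
  - exact: (cmeas2_snd (cintegrable_meas cf)).
  - exact: (cmeas2_fst (cmeas_conj (cintegrable_meas cg))).
by move=> x t; rewrite !normcM normc_expi mul1r normc_conj mulrC.
Qed.

Let kernel1 f g x : cintegrable f ->
  cint setT (fun t => expi (- (x * t)) * f t * conjc (g x)) = fourier f x * conjc (g x).
Proof.
move=> cf; rewrite mulrC fourierE -cintZ; last exact: cintegrable_fourier_kernel.
by apply: eq_cint => t; rewrite mulrC.
Qed.

Lemma cintegrable_fourier_mul f g : cintegrable f -> cintegrable g ->
  cintegrable (fun x => fourier f x * conjc (g x)).
Proof.
move=> cf cg; have [mK bK] := kernel cf cg.
have [h _ _] := cint_fubini mK (cintegrable_norm cg) (cintegrable_norm cf) bK.
rewrite (_ : (fun x => _) = (fun x => cint setT (fun t => expi (- (x * t)) * f t * conjc (g x)))).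
  exact: h.
by apply/funext => x; rewrite kernel1.
Qed.

(** Both sides are iterated integrals of [expi (- x t) f t conjc (g x)], in the two orders. *)
Lemma fourier_adjoint f g : cintegrable f -> cintegrable g ->
  cint setT (fun x => fourier f x * conjc (g x)) =
  cint setT (fun t => f t * conjc (ifourier g t)).
Proof.
move=> cf cg; have [mK bK] := kernel cf cg.
have [_ _ h] := cint_fubini mK (cintegrable_norm cg) (cintegrable_norm cf) bK.
have -> : cint setT (fun x => fourier f x * conjc (g x)) =
    cint setT (fun x => cint setT (fun t => expi (- (x * t)) * f t * conjc (g x))).
  by apply: eq_cint => x; rewrite kernel1.
rewrite h; apply: eq_cint => t.
have mt : measurable_fun setT (fun x : R => x * t) by apply: measurable_funM.
have cgt : cintegrable (fun x => expi (x * t) * g x) by exact: cintegrable_expi mt cg.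
rewrite /ifourier -(cint_conj cgt) -(cintZ _ (cintegrable_conj cgt)).
by apply: eq_cint => x /=; rewrite conjcM conj_expi mulrA [f t * _]mulrC.
Qed.

End Fourier_L1.

(** * The Poisson kernel *)

Section Poisson_kernel.
Context {R : realType}.
Local Notation C := (complex R).
Local Notation mu := (@lebesgue_measure R).

(** This is [2 pi] times the probability density of the Cauchy law of scale [e]. *)
Definition poisson (e r : R) : R := 2 * e / (e ^+ 2 + r ^+ 2).

Lemma poisson_ge0 e r : 0 < e -> 0 <= poisson e r.
Proof. by move=> e0; rewrite /poisson divr_ge0 ?mulr_ge0 ?addr_ge0 ?sqr_ge0 ?ltW. Qed.

Lemma poissonN e r : poisson e (- r) = poisson e r.
Proof. by rewrite /poisson sqrrN. Qed.

Let den (e r : R) : 0 < e -> 0 < e ^+ 2 + r ^+ 2.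
Proof. by move=> e0; rewrite ltr_pwDl ?sqr_ge0 ?exprn_gt0. Qed.

Lemma continuous_poisson e : 0 < e -> continuous (poisson e).
Proof.
move=> e0 x; rewrite /poisson; apply: (@cvgM _ _ (nbhs x) _ (fun=> 2 * e) (fun r => (e ^+ 2 + r ^+ 2)^-1)); first exact: cvg_cst.
apply: cvgV; first by rewrite gt_eqF// den.
by apply: cvgD; [exact: cvg_cst|exact: exprn_continuous].
Qed.

Lemma measurable_poisson e : 0 < e -> measurable_fun setT (poisson e).
Proof. by move=> e0; apply: continuous_measurable_fun; exact: continuous_poisson. Qed.

Lemma integral_poisson1 : rintegrable (poisson 1) /\ \int[mu]_r poisson 1 r = 2 * pi.
Proof.
have E : (\int[mu]_r (poisson 1 r)%:E = (2 * pi)%:E)%E.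
  rewrite ge0_symfun_integralT; last 3 first.
  - by move=> x; exact: poisson_ge0.
  - exact: continuous_poisson.
  - by move=> x /=; rewrite poissonN.
  rewrite -set_itvcy EFinM; congr (_ * _)%E.
  rewrite (_ : (fun x => _) = (fun x => (2 * (oneDsqr x)^-1)%:E)); last first.
    by apply/funext => x; rewrite /poisson /oneDsqr expr1n mulr1.
  have h := @integral0y_oneDsqr R.
  under eq_integral do rewrite EFinM.
  rewrite ge0_integralZl// ?h.
  - by rewrite -EFinM mulrC divfK.
  - apply/measurable_EFinP; apply: measurable_funTS; apply: continuous_measurable_fun.
    by move=> x; exact: continuous_oneDsqrV.
have ip : rintegrable (poisson 1).
  apply: ge0_rintegrable; [exact: measurable_poisson|by move=> x; exact: poisson_ge0|].
  by rewrite E ltry.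
by split; [exact: ip|rewrite /Rintegral E].
Qed.

Definition abelw (e x : R) : R := expR (- (e * `|x|)).

Lemma abelw_ge0 (e x : R) : 0 <= abelw e x.
Proof. exact: expR_ge0. Qed.

Lemma abelw_le1 (e x : R) : 0 <= e -> abelw e x <= 1.
Proof. by move=> e0; rewrite -expR0 ler_expR oppr_le0 mulr_ge0. Qed.

Lemma continuous_abelw e : continuous (abelw e).
Proof.
move=> x; apply: (@continuous_comp _ _ _ (fun x : R => - (e * `|x|)) expR).
  by apply: cvgN; apply: cvgM; [exact: cvg_cst|exact: norm_continuous].
exact: continuous_expR.
Qed.

Lemma measurable_abelw e : measurable_fun setT (abelw e).
Proof. by apply: continuous_measurable_fun; exact: continuous_abelw. Qed.

Let prim (e r x : R) : R :=
  expR (- (e * x)) * ((r * sin (r * x) - e * cos (r * x)) / (e ^+ 2 + r ^+ 2) - e^-1).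

Let dprim (e r x : R) : 0 < e -> is_derive x 1 (prim e r) (expR (- (e * x)) * (1 + cos (r * x))).
Proof.
move=> e0; have dn0 : e ^+ 2 + r ^+ 2 != 0 by rewrite gt_eqF// den.
have en0 : e != 0 by rewrite gt_eqF.
have aff (k : R) : is_derive x 1 (fun x : R => k * x) k.
  have := @is_deriveZ _ _ _ id k x 1 1 (is_derive_id _ _).
  by rewrite /GRing.scale /= mulr1.
have h1 : is_derive x 1 (fun x : R => expR (- (e * x))) (expR (- (e * x)) * (- e)).
  have := @is_derive1_comp _ expR (fun x => - e * x) x _ _ (is_derive_expR _) (aff (- e)).
  by rewrite (_ : expR \o _ = fun x => expR (- (e * x))) ?mulNr//; apply/funext => y; rewrite /= mulNr.
have h2 : is_derive x 1 (fun x : R => sin (r * x)) (cos (r * x) * r).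
  exact: (@is_derive1_comp _ sin (fun x => r * x) x _ _ (is_derive_sin _) (aff r)).
have h3 : is_derive x 1 (fun x : R => cos (r * x)) (- sin (r * x) * r).
  exact: (@is_derive1_comp _ cos (fun x => r * x) x _ _ (is_derive_cos _) (aff r)).
pose q x := (r * sin (r * x) - e * cos (r * x)) / (e ^+ 2 + r ^+ 2) - e^-1.
have h4 : is_derive x 1 q ((r * (cos (r * x) * r) - e * (- sin (r * x) * r)) / (e ^+ 2 + r ^+ 2)).
  rewrite (_ : q = (fun x => (e ^+ 2 + r ^+ 2)^-1 * (r * sin (r * x) - e * cos (r * x)) - e^-1)); last first.
    by apply/funext => y; rewrite /q mulrC.
  have h5 := @is_deriveB _ _ _ _ _ x 1 _ _ (is_deriveZ r h2) (is_deriveZ e h3).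
  have h6 := @is_deriveB _ _ _ _ _ x 1 _ _ (is_deriveZ (e ^+ 2 + r ^+ 2)^-1 h5) (is_derive_cst e^-1 x 1).
  by rewrite subr0 /GRing.scale /= mulrC in h6.
have h7 := is_deriveM h1 h4.
rewrite (_ : prim e r = (fun x => expR (- (e * x))) * q)//.
apply: is_derive_eq h7 _; rewrite /GRing.scale /= /q; field.
by rewrite en0 dn0.
Qed.

Let prim_cvg (e r : R) : 0 < e -> prim e r x @[x --> +oo] --> 0.
Proof.
move=> e0; pose K := (`|r| + e) / (e ^+ 2 + r ^+ 2) + e^-1.
have K0 : 0 <= K by rewrite addr_ge0 ?divr_ge0 ?invr_ge0 ?addr_ge0 ?sqr_ge0// ltW.
have bnd x : `|prim e r x| <= expR (- (e * x)) * K.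
  rewrite normrM ger0_norm ?expR_ge0// ler_wpM2l ?expR_ge0//.
  apply: le_trans (ler_normB _ _) _; rewrite lerD//; last by rewrite ger0_norm// invr_ge0 ltW.
  rewrite normrM ler_pM//; last by rewrite ger0_norm// invr_ge0 ltW ?den.
  apply: le_trans (ler_normB _ _) _; rewrite !normrM lerD//.
    by rewrite ler_piMr// sin_max.
  by rewrite (ger0_norm (ltW e0)) ler_piMr ?cos_max// ltW.
have lim : expR (- (e * x)) * K @[x --> +oo] --> 0.
  rewrite -[X in _ --> X](mul0r K); apply: cvgM; last exact: cvg_cst.
  apply: (cvg_comp (fun x => e * x) (fun x => expR (- x))); last exact: cvgr_expR.
  exact: gt0_cvgMry.
apply/cvgrPdist_le => d d0; move/cvgrPdist_le : lim => /(_ d d0).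
apply: filterS => x; rewrite !sub0r !normrN => h; apply: le_trans (bnd x) _.
by apply: le_trans h; rewrite ler_norm.
Qed.

Let integral_abelw_cos1 (e r : R) : 0 < e ->
  (\int[mu]_x (abelw e x * (1 + cos (r * x)))%:E = (2 / e + poisson e r)%:E)%E.
Proof.
move=> e0; have ge1 x : 0 <= 1 + cos (r * x) by rewrite addrC -lerBlDr sub0r cos_geN1.
have cc : continuous (fun x : R => 1 + cos (r * x)).
  move=> x; apply: cvgD; first exact: cvg_cst.
  apply: (@continuous_comp _ _ _ (fun x : R => r * x) cos); last exact: continuous_cos.
  by apply: cvgM; [exact: cvg_cst|exact: cvg_id].
have cf : continuous (fun x : R => abelw e x * (1 + cos (r * x))).
  by move=> x; apply: cvgM; [exact: continuous_abelw|exact: cc].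
rewrite ge0_symfun_integralT//; last 2 first.
- by move=> x; rewrite mulr_ge0// abelw_ge0.
- by move=> x; rewrite /abelw /= normrN mulrN cosN.
rewrite -set_itvcy.
have -> : (\int[mu]_(x in `[0%R, +oo[) (abelw e x * (1 + cos (r * x)))%:E =
    \int[mu]_(x in `[0%R, +oo[) (expR (- (e * x)) * (1 + cos (r * x)))%:E)%E.
  by apply: eq_integral => x; rewrite inE/= in_itv/= andbT => x0; rewrite /abelw ger0_norm.
have cE : continuous (fun x : R => expR (- (e * x))).
  move=> x; apply: (@continuous_comp _ _ _ (fun x : R => - (e * x)) expR); last exact: continuous_expR.
  by apply: cvgN; apply: cvgM; [exact: cvg_cst|exact: cvg_id].
rewrite (ge0_continuous_FTC2y _ _ (prim_cvg r e0))//=.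
- rewrite -EFinD add0r -EFinM; congr (_%:E).
  rewrite /prim !mulr0 oppr0 expR0 sin0 cos0 /poisson; field.
  by rewrite !gt_eqF// den.
- apply: continuous_subspaceT => x; apply: cvgM; [exact: cE|exact: cc].
- apply: cvg_at_right_filter; apply: differentiable_continuous; apply/derivable1_diffP.
  by have [] := dprim r 0 e0.
- by move=> x _; rewrite derive1E; exact: (@derive_val _ _ _ _ _ _ _ (dprim r x e0)).
Qed.

Lemma rintegrable_abelw e : 0 < e -> rintegrable (abelw e).
Proof.
move=> e0; apply: ge0_rintegrable; [exact: measurable_abelw|by move=> x; exact: abelw_ge0|].
have := integral_abelw_cos1 0 e0.
under eq_integral do rewrite mul0r cos0.
move=> h; apply: (@le_lt_trans _ _ (\int[mu]_x (abelw e x * (1 + 1))%:E)%E); last by rewrite h ltry.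
apply: ge0_le_integral => //.
- by move=> x _; rewrite lee_fin abelw_ge0.
- by apply/measurable_EFinP; exact: measurable_abelw.
- apply/measurable_EFinP; apply: measurable_funM => //; exact: measurable_abelw.
- by move=> x _; rewrite lee_fin ler_peMr ?abelw_ge0// lerDl.
Qed.

(** This makes the Abel means of an inverse transform explicit, as convolutions with the Poisson
    kernel. *)
Lemma cint_abelw e r : 0 < e ->
  cint setT (fun x => expi (x * r) * (abelw e x)%:C%C) = (poisson e r)%:C%C.
Proof.
move=> e0; have iw := rintegrable_abelw e0.
have mc (h : R -> R) : continuous h -> measurable_fun setT (fun x => h (r * x)).
  move=> ch; apply: measurableT_comp; first exact: continuous_measurable_fun.
  exact: measurable_funM.
have ic : rintegrable (fun x => abelw e x * cos (r * x)).
  apply: rintegrable_le iw.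
    by apply: measurable_funM; [exact: measurable_abelw|exact: (mc cos (@continuous_cos R))].
  by move=> x; rewrite normrM (ger0_norm (abelw_ge0 _ _)) ler_piMr ?abelw_ge0 ?cos_max.
have key s : \int[mu]_x (abelw e x * (1 + cos (s * x))) = 2 / e + poisson e s.
  by rewrite /Rintegral integral_abelw_cos1.
have w0 : \int[mu]_x abelw e x = 2 / e.
  have := key 0; under eq_Rintegral do rewrite mul0r cos0 mulrC.
  rewrite RintZ// /poisson expr0n addr0 => h.
  have en0 : e != 0 by rewrite gt_eqF.
  have -> : 2 / e = (2 / e + 2 * e / e ^+ 2) / 2 by field.
  by rewrite -h mulrC mulKf.
apply: eq_ReIm => /=.
- under eq_Rintegral do rewrite /rpart mulrC ReM_real /= [_ * r]mulrC.
  have := key r; under eq_Rintegral do rewrite mulrDr mulr1.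
  by rewrite RintD// w0 => /addrI.
- under eq_Rintegral do rewrite /ipart mulrC ImM_real /= [_ * r]mulrC.
  set J := \int[mu]_x _; have : J = - J; last by lra.
  have is_ : rintegrable (fun x => abelw e x * sin (r * x)).
    apply: rintegrable_le iw.
      by apply: measurable_funM; [exact: measurable_abelw|exact: (mc sin (@continuous_sin R))].
    by move=> x; rewrite normrM (ger0_norm (abelw_ge0 _ _)) ler_piMr ?abelw_ge0 ?sin_max.
  rewrite -RintN// -(Rint_opp (rintegrableN is_)).
  by apply: eq_Rintegral => x _; rewrite /abelw normrN mulrN sinN mulrN opprK.
Qed.

End Poisson_kernel.

(** * Plancherel for bounded continuous functions *)

Section Plancherel.
Context {R : realType}.
Local Notation C := (complex R).
Local Notation mu := (@lebesgue_measure R).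
Implicit Types (f g : R -> C).

Definition cabelw (e : R) : R -> C := fun x => (abelw e x)%:C%C.

Lemma cintegrable_cabelw (e : R) : 0 < e -> cintegrable (cabelw e).
Proof. by move=> e0; split; [exact: rintegrable_abelw|exact: integrable0]. Qed.

Lemma fourier_meas f : cintegrable f -> cmeasurable (fourier f).
Proof.
move=> cf; have h := cintegrable_fourier_mul cf (cintegrable_cabelw (@ltr01 R)).
rewrite (_ : fourier f = (fun x => (fourier f x * conjc (cabelw 1 x)) * (expR `|x|)%:C%C)).
  apply: cmeas_mul; first exact: cintegrable_meas h.
  apply: cmeas_real; apply: measurableT_comp; first exact: measurable_expR.
  exact: normr_measurable.
apply/funext => x; rewrite conjc_real -mulrA -rmorphM/= /abelw mul1r.
by rewrite -expRD addNr expR0 mulr1.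
Qed.

Lemma ifourier_fourier f t : ifourier f t = fourier f (- t).
Proof. by apply: eq_cint => x; rewrite mulNr opprK [x * t]mulrC. Qed.

Let eps (n : nat) : R := n.+1%:R^-1.

Let eps0 n : 0 < eps n.
Proof. by rewrite invr_gt0. Qed.

Let cvg_eps : eps n @[n --> \oo] --> 0.
Proof. exact: cvg_harmonic. Qed.

Lemma poisson_scale (e r : R) : 0 < e -> e * poisson e (e * r) = poisson 1 r.
Proof.
move=> e0; rewrite /poisson; field.
by rewrite gt_eqF//= ?gt_eqF// ?ltr_pwDl ?sqr_ge0 ?exprn_gt0.
Qed.

Lemma cintegrable_poisson f (M : R) (s : R -> R) : cmeasurable f -> (forall x, normc (f x) <= M) ->
  measurable_fun setT s ->
  cintegrable (fun r => f (s r) * (poisson 1 r)%:C%C).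
Proof.
move=> mf fM ms; have [ip _] := @integral_poisson1 R.
apply: (cintegrable_le _ _ (rintegrableZ M ip)).
  by apply: cmeas_mul; [exact: cmeas_comp ms mf|exact: cmeas_real (measurable_poisson ltr01)].
move=> x; rewrite normcM normc_real ger0_norm ?poisson_ge0//.
by rewrite ler_wpM2r ?poisson_ge0.
Qed.

(** Abel means of the inverse transform of [fourier f] are Poisson averages of [f]: move the
    transform onto the Abel kernel with [fourier_adjoint] and rescale. *)
Lemma ifourier_abel f (M e t : R) : cintegrable f -> (forall x, normc (f x) <= M) -> 0 < e ->
  ifourier (fun x => fourier f x * (abelw e x)%:C%C) t =
  cint setT (fun r => f (e * r + t) * (poisson 1 r)%:C%C).
Proof.
move=> cf fM e0.
pose g x := expi (- t * x) * cabelw e x.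
have mt : measurable_fun setT (fun x : R => - t * x) by exact: measurable_funM.
have cg : cintegrable g by exact: cintegrable_expi mt (cintegrable_cabelw e0).
have -> : ifourier (fun x => fourier f x * (abelw e x)%:C%C) t = cint setT (fun x => fourier f x * conjc (g x)).
  apply: eq_cint => x; rewrite /g conjcM conj_expi conjc_real mulNr opprK mulrCA [t * x]mulrC.
  by rewrite mulrA.
rewrite fourier_adjoint//.
have ig s : ifourier g s = (poisson e (s - t))%:C%C.
  rewrite -cint_abelw//; apply: eq_cint => x; rewrite /g mulrA -expiD; congr (expi _ * _).
  by rewrite mulrBr mulNr [t * x]mulrC.
have cp : cintegrable (fun s => f s * (poisson e (s - t))%:C%C).
  apply: (cintegrable_le _ _ (rintegrableZ (2 * e / e ^+ 2) (cintegrable_norm cf))).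
    apply: cmeas_mul; first exact: cintegrable_meas.
    apply: cmeas_real; apply: (@measurableT_comp _ _ _ _ _ _ (poisson e)); first exact: measurable_poisson.
    exact: measurable_funB.
  move=> s; rewrite normcM normc_real ger0_norm ?poisson_ge0// mulrC ler_wpM2r ?normc_ge0//.
  rewrite /poisson; apply: ler_wpM2l; first by rewrite mulr_ge0// ltW.
  by rewrite lef_pV2 ?posrE ?exprn_gt0 ?ltr_pwDl ?sqr_ge0 ?exprn_gt0// lerDl sqr_ge0.
have -> : cint setT (fun s => f s * conjc (ifourier g s)) = cint setT (fun s => f s * (poisson e (s - t))%:C%C).
  by apply: eq_cint => s; rewrite ig conjc_real.
rewrite (cint_affine t e0 cp) -cintZ; last exact: (cintegrable_affine t e0 cp).
apply: eq_cint => r; rewrite mulrCA -rmorphM/= addrK.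
by rewrite poisson_scale.
Qed.

(** The Poisson kernels form an approximate identity, and a bounded continuous function is the limit
    of its averages everywhere. *)
Lemma cvg_poisson_average f (M : R) t : continuous (rpart f) -> continuous (ipart f) ->
  (forall x, normc (f x) <= M) ->
  (complex.Re (cint setT (fun r => f (eps n * r + t) * (poisson 1 r)%:C%C)) @[n --> \oo]
    --> 2 * pi * complex.Re (f t)) /\
  (complex.Im (cint setT (fun r => f (eps n * r + t) * (poisson 1 r)%:C%C)) @[n --> \oo]
    --> 2 * pi * complex.Im (f t)).
Proof.
move=> c1 c2 fM; have [ip ep] := @integral_poisson1 R.
have one (p : R -> R) : continuous p -> (forall x, `|p x| <= M) ->
    \int[mu]_r (p (eps n * r + t) * poisson 1 r) @[n --> \oo] --> 2 * pi * p t.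
  move=> cp pM.
  have [] := @Rint_dct _ (fun n r => p (eps n * r + t) * poisson 1 r) (fun r => p t * poisson 1 r)
      (fun r => M * poisson 1 r).
  - move=> n; apply: measurable_funM; last exact: measurable_poisson.
    apply: measurableT_comp; first exact: continuous_measurable_fun.
    exact: measurable_affine.
  - move=> r; apply: cvgM; last exact: cvg_cst.
    apply: continuous_cvg; first exact: cp.
    rewrite -[X in _ --> X]add0r -[X in _ --> X + _](mul0r r).
    by apply: cvgD; [apply: cvgM; [exact: cvg_eps|exact: cvg_cst]|exact: cvg_cst].
  - exact: rintegrableZ.
  - move=> n r; rewrite normrM [ `|poisson _ _| ]ger0_norm ?poisson_ge0//.
    by rewrite ler_wpM2r ?poisson_ge0.
  by move=> _; rewrite RintZ// ep mulrC.
split.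
- rewrite (_ : (fun n => complex.Re _) = (fun n => \int[mu]_r (rpart f (eps n * r + t) * poisson 1 r))).
    exact: one c1 (fun x => le_trans (normr_Re _) (fM x)).
  apply/funext => n; apply: eq_Rintegral => r _.
  by rewrite /rpart mulrC ReM_real mulrC.
- rewrite (_ : (fun n => complex.Im _) = (fun n => \int[mu]_r (ipart f (eps n * r + t) * poisson 1 r))).
    exact: one c2 (fun x => le_trans (normr_Im _) (fM x)).
  apply/funext => n; apply: eq_Rintegral => r _.
  by rewrite /ipart mulrC ImM_real mulrC.
Qed.

Definition plancherel_at f := L2 (fourier f) /\ n2 (fourier f) = 2 * pi * n2 f.

(** By [fourier_adjoint] used twice, [\int |fourier f|^2 exp (- e |x|)] is the inner product of [f]
    with its Poisson average, which tends to [2 pi |f|^2]; the left-hand side increases to [\int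
    |fourier f|^2]. *)
Lemma plancherel_continuous f (M : R) : continuous (rpart f) -> continuous (ipart f) ->
  (forall x, normc (f x) <= M) -> cintegrable f -> L2 f -> plancherel_at f.
Proof.
move=> c1 c2 fM cf lf; have [ip ep] := @integral_poisson1 R.
have M0 : 0 <= M by apply: le_trans (fM 0); exact: normc_ge0.
have mf := cintegrable_meas cf; have mF := fourier_meas cf.
pose u n t := cint setT (fun r => f (eps n * r + t) * (poisson 1 r)%:C%C).
have uE n t : ifourier (fun x => fourier f x * (abelw (eps n) x)%:C%C) t = u n t.
  exact: ifourier_abel cf fM (eps0 n).
pose A n := \int[mu]_x (nsq (fourier f x) * abelw (eps n) x).
have ub n t : normc (u n t) <= 2 * (M * (2 * pi)).
  rewrite -ep -RintZ//; apply: cint_le.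
  - exact: (cintegrable_poisson mf fM (measurable_affine (eps n) t)).
  - exact: rintegrableZ.
  - by move=> r; rewrite normcM normc_real ger0_norm ?poisson_ge0// ler_wpM2r ?poisson_ge0.
have ig n : cintegrable (fun x => fourier f x * (abelw (eps n) x)%:C%C).
  have h := cintegrable_fourier_mul cf (cintegrable_cabelw (eps0 n)).
  by rewrite (_ : (fun x => _) = (fun x => fourier f x * conjc (cabelw (eps n) x)))//; apply/funext => x; rewrite conjc_real.
have AE n : A n = \int[mu]_t (complex.Re (f t) * complex.Re (u n t) + complex.Im (f t) * complex.Im (u n t)).
  have := fourier_adjoint cf (ig n).
  move=> /(congr1 (@complex.Re R)) h; rewrite (_ : A n = complex.Re (cint setT (fun x => fourier f x * conjc (fourier f x * (abelw (eps n) x)%:C%C)))).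
    rewrite h; apply: eq_Rintegral => t _; rewrite /rpart uE ReM ReC ImC.
    by rewrite mulrN opprK.
  by apply: eq_Rintegral => x _; rewrite /rpart conjcM conjc_real mulrA mul_conjc mulrC ReM_real mulrC.
have Alim : A n @[n --> \oo] --> 2 * pi * n2 f.
  have mu_ n : cmeasurable (u n).
    rewrite (_ : u n = fun t => fourier (fun x => fourier f x * (abelw (eps n) x)%:C%C) (- t)).
      by apply: cmeas_comp; [exact: oppr_measurable|exact: fourier_meas (ig n)].
    by apply/funext => t; rewrite -uE ifourier_fourier.
  have [] := @Rint_dct _ (fun n t => complex.Re (f t) * complex.Re (u n t) + complex.Im (f t) * complex.Im (u n t))
     (fun t => 2 * pi * nsq (f t)) (fun t => normc (f t) * (2 * (2 * (M * (2 * pi))))).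
  - move=> n; have [m1 m2] := mf; have [m3 m4] := mu_ n.
    by apply: measurable_funD; apply: measurable_funM.
  - move=> t; have [h1 h2] := cvg_poisson_average t c1 c2 fM.
    rewrite (_ : 2 * pi * nsq (f t) = complex.Re (f t) * (2 * pi * complex.Re (f t)) + complex.Im (f t) * (2 * pi * complex.Im (f t))).
      by apply: cvgD; apply: cvgM; [exact: cvg_cst|exact: h1|exact: cvg_cst|exact: h2].
    by rewrite /nsq; ring.
  - under eq_fun do rewrite mulrC; apply: rintegrableZ; exact: cintegrable_norm.
  - move=> n t; rewrite (le_trans (ler_normD _ _))// mulr_natl mulr2n mulrDr.
    rewrite !normrM; apply: lerD; apply: ler_pM => //.
    + exact: normr_Re.
    + exact: le_trans (normr_Re _) (ub n t).
    + exact: normr_Im.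
    + exact: le_trans (normr_Im _) (ub n t).
  move=> _; rewrite RintZ; last exact: L2_int.
  by under eq_fun do rewrite -AE.
have mA n : measurable_fun setT (fun x => nsq (fourier f x) * abelw (eps n) x).
  by apply: measurable_funM; [exact: measurable_nsq|exact: measurable_abelw].
have cA x : nsq (fourier f x) * abelw (eps n) x @[n --> \oo] --> nsq (fourier f x).
  rewrite -[X in _ --> X]mulr1; apply: cvgM; first exact: cvg_cst.
  rewrite -expR0 /abelw; apply: continuous_cvg; first exact: continuous_expR.
  rewrite -[X in _ --> X]oppr0 -[X in _ --> - X](mul0r `|x|).
  by apply: cvgN; apply: cvgM; [exact: cvg_eps|exact: cvg_cst].
have iA n : rintegrable (fun x => nsq (fourier f x) * abelw (eps n) x).
  have h := cintegrable_fourier_mul cf (ig n).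
  apply: rintegrable_le (cintegrable_norm h); first exact: mA.
  move=> x; rewrite conjcM mulrA mul_conjc conjc_real -rmorphM normc_real.
  exact: lexx.
have LF : L2 (fourier f).
  apply: L2_fin => //; apply: (@le_lt_trans _ _ (2 * pi * n2 f + 1)%:E); last exact: ltry.
  have [n0 _ hn0] : \forall n \near \oo, A n <= 2 * pi * n2 f + 1.
    move/cvgrPdist_le : Alim => /(_ 1 ltr01); apply: filterS => n.
    by rewrite distrC => h; rewrite addrC -lerBlDr (le_trans (ler_norm _)).
  apply: (@fatou_bound _ (fun n x => nsq (fourier f x) * abelw (eps n) x) _ _ n0) => //.
    by move=> n x; rewrite mulr_ge0 ?nsq_ge0 ?abelw_ge0.
  by move=> n nn0; rewrite -EFin_Rint// lee_fin; exact: hn0.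
split => //.
have [] := @Rint_dct _ (fun n x => nsq (fourier f x) * abelw (eps n) x) (fun x => nsq (fourier f x)) (fun x => nsq (fourier f x)).
- exact: mA.
- exact: cA.
- exact: L2_int.
- move=> n x; rewrite ger0_norm ?mulr_ge0 ?nsq_ge0 ?abelw_ge0//.
  by rewrite ler_piMr ?nsq_ge0// abelw_le1// ltW.
move=> _ lim; rewrite n2I; exact: (cvg_unique _ lim Alim).
Qed.

End Plancherel.

(** * Approximation by continuous functions *)

Section Continuous_approximation.
Context {R : realType}.
Local Notation C := (complex R).
Local Notation mu := (@lebesgue_measure R).
Implicit Types (f g h : R -> C).

Let clamp (c y : R) : R := Num.max (- c) (Num.min c y).

Let clamp_bound (c y : R) : 0 <= c -> `|clamp c y| <= c.
Proof.
move=> c0; rewrite ler_norml /clamp le_max lexx /= ge_max ge_min lexx /= andbT.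
by rewrite (le_trans _ c0)// oppr_le0.
Qed.

Let clamp_close (c q y : R) : `|q| <= c -> `|q - clamp c y| <= `|q - y|.
Proof.
rewrite ler_norml => /andP[h1 h2]; rewrite /clamp; have [y1|y1] := leP y c.
  have [y2|y2] := leP (- c) y; first by [].
  by rewrite opprK ger0_norm ?(le_trans _ (ler_norm _))//; lra.
rewrite max_r; last by lra.
by rewrite distrC [leRHS]distrC ger0_norm ?(le_trans _ (ler_norm _))//; lra.
Qed.

Let clamp_continuous (c : R) (g : R -> R) : continuous g -> continuous (fun x => clamp c (g x)).
Proof.
move=> cg x; apply: (@continuous_max _ _ (fun=> - c) (fun x => Num.min c (g x))).
  exact: cvg_cst.
by apply: (@continuous_min _ _ (fun=> c) g); [exact: cvg_cst|exact: cg].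
Qed.

(** Clamping and a trapezoidal cut-off keep an L1 approximant continuous,
    bounded by the same constant, and supported near the support of the target. *)
Lemma approx_continuous_real (q : R -> R) (M r e : R) : measurable_fun setT q -> 0 <= M -> 0 < r ->
  (forall x, `|q x| <= M) -> (forall x, r < `|x| -> q x = 0) -> 0 < e ->
  exists h : R -> R, [/\ continuous h, forall x, `|h x| <= M,
    forall x, r + 1 < `|x| -> h x = 0 &
    rintegrable (fun x => `|q x - h x|) /\ \int[mu]_x `|q x - h x| <= e].
Proof.
move=> mq M0 r0 qM qr e0; pose E := `[(- (r + 1))%R, r + 1]%classic.
have mE : measurable E by exact: measurable_itv.
have fE : (mu E < +oo)%E by rewrite lebesgue_measure_itv/=; case: ifP => _; rewrite ?ltry.
have iq : mu.-integrable E (EFin \o q).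
  apply: measurable_bounded_integrable => //; first exact: measurable_funTS.
  exists M; split; first exact: num_real.
  by move=> y My x _ /=; rewrite (le_trans (qM x))// ltW.
have [g_ [cg ig lim]] := approximation_continuous_integrable mE fE iq.
have [n hn] : exists n, (\int[mu]_(z in E) `|(q z - g_ n z)%:E| <= e%:E)%E.
  move/fine_cvgP : lim => [fin /cvgrPdist_le /(_ e e0) h].
  near \oo => n; exists n.
  have fn : (\int[mu]_(z in E) `|(q z - g_ n z)%:E|)%E \is a fin_num by near: n.
  rewrite -(fineK fn) lee_fin; have : `|0 - fine (\int[mu]_(z in E) `|(q z - g_ n z)%:E|)%E| <= e by near: n.
  by rewrite sub0r normrN; apply: le_trans; exact: ler_norm.
pose chi' (x : R) : R := Num.max 0 (Num.min 1 (r + 1 - `|x|)).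
pose h (x : R) : R := chi' x * clamp M (g_ n x).
have cchi : continuous chi'.
  move=> x; apply: (@continuous_max _ _ (fun=> 0) (fun x => Num.min 1 (r + 1 - `|x|))).
    exact: cvg_cst.
  apply: (@continuous_min _ _ (fun=> 1) (fun x => r + 1 - `|x|)); first exact: cvg_cst.
  by apply: cvgB; [exact: cvg_cst|exact: norm_continuous].
have chi01 x : 0 <= chi' x <= 1 by rewrite /chi' le_max lexx /= ge_max ler01 ge_min lexx.
have ch : continuous h.
  by move=> x; apply: cvgM; [exact: cchi|exact: (@clamp_continuous M (g_ n) (cg n) x)].
have hM x : `|h x| <= M.
  have /andP[c0 c1] := chi01 x.
  by rewrite normrM ger0_norm// -[leRHS]mul1r ler_pM// clamp_bound.
have hr x : r + 1 < `|x| -> h x = 0.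
  move=> rx; rewrite /h /chi' max_l ?mul0r//.
  by rewrite ge_min; apply/orP; right; rewrite subr_le0 ltW.
have close x : `|q x - h x| <= `|q x - g_ n x|.
  have [xr|xr] := leP `|x| r.
    rewrite /h /chi' min_l ?max_r ?mul1r; [exact: clamp_close|done|].
    by rewrite lerBrDr addrC lerD2r.
  rewrite (qr x xr) !sub0r !normrN /h normrM; have /andP[c0 c1] := chi01 x.
  rewrite (ger0_norm c0); apply: (@le_trans _ _ (1 * `|clamp M (g_ n x)|)).
    by rewrite ler_wpM2r.
  have := @clamp_close M 0 (g_ n x); rewrite mul1r normr0 !sub0r !normrN; exact.
exists h; split; [exact: ch|exact: hM|exact: hr|].
have mh : measurable_fun setT (fun x => `|q x - h x|).
  apply: measurableT_comp => //; apply: measurable_funB => //.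
  exact: continuous_measurable_fun.
have le : (\int[mu]_x (`|q x - h x|)%:E <= e%:E)%E.
  apply: le_trans hn; rewrite [leRHS]integral_mkcond.
  apply: (ge0_le_integral _ measurableT).
  - by move=> x _; rewrite lee_fin.
  - exact/measurable_EFinP.
  - apply/(measurable_restrictT _ mE); apply: measurableT_comp => //.
    apply/measurable_EFinP; apply: measurable_funTS; apply: measurable_funB => //.
    by apply: continuous_measurable_fun; exact: cg.
  - move=> x _; rewrite patchE; case: ifPn => xE.
      by rewrite abse_EFin lee_fin.
    rewrite notin_setE /E/= in_itv/= in xE.
    have rx : r + 1 < `|x| by rewrite ltNge ler_norml; apply/negP.
    by rewrite hr// qr ?subr0 ?normr0// (lt_trans _ rx)// ltrDl.
have irr : rintegrable (fun x => `|q x - h x|).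
  by apply: ge0_rintegrable => //; exact: le_lt_trans le (ltry _).
by split; [exact: irr|rewrite -lee_fin EFin_Rint].
Unshelve. all: by end_near. Qed.

(** The intersection of L1 and L2: here the transform is given by the integral and Plancherel's
    identity makes sense. *)
Definition L12 f := cintegrable f /\ L2 f.

Lemma L12B f g : L12 f -> L12 g -> L12 (fun x => f x - g x).
Proof.
move=> [cf lf] [cg lg]; split; last exact: L2B.
apply: cintegrableD => //; rewrite (_ : (fun x => - g x) = (fun x => (-1) * g x)).
  exact: cintegrableZ.
by apply/funext => x; rewrite mulN1r.
Qed.

Let approx_compact f (M r e : R) : L12 f -> 0 < r ->
  (forall x, normc (f x) <= M) -> (forall x, r < `|x| -> f x = 0) -> 0 < e ->
  exists h, [/\ continuous (rpart h) /\ continuous (ipart h), exists K, forall x, normc (h x) <= K,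
    L12 h, \int[mu]_x normc (f x - h x) <= e & n2 (fun x => f x - h x) <= e].
Proof.
move=> [cf lf] r0 fM fr e0.
have M0 : 0 <= M by apply: le_trans (fM 0); exact: normc_ge0.
pose e' := e / (4 * M + 2).
have D0 : 0 < 4 * M + 2 by rewrite ltr_wpDl ?mulr_ge0.
have e'0 : 0 < e' by rewrite divr_gt0.
have [mf1 mf2] := cintegrable_meas cf.
have [|h1 [c1 b1 s1 [i1 l1]]] := @approx_continuous_real (rpart f) M r e' mf1 M0 r0 (fun x => le_trans (normr_Re _) (fM x)) _ e'0.
  by move=> x /fr h; rewrite /rpart h.
have [|h2 [c2 b2 s2 [i2 l2]]] := @approx_continuous_real (ipart f) M r e' mf2 M0 r0 (fun x => le_trans (normr_Im _) (fM x)) _ e'0.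
  by move=> x /fr h; rewrite /ipart h.
pose h x := Complex (h1 x) (h2 x).
have mh : cmeasurable h by split; exact: continuous_measurable_fun.
have mfh : cmeasurable (fun x => f x - h x) by apply: cmeas_sub => //; exact: cintegrable_meas.
have i12 := rintegrableD i1 i2.
have b x : normc (f x - h x) <= `|rpart f x - h1 x| + `|ipart f x - h2 x|.
  by apply: le_trans (normc_le_ReIm _) _; rewrite ReD ImD ReN ImN.
have cfh : cintegrable (fun x => f x - h x) := cintegrable_le mfh b i12.
have bd (y z : R) : `|y| <= M -> `|z| <= M -> (y - z) ^+ 2 <= 2 * M * `|y - z|.
  move=> yM zM; rewrite -real_normK ?num_real// expr2 ler_wpM2r//.
  by rewrite (le_trans (ler_normB _ _))// mulr_natl mulr2n lerD.
have b' x : nsq (f x - h x) <= 2 * M * (`|rpart f x - h1 x| + `|ipart f x - h2 x|).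
  rewrite mulrDr /nsq ReD ImD ReN ImN; apply: lerD.
  - exact: (bd _ _ (le_trans (normr_Re _) (fM x)) (b1 x)).
  - exact: (bd _ _ (le_trans (normr_Im _) (fM x)) (b2 x)).
have lfh : L2 (fun x => f x - h x) := L2_le mfh (rintegrableZ _ i12) b'.
have hE : h = (fun x => f x - (f x - h x)) by apply/funext => x; rewrite opprB addrC subrK.
have [Lh1 Lh2] : L12 h by rewrite hE; apply: L12B; split.
exists h; split; [by split| |by split| |].
- by exists (M + M) => x; apply: le_trans (normc_le_ReIm _) _; exact: (lerD (b1 x) (b2 x)).
- apply: (@le_trans _ _ (\int[mu]_x (`|rpart f x - h1 x| + `|ipart f x - h2 x|))).
    by apply: le_Rint => //; exact: cintegrable_norm.
  rewrite RintD//; apply: le_trans (lerD l1 l2) _.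
  rewrite -mulrDl ler_pdivrMr//.
  by have := mulr_ge0 (ltW e0) M0; nra.
- apply: le_trans (n2_le (rintegrableZ _ i12) lfh b') _.
  rewrite RintZ// RintD//; apply: (@le_trans _ _ (2 * M * (e' + e'))).
    by rewrite ler_wpM2l ?mulr_ge0// lerD.
  by rewrite /e' -mulrDl mulrA ler_pdivrMr// (_ : 2 * M * (e + e) = e * (4 * M)) ?ler_wpM2l ?(ltW e0)//; [lra|ring].
Qed.

Let trunc (n : nat) f : set R := [set x | `|x| <= n.+1%:R /\ nsq (f x) <= n%:R].

Let mtrunc n f : cmeasurable f -> measurable (trunc n f).
Proof.
move=> mf; rewrite (_ : trunc n f = (fun x : R => `|x| <= n.+1%:R) @^-1` [set true] `&` (fun x => nsq (f x) <= n%:R) @^-1` [set true]).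
  apply: measurableI; rewrite -[X in measurable X]setTI.
  - by apply: (@measurable_fun_ler _ _ _ _ (fun x : R => `|x|) (fun=> n.+1%:R)) => //; exact: normr_measurable.
  - by apply: (@measurable_fun_ler _ _ _ _ (fun x => nsq (f x)) (fun=> n%:R)) => //; exact: measurable_nsq.
by apply/seteqP; split => x.
Qed.

Let trunc_near f x : \forall n \near \oo, trunc n f x.
Proof.
exists (Num.truncn (`|x| + nsq (f x))).+1 => // n /= hn.
have h : `|x| + nsq (f x) <= n%:R.
  by apply/ltW; apply: lt_le_trans (truncnS_gt _) _; rewrite ler_nat.
split; last by apply: le_trans h; rewrite lerDr.
by apply: le_trans (le_trans h _); rewrite ?lerDl ?nsq_ge0// ler_nat.
Qed.

(** Truncate [f] in both size and support; a bounded function of bounded support is close to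
    continuous ones in L1, and boundedness upgrades this to L2. *)
Lemma approx_continuous f (e : R) : L12 f -> 0 < e ->
  exists h, [/\ continuous (rpart h) /\ continuous (ipart h), exists K, forall x, normc (h x) <= K,
    L12 h, \int[mu]_x normc (f x - h x) <= e & n2 (fun x => f x - h x) <= e].
Proof.
move=> [cf lf] e0; have mf := cintegrable_meas cf.
pose fn n x := cind (trunc n f) x * f x.
have mfn n : cmeasurable (fn n) by apply: cmeas_mul => //; apply: cmeas_cind; exact: mtrunc.
have Lfn n : L12 (fn n).
  split; last by apply: L2_cind => //; exact: mtrunc.
  by apply: (cintegrableM (cmeas_cind (mtrunc n mf)) (normc_cind _) cf).
have E (x : R) : \forall n \near \oo, f x - fn n x = 0.
  by apply: filterS (trunc_near f x) => n h; rewrite /fn cind_in// mul1r subrr.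
have ndiff n x : nsq (f x - fn n x) <= nsq (f x).
  have [h|h] := pselect (trunc n f x).
    by rewrite /fn cind_in// mul1r subrr nsq0 nsq_ge0.
  by rewrite /fn cind_out// mul0r subr0.
have [_ lim1] : rintegrable (fun _ : R => 0 : R) /\ \int[mu]_x normc (f x - fn n x) @[n --> \oo] --> \int[mu]_x (0:R).
  apply: (@Rint_dct _ (fun n x => normc (f x - fn n x)) (fun=> 0) (fun x => normc (f x))).
  - by move=> n; apply: (@measurable_normc _ (fun x => f x - fn n x)); exact: cmeas_sub.
  - move=> x; apply: cvg_near_cst.
    by apply: filterS (E x) => n ->; rewrite normcE nsq0 sqrtr0.
  - exact: cintegrable_norm.
  - by move=> n x; rewrite ger0_norm ?normc_ge0// !normcE ler_wsqrtr.
have [_ lim2] : rintegrable (fun _ : R => 0 : R) /\ \int[mu]_x nsq (f x - fn n x) @[n --> \oo] --> \int[mu]_x (0:R).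
  apply: (@Rint_dct _ (fun n x => nsq (f x - fn n x)) (fun=> 0) (fun x => nsq (f x))).
  - by move=> n; apply: (@measurable_nsq _ (fun x => f x - fn n x)); exact: cmeas_sub.
  - move=> x; apply: cvg_near_cst.
    by apply: filterS (E x) => n ->; rewrite nsq0.
  - exact: L2_int.
  - by move=> n x; rewrite ger0_norm ?nsq_ge0.
have I0 : \int[mu]_x (0:R) = 0 by rewrite /Rintegral integral0.
rewrite I0 in lim1 lim2.
have e4 : 0 < e / 4 by rewrite divr_gt0.
have [n [hn1 hn2]] : exists n, \int[mu]_x normc (f x - fn n x) <= e / 4 /\ n2 (fun x => f x - fn n x) <= e / 4.
  move/cvgrPdist_le : lim1 => /(_ _ e4) h1; move/cvgrPdist_le : lim2 => /(_ _ e4) h2.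
  have [n0 _ hn] := filterI h1 h2; exists n0; have [] := hn n0 (leqnn _).
  rewrite !sub0r !normrN => a b; split; first exact: le_trans (ler_norm _) a.
  by rewrite n2I; exact: le_trans (ler_norm _) b.
have [|||h [ch bh lh h1 h2]] := @approx_compact (fn n) (Num.sqrt n%:R) n.+1%:R (e / 4) (Lfn n) _ _ _ e4.
- by [].
- move=> x; rewrite normcE ler_wsqrtr// /fn.
  have [t|t] := pselect (trunc n f x); last by rewrite cind_out// mul0r nsq0.
  by rewrite cind_in// mul1r; case: t.
- move=> x hx; rewrite /fn cind_out ?mul0r// => -[h _].
  by move: hx; rewrite ltNge h.
exists h; split => //.
- have [cd1 _] := L12B (conj cf lf) (Lfn n).
  have [cd2 _] := L12B (Lfn n) lh.
  have [cd3 _] := L12B (conj cf lf) lh.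
  apply: (@le_trans _ _ (\int[mu]_x (normc (f x - fn n x) + normc (fn n x - h x)))).
    apply: le_Rint; [exact: cintegrable_norm|by apply: rintegrableD; exact: cintegrable_norm|move=> x].
    have -> : f x - h x = (f x - fn n x) + (fn n x - h x) by rewrite addrA subrK.
    exact: le_normcD.
  rewrite RintD; [|exact: cintegrable_norm|exact: cintegrable_norm].
  by move: hn1 h1; lra.
- have [_ lfn] := Lfn n; have [_ lh2] := lh.
  apply: le_trans (n2_tri2 lf lfn lh2) _.
  by move: (n2 _) (n2 _) hn2 h2 => a b; lra.
Qed.

End Continuous_approximation.

(** * The theorem of Plancherel *)

Section Plancherel_theorem.
Context {R : realType}.
Local Notation C := (complex R).
Local Notation mu := (@lebesgue_measure R).
Implicit Types (f g h : R -> C).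

Lemma L2norm_dist f g : L2 f -> L2 g -> `|L2norm f - L2norm g| <= L2norm (fun x => f x - g x).
Proof.
move=> lf lg; have h1 := L2norm_le_sub lf lg; have h2 := L2norm_le_sub lg lf.
rewrite (L2norm_sub_sym lg lf) in h2.
by move: (L2norm _) (L2norm _) (L2norm _) h1 h2 => a b c h1 h2; rewrite ler_norml; apply/andP; split; lra.
Qed.

(** The norm is continuous, so a relation between the norms of approximants passes to the limit. *)
Lemma n2_approx_eq f F (c : R) : 0 <= c -> L2 f -> L2 F ->
  (forall e : R, 0 < e -> exists g G, [/\ L2 g, L2 G, n2 (fun x => f x - g x) <= e,
     n2 (fun x => F x - G x) <= e & n2 G = c * n2 g]) ->
  n2 F = c * n2 f.
Proof.
move=> c0 lf lF h.
suff E : L2norm F = Num.sqrt c * L2norm f.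
  by rewrite -!L2norm_sqr// E exprMn sqr_sqrtr.
apply/eqP; rewrite -subr_eq0 -normr_eq0 eq_le normr_ge0 andbT.
apply/ler_addgt0Pr => e e0; rewrite add0r.
pose k := 1 + Num.sqrt c; have k0 : 0 < k by rewrite ltr_pwDl ?sqrtr_ge0.
have d0 : 0 < e / k by rewrite divr_gt0.
have [g [G [lg lG h1 h2 h3]]] := h _ (exprn_gt0 2 d0).
have n1 : L2norm (fun x => f x - g x) <= e / k.
  rewrite -(@ler_pXn2r _ 2%N) ?nnegrE ?L2norm_ge0 ?(ltW d0)//.
  by rewrite L2norm_sqr//; exact: L2B.
have n2' : L2norm (fun x => F x - G x) <= e / k.
  rewrite -(@ler_pXn2r _ 2%N) ?nnegrE ?L2norm_ge0 ?(ltW d0)//.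
  by rewrite L2norm_sqr//; exact: L2B.
have GE : L2norm G = Num.sqrt c * L2norm g by rewrite !L2normE// h3 sqrtrM.
have -> : L2norm F - Num.sqrt c * L2norm f = (L2norm F - L2norm G) + Num.sqrt c * (L2norm g - L2norm f).
  by rewrite GE mulrBr addrA subrK.
apply: le_trans (ler_normD _ _) _; rewrite normrM (ger0_norm (sqrtr_ge0 _)).
apply: (@le_trans _ _ (e / k + Num.sqrt c * (e / k))).
  apply: lerD; first exact: le_trans (L2norm_dist lF lG) n2'.
  rewrite ler_wpM2l ?sqrtr_ge0//.
  by rewrite distrC; exact: le_trans (L2norm_dist lf lg) n1.
by rewrite -{1}[e / k]mul1r -mulrDl -/k mulrC divfK// gt_eqF.
Qed.

Lemma fourierB f g x : cintegrable f -> cintegrable g ->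
  fourier (fun t => f t - g t) x = fourier f x - fourier g x.
Proof.
move=> cf cg; have kf := cintegrable_fourier_kernel x cf.
have kg := cintegrable_fourier_kernel x cg.
rewrite !fourierE -[X in _ - X]mul1r -mulNr -(cintZ (-1) kg) -cintD//; last exact: cintegrableZ.
by apply: eq_cint => t; rewrite mulrBr mulN1r.
Qed.

(** If [h n] are continuous and tend to [f] in both L1 and L2, their transforms tend to that of [f]
    uniformly, and Fatou's lemma together with the identity for the differences [h m - h n] makes
    the convergence hold in L2. *)
Theorem plancherel f : L12 f -> plancherel_at f.
Proof.
move=> Lf; have [cf lf] := Lf.
have [h Hh] : {h : nat -> R -> C | forall n, [/\ continuous (rpart (h n)) /\ continuous (ipart (h n)),
    exists K, forall x, normc (h n x) <= K, L12 (h n),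
    \int[mu]_x normc (f x - h n x) <= n.+1%:R^-1 & n2 (fun x => f x - h n x) <= n.+1%:R^-1]}.
  have H n : {h | [/\ continuous (rpart h) /\ continuous (ipart h),
    exists K, forall x, normc (h x) <= K, L12 h,
    \int[mu]_x normc (f x - h x) <= n.+1%:R^-1 & n2 (fun x => f x - h x) <= n.+1%:R^-1]}.
    by apply: cid; apply: approx_continuous; rewrite ?invr_gt0.
  by exists (fun n => projT1 (H n)) => n; exact: projT2 (H n).
have Lh n : L12 (h n) by case: (Hh n).
have ch n : cintegrable (h n) by case: (Lh n).
have lh n : L2 (h n) by case: (Lh n).
have good n : plancherel_at (h n).
  by have [[c1 c2] [K hK] [ci l2] _ _] := Hh n; exact: plancherel_continuous hK ci l2.
have goodB m n : plancherel_at (fun x => h m x - h n x).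
  have [[c1 c2] [K hK] _ _ _] := Hh m; have [[c3 c4] [K' hK'] _ _ _] := Hh n.
  have [ci l2] := L12B (Lh m) (Lh n).
  apply: (@plancherel_continuous _ _ (K + K')) => //.
  - rewrite (_ : rpart _ = (fun x => rpart (h m) x - rpart (h n) x)); last first.
      by apply/funext => x; rewrite /rpart ReD ReN.
    by move=> x; apply: cvgB; [exact: c1|exact: c3].
  - rewrite (_ : ipart _ = (fun x => ipart (h m) x - ipart (h n) x)); last first.
      by apply/funext => x; rewrite /ipart ImD ImN.
    by move=> x; apply: cvgB; [exact: c2|exact: c4].
  - by move=> x; apply: le_trans (le_normcD _ _) _; rewrite normcN lerD.
have cvF x : (complex.Re (fourier (h n) x) @[n --> \oo] --> complex.Re (fourier f x)) /\
             (complex.Im (fourier (h n) x) @[n --> \oo] --> complex.Im (fourier f x)).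
  have b n : normc (fourier f x - fourier (h n) x) <= 2 * n.+1%:R^-1.
    have [_ _ _ hn _] := Hh n; have [cd _] := L12B Lf (Lh n).
    rewrite -fourierB//; apply: le_trans (fourier_bound x cd) _.
    by rewrite ler_wpM2l.
  have lim : 2 * n.+1%:R^-1 @[n --> \oo] --> (0:R).
    by rewrite -[X in _ --> X](mulr0 2); apply: cvgM; [exact: cvg_cst|exact: cvg_harmonic].
  split; apply/cvgrPdist_le => e e0; move/cvgrPdist_le : lim => /(_ e e0);
    apply: filterS => n; rewrite sub0r normrN => hn.
  - rewrite -ReN -ReD; apply: le_trans (normr_Re _) _; apply: le_trans (b n) _.
    exact: le_trans (ler_norm _) hn.
  - rewrite -ImN -ImD; apply: le_trans (normr_Im _) _; apply: le_trans (b n) _.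
    exact: le_trans (ler_norm _) hn.
have mF n : cmeasurable (fourier (h n)) by exact: fourier_meas.
have pi0 : 0 <= 2 * (pi : R) by rewrite mulr_ge0// pi_ge0.
have close n : (\int[mu]_x (nsq (fourier f x - fourier (h n) x))%:E <= (2 * pi * (4 * n.+1%:R^-1))%:E)%E.
  apply: (@fatou_bound _ (fun m x => nsq (fourier (h m) x - fourier (h n) x)) _ _ n).
  - by move=> m; apply: (@measurable_nsq _ (fun x => fourier (h m) x - fourier (h n) x)); exact: cmeas_sub.
  - by move=> m x; exact: nsq_ge0.
  - move=> x; have [c1 c2] := cvF x; apply: (@cvg_nsq _ (fun m => fourier (h m) x - fourier (h n) x)).
      under eq_cvg do rewrite ReD ReN.
      by rewrite ReD ReN; apply: cvgB => //; exact: cvg_cst.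
    under eq_cvg do rewrite ImD ImN.
    by rewrite ImD ImN; apply: cvgB => //; exact: cvg_cst.
  - move=> m nm; have [lB eB] := goodB m n.
    have FB : fourier (fun x => h m x - h n x) = (fun x => fourier (h m) x - fourier (h n) x).
      by apply/funext => x; rewrite fourierB.
    rewrite FB in lB eB; rewrite n2E// eB lee_fin ler_wpM2l//.
    apply: le_trans (n2_tri2 (lh m) lf (lh n)) _.
    rewrite [X in 2 * X + _]n2_sub_sym.
    have [_ _ _ _ e1] := Hh m; have [_ _ _ _ e2] := Hh n.
    have e3 : m.+1%:R^-1 <= n.+1%:R^-1 :> R by rewrite lef_pV2 ?posrE// ler_nat.
    by move: (n2 _) (n2 _) m.+1%:R^-1 n.+1%:R^-1 e1 e2 e3 => *; lra.
have mFf := fourier_meas cf.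
have lB n : L2 (fun x => fourier f x - fourier (h n) x).
  by apply: L2_fin; [exact: cmeas_sub|exact: le_lt_trans (close n) (ltry _)].
have lF : L2 (fourier f).
  rewrite (_ : fourier f = fun x => (fourier f x - fourier (h 0%N) x) + fourier (h 0%N) x).
    by apply: L2D => //; case: (good 0%N).
  by apply/funext => x; rewrite subrK.
split => //; apply: n2_approx_eq => // e e0.
pose e' := e / (2 * pi * 4 + 1).
have p8 : 0 <= 2 * (pi : R) * 4 by exact: mulr_ge0.
have D0 : 0 < 2 * (pi : R) * 4 + 1 by rewrite ltr_wpDl.
have e'0 : 0 < e' by rewrite divr_gt0.
have [n hn] : exists n : nat, n.+1%:R^-1 <= e'.
  exists (Num.truncn e'^-1); rewrite invf_ple ?posrE//.
  by rewrite ltW// truncnS_gt.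
have ee : e' * (2 * pi * 4 + 1) = e by rewrite divfK// gt_eqF.
exists (h n), (fourier (h n)); have [lFh eh] := good n; split => //.
- have [_ _ _ _ h1] := Hh n; apply: (le_trans h1); apply: (le_trans hn).
  by rewrite -ee ler_peMr ?(ltW e'0)// lerDr.
- rewrite -lee_fin -n2E//; apply: le_trans (close n) _; rewrite lee_fin mulrA.
  apply: (@le_trans _ _ (2 * pi * 4 * e')); first by rewrite ler_wpM2l.
  by rewrite -ee mulrC ler_wpM2l ?(ltW e'0)// lerDl.
Qed.

End Plancherel_theorem.

(** * The Fourier transform on L2 *)

Section L2_Fourier.
Context {R : realType}.
Local Notation C := (complex R).
Local Notation mu := (@lebesgue_measure R).
Implicit Types (f g h : R -> C).

Definition window (n : nat) : set R := `[(- n%:R)%R, n%:R]%classic.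

Definition cut n f : R -> C := fun x => cind (window n) x * f x.

Lemma measurable_window n : measurable (window n).
Proof. exact: measurable_itv. Qed.

Lemma windowP n x : window n x <-> `|x| <= n%:R.
Proof. by rewrite /window/= in_itv/= ler_norml. Qed.

Lemma near_window x : \forall n \near \oo, window n x.
Proof.
exists (Num.truncn `|x|).+1 => // n /= hn; apply/windowP.
by apply/ltW; apply: lt_le_trans (truncnS_gt _) _; rewrite ler_nat.
Qed.

Lemma window_lty n : (mu (window n) < +oo)%E.
Proof. by rewrite lebesgue_measure_itv/=; case: ifP => _; rewrite ?ltry. Qed.

Lemma rintegrable_indic (D : set R) : measurable D -> (mu D < +oo)%E -> rintegrable (\1_D : R -> R).
Proof.
move=> mD fD; apply: ge0_rintegrable; first exact: measurable_indic.
  by move=> x; rewrite indicE.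
by rewrite integral_indic// setIT.
Qed.

Lemma fourier_on_cut n f : fourier_on (window n) f = fourier (cut n f).
Proof.
apply/funext => x; apply: eq_ReIm; rewrite /= Rintegral_mkcond; apply: eq_Rintegral => t _;
  rewrite patchE /rpart /ipart /cut; case: ifPn => tD.
- by rewrite cind_in ?mul1r//; exact: set_mem.
- by rewrite cind_out ?mul0r ?mulr0//; move/negP : tD => tD /mem_set.
- by rewrite cind_in ?mul1r//; exact: set_mem.
- by rewrite cind_out ?mul0r ?mulr0//; move/negP : tD => tD /mem_set.
Qed.

Lemma cut_L2 n f : L2 f -> L2 (cut n f).
Proof. by apply: L2_cind; exact: measurable_window. Qed.

Lemma cut_L12 n f : L2 f -> L12 (cut n f).
Proof.
move=> lf; split; last exact: cut_L2.
have i1 := rintegrable_indic (measurable_window n) (window_lty n).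
apply: (cintegrable_le _ _ (rintegrableD i1 (L2_int lf))).
  by apply: cmeas_mul; [exact: cmeas_cind (measurable_window n)|exact: L2_meas].
move=> x; rewrite /cut normcM normc_real indicE; case: (x \in window n) => /=.
  rewrite normr1 mul1r -normc_sqr; have := normc_ge0 (f x).
  by move: (normc (f x)) => a a0; have := sqr_ge0 (a - 1); nra.
by rewrite normr0 mul0r add0r nsq_ge0.
Qed.

Lemma cutZ n (c : C) f : cut n (fun x => c * f x) = (fun x => c * cut n f x).
Proof. by apply/funext => x; rewrite /cut mulrCA. Qed.

Lemma cutD n f g : cut n (fun x => f x + g x) = (fun x => cut n f x + cut n g x).
Proof. by apply/funext => x; rewrite /cut mulrDr. Qed.

Lemma n2_cut n f : L2 f -> n2 (cut n f) <= n2 f.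
Proof.
move=> lf; have := n2M (cmeas_cind (measurable_window n)) (nsq_cind _) lf.
by rewrite mul1r.
Qed.

Lemma cvg_cut f (e : R) : L2 f -> 0 < e ->
  exists n0, forall n, (n0 <= n)%N -> n2 (fun x => f x - cut n f x) <= e.
Proof.
move=> lf e0.
have [_ lim] : rintegrable (fun _ : R => 0 : R) /\ \int[mu]_x nsq (f x - cut n f x) @[n --> \oo] --> \int[mu]_x (0:R).
  apply: (@Rint_dct _ (fun n x => nsq (f x - cut n f x)) (fun=> 0) (fun x => nsq (f x))).
  - move=> n; apply: (@measurable_nsq _ (fun x => f x - cut n f x)).
    by apply: cmeas_sub; [exact: L2_meas|exact: L2_meas (cut_L2 n lf)].
  - move=> x; apply: cvg_near_cst; apply: filterS (near_window x) => n h.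
    by rewrite /cut cind_in// mul1r subrr nsq0.
  - exact: L2_int.
  - move=> n x; rewrite ger0_norm ?nsq_ge0//.
    have [h|h] := pselect (window n x).
      by rewrite /cut cind_in// mul1r subrr nsq0 nsq_ge0.
    by rewrite /cut cind_out// mul0r subr0.
rewrite (_ : \int[mu]_x 0 = 0) in lim; last by rewrite /Rintegral integral0.
move/cvgrPdist_le : lim => /(_ e e0) [n0 _ hn]; exists n0 => n nn0.
have := hn n nn0; rewrite sub0r normrN n2I; apply: le_trans; exact: ler_norm.
Qed.

Lemma L2_fourierP f g : L2 f -> L2 g -> L2_fourier f g <->
  (forall e : R, 0 < e -> exists n0, forall n, (n0 <= n)%N ->
     n2 (fun x => g x - fourier (cut n f) x) <= e).
Proof.
move=> lf lg.
have lF n : L2 (fourier (cut n f)) by have [] := plancherel (cut_L12 n lf).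
have E n : L2diste g (fourier_on (window n) f) = (Num.sqrt (n2 (fun x => g x - fourier (cut n f) x)))%:E.
  by rewrite fourier_on_cut /L2diste L2normeE_fin//; exact: L2B.
split.
- move=> [_ _ lim] e e0; have s0 : 0 < Num.sqrt e by rewrite sqrtr_gt0.
  move/fine_cvgP : lim => [_ /cvgrPdist_le /(_ _ s0) [n0 _ hn]].
  exists n0 => n nn0; have := hn n nn0; rewrite /= E /= sub0r normrN ger0_norm ?sqrtr_ge0//.
  by rewrite ler_sqrt// ltW.
- move=> h; split => //.
  rewrite (_ : (fun n => _) = (fun n => (Num.sqrt (n2 (fun x => g x - fourier (cut n f) x)))%:E)); last first.
    by apply/funext => n; exact: E.
  apply: cvg_EFin; first exact: nearW.
  apply/cvgrPdist_le => e e0; have [n0 hn] := h _ (exprn_gt0 2 e0).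
  exists n0 => // n /= nn0; rewrite sub0r normrN ger0_norm ?sqrtr_ge0//.
  by rewrite -[leRHS]ger0_norm ?(ltW e0)// -sqrtr_sqr ler_wsqrtr// hn.
Qed.

Lemma L2_fourier_L2l f g : L2_fourier f g -> L2 f. Proof. by case. Qed.
Lemma L2_fourier_L2r f g : L2_fourier f g -> L2 g. Proof. by case. Qed.

Lemma L2_fourier_isometry f g : L2_fourier f g -> n2 g = 2 * pi * n2 f.
Proof.
move=> fg; have lf := L2_fourier_L2l fg; have lg := L2_fourier_L2r fg.
have pi0 : 0 <= 2 * (pi : R) by rewrite mulr_ge0// pi_ge0.
apply: n2_approx_eq => // e e0.
have [n0 h0] := cvg_cut lf e0; have [n1 h1] := (L2_fourierP lf lg).1 fg e e0.
pose n := maxn n0 n1; have [lF eF] := plancherel (cut_L12 n lf).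
exists (cut n f), (fourier (cut n f)); split => //.
- exact: cut_L2.
- by apply: h0; exact: leq_maxl.
- by apply: h1; exact: leq_maxr.
Qed.

Lemma fourierD f g x : cintegrable f -> cintegrable g ->
  fourier (fun t => f t + g t) x = fourier f x + fourier g x.
Proof.
move=> cf cg; rewrite !fourierE -cintD; [|exact: cintegrable_fourier_kernel|exact: cintegrable_fourier_kernel].
by apply: eq_cint => t; rewrite mulrDr.
Qed.

Lemma fourierZ (c : C) f x : cintegrable f -> fourier (fun t => c * f t) x = c * fourier f x.
Proof.
move=> cf; rewrite !fourierE -cintZ; last exact: cintegrable_fourier_kernel.
by apply: eq_cint => t; rewrite mulrCA.
Qed.

Lemma n2_sum2 f g : L2 f -> L2 g -> n2 (fun x => f x + g x) <= 2 * n2 f + 2 * n2 g.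
Proof.
move=> lf lg; rewrite !n2I -!RintZ ?(L2_int lf) ?(L2_int lg)// -RintD.
- apply: le_Rint => [||x]; last exact: nsqD.
  + exact: (L2_int (L2D lf lg)).
  + by apply: rintegrableD; apply: rintegrableZ; [exact: (L2_int lf)|exact: (L2_int lg)].
- exact/rintegrableZ/(L2_int lf).
- exact/rintegrableZ/(L2_int lg).
Qed.

Lemma L2_fourierZ (c : C) f g : L2_fourier f g -> L2_fourier (fun x => c * f x) (fun x => c * g x).
Proof.
move=> fg; have lf := L2_fourier_L2l fg; have lg := L2_fourier_L2r fg.
apply/(L2_fourierP (L2Z c lf) (L2Z c lg)) => e e0.
have c0 := nsq_ge0 c; have c1 : 0 < nsq c + 1 by rewrite ltr_wpDl.
have [n0 h0] := (L2_fourierP lf lg).1 fg _ (divr_gt0 e0 c1); exists n0 => n nn0.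
have [cn _] := cut_L12 n lf; have [lF _] := plancherel (cut_L12 n lf).
rewrite (_ : (fun x => _) = (fun x => c * (g x - fourier (cut n f) x))); last first.
  by apply/funext => x; rewrite cutZ (fourierZ c x cn) mulrBr.
rewrite n2Z; last exact: L2B.
apply: (@le_trans _ _ ((nsq c + 1) * (e / (nsq c + 1)))); last by rewrite mulrC divfK// gt_eqF.
by apply: ler_pM => //; [exact: n2_ge0|rewrite lerDl|exact: h0].
Qed.

Lemma L2_fourierD f g f' g' : L2_fourier f g -> L2_fourier f' g' ->
  L2_fourier (fun x => f x + f' x) (fun x => g x + g' x).
Proof.
move=> fg fg'; have lf := L2_fourier_L2l fg; have lg := L2_fourier_L2r fg.
have lf' := L2_fourier_L2l fg'; have lg' := L2_fourier_L2r fg'.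
apply/(L2_fourierP (L2D lf lf') (L2D lg lg')) => e e0.
have e4 : 0 < e / 4 by rewrite divr_gt0.
have [n0 h0] := (L2_fourierP lf lg).1 fg _ e4.
have [n1 h1] := (L2_fourierP lf' lg').1 fg' _ e4.
exists (maxn n0 n1) => n; rewrite geq_max => /andP[nn0 nn1].
have [cn _] := cut_L12 n lf; have [lF _] := plancherel (cut_L12 n lf).
have [cn' _] := cut_L12 n lf'; have [lF' _] := plancherel (cut_L12 n lf').
rewrite (_ : (fun x => _) = (fun x => (g x - fourier (cut n f) x) + (g' x - fourier (cut n f') x))); last first.
  by apply/funext => x; rewrite cutD (fourierD x cn cn') opprD addrACA.
apply: le_trans (n2_sum2 (L2B lg lF) (L2B lg' lF')) _.
by have := h0 n nn0; have := h1 n nn1; move: (n2 _) (n2 _) => a b; lra.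
Qed.

Lemma L2_fourier0 : L2_fourier (fun _ : R => 0 : C) (fun _ => 0).
Proof.
apply/(L2_fourierP L20 L20) => e e0; exists 0%N => n _.
rewrite (_ : (fun x => _) = (fun _ => 0)) ?n20 ?(ltW e0)//.
apply/funext => x; rewrite (_ : cut n _ = (fun _ => 0)); last by apply/funext => t; rewrite /cut mulr0.
by rewrite fourierE; under eq_cint do rewrite mulr0; rewrite cint0 subr0.
Qed.

Lemma L2_fourier_sum (I : Type) (s : seq I) (F G : I -> R -> C) :
  (forall i, L2_fourier (F i) (G i)) ->
  L2_fourier (fun x => \sum_(i <- s) F i x) (fun x => \sum_(i <- s) G i x).
Proof.
move=> FG; elim: s => [|i s IH].
  by under eq_fun do rewrite big_nil; under [X in L2_fourier _ X]eq_fun do rewrite big_nil; exact: L2_fourier0.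
under eq_fun do rewrite big_cons; under [X in L2_fourier _ X]eq_fun do rewrite big_cons.
exact: L2_fourierD.
Qed.

Lemma L2_fourierB f g f' g' : L2_fourier f g -> L2_fourier f' g' ->
  L2_fourier (fun x => f x - f' x) (fun x => g x - g' x).
Proof.
move=> fg fg'; have h := L2_fourierD fg (L2_fourierZ (-1) fg').
rewrite (_ : (fun x => f x - f' x) = (fun x => f x + -1 * f' x)); last first.
  by apply/funext => x; rewrite mulN1r.
rewrite (_ : (fun x => g x - g' x) = (fun x => g x + -1 * g' x))//.
by apply/funext => x; rewrite mulN1r.
Qed.

Lemma L2_fourier_L12 f : L12 f -> L2_fourier f (fourier f).
Proof.
move=> Lf; have [cf lf] := Lf; have [lF _] := plancherel Lf.
apply/(L2_fourierP lf lF) => e e0.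
have pi1 : 0 < 2 * (pi : R) by rewrite mulr_gt0// pi_gt0.
have [n0 h0] := cvg_cut lf (divr_gt0 e0 pi1); exists n0 => n nn0.
have Ln := cut_L12 n lf; have [cn ln] := Ln.
rewrite (_ : (fun x => _) = fourier (fun x => f x - cut n f x)); last first.
  by apply/funext => x; rewrite (fourierB x cf cn).
have [_ ->] := plancherel (L12B Lf Ln).
by rewrite -ler_pdivlMl// mulrC h0.
Qed.

(** The transforms of the truncations [cut n f] are Cauchy by Plancherel's theorem. *)
Lemma L2_fourier_exists f : L2 f -> exists g, L2_fourier f g.
Proof.
move=> lf; have pi1 : 0 < 2 * (pi : R) by rewrite mulr_gt0// pi_gt0.
have lF n : L2 (fourier (cut n f)) by have [] := plancherel (cut_L12 n lf).
have lc n := cut_L2 n lf.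
have [|g lg hg] := L2_complete lF.
  move=> e e0; have d0 : 0 < e / (2 * pi) / 4 by rewrite !divr_gt0.
  have [n0 h0] := cvg_cut lf d0; exists n0 => m n mm nn.
  have [cm _] := cut_L12 m lf; have [cn _] := cut_L12 n lf.
  rewrite (_ : (fun x => _) = fourier (fun x => cut m f x - cut n f x)); last first.
    by apply/funext => x; rewrite (fourierB x cm cn).
  have [_ ->] := plancherel (L12B (cut_L12 m lf) (cut_L12 n lf)).
  rewrite -ler_pdivlMl// mulrC; apply: le_trans (n2_tri2 (lc m) lf (lc n)) _.
  rewrite [X in 2 * X + _]n2_sub_sym.
  by have := h0 m mm; have := h0 n nn; move: (n2 _) (n2 _) (e / _) => a b c; lra.
exists g; apply/(L2_fourierP lf lg) => e e0; have [n0 h0] := hg e e0; exists n0 => n nn0.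
by rewrite n2_sub_sym h0.
Qed.

End L2_Fourier.

(** * Parseval, surjectivity and translations *)

Section Fourier_inversion.
Context {R : realType}.
Local Notation C := (complex R).
Local Notation mu := (@lebesgue_measure R).
Implicit Types (f g h : R -> C).

Let pi1 : 0 < 2 * (pi : R).
Proof. by rewrite mulr_gt0// pi_gt0. Qed.

Lemma eq0_small (x : R) : 0 <= x -> (forall e : R, 0 < e -> x <= e) -> x = 0.
Proof.
move=> x0 h; apply/eqP; rewrite eq_le x0 andbT.
by apply/ler_addgt0Pr => e e0; rewrite add0r h.
Qed.

Lemma L2_fourier_closed f g : L2 f -> L2 g ->
  (forall e : R, 0 < e -> exists f' g', [/\ L2_fourier f' g',
     n2 (fun x => f x - f' x) <= e & n2 (fun x => g x - g' x) <= e]) ->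
  L2_fourier f g.
Proof.
move=> lf lg happ; have [g2 fg2] := L2_fourier_exists lf; have lg2 := L2_fourier_L2r fg2.
have gg2 : n2 (fun x => g x - g2 x) = 0.
  apply: eq0_small => [|e e0]; first exact: n2_ge0.
  have p0 := ltW pi1; have c0 : 0 < 2 + 2 * (2 * (pi : R)) by rewrite ltr_pwDl// mulr_ge0.
  have [f' [g' [fg' h1 h2]]] := happ _ (divr_gt0 e0 c0).
  apply: le_trans (n2_tri2 lg (L2_fourier_L2r fg') lg2) _.
  rewrite [X in _ + 2 * X]n2_sub_sym (L2_fourier_isometry (L2_fourierB fg2 fg')).
  apply: (@le_trans _ _ ((2 + 2 * (2 * pi)) * (e / (2 + 2 * (2 * pi))))); last first.
    by rewrite mulrC divfK// gt_eqF.
  have h3 := ler_wpM2l p0 h1; move: h2 h3; set E := e / _; move: (2 * pi) (n2 _) (n2 _) E => p A B E h2 h3.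
  by rewrite [leRHS]mulrDl -(mulrA 2 p); lra.
apply/(L2_fourierP lf lg) => e e0.
have e2 : 0 < e / 2 by rewrite divr_gt0.
have [n0 h0] := (L2_fourierP lf lg2).1 fg2 _ e2; exists n0 => n nn0.
have [lF _] := plancherel (cut_L12 n lf).
apply: le_trans (n2_tri2 lg lg2 lF) _; rewrite gg2 mulr0 add0r.
by have := h0 n nn0; move: (n2 _) => a; lra.
Qed.

Lemma Re_inner f g : L2 f -> L2 g ->
  complex.Re (inner f g) = 2^-1 * (n2 (fun x => f x + g x) - n2 f - n2 g).
Proof. by move=> lf lg; rewrite n2D//; move: (n2 f) (n2 g) (complex.Re _) => a b c; lra. Qed.

Lemma Im_inner f g : L2 f -> L2 g ->
  complex.Im (inner f g) = complex.Re (inner f (fun x => 'i%C * g x)).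
Proof. by move=> lf lg; rewrite innerZr// ReM /=; ring. Qed.

(** Polarization of the isometry property. *)
Lemma parseval f g f' g' : L2_fourier f g -> L2_fourier f' g' ->
  inner g g' = (2 * pi)%:C%C * inner f f'.
Proof.
move=> fg fg'; have lf := L2_fourier_L2l fg; have lg := L2_fourier_L2r fg.
have key h h' : L2_fourier h h' -> complex.Re (inner g h') = 2 * pi * complex.Re (inner f h).
  move=> hh'; rewrite (Re_inner lg (L2_fourier_L2r hh')) (Re_inner lf (L2_fourier_L2l hh')).
  rewrite (L2_fourier_isometry (L2_fourierD fg hh')) (L2_fourier_isometry fg) (L2_fourier_isometry hh').
  by move: (n2 _) (n2 _) (n2 _) => a b c; ring.
have lf' := L2_fourier_L2l fg'; have lg' := L2_fourier_L2r fg'.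
apply: eq_ReIm; rewrite ?ReM_real ?ImM_real ?(key _ _ fg')//.
by rewrite !Im_inner// (key _ _ (L2_fourierZ 'i%C fg')).
Qed.

Lemma L2_opp f : L2 f -> L2 (fun x => f (- x)).
Proof.
move=> /L2P[mf lf]; apply/L2P; split; last exact: (rintegrable_opp lf).
by apply: (cmeas_comp _ mf); exact: oppr_measurable.
Qed.

Lemma n2_opp f : L2 f -> n2 (fun x => f (- x)) = n2 f.
Proof. by move=> lf; rewrite !n2I (Rint_opp (L2_int lf)). Qed.

(** The candidate preimage [f] is the limit of [(2 pi)^-1 fourier (cut n g) (- t)]; the adjoint
    relation is the limit of [fourier_adjoint]. *)
Let adjoint g : L2 g -> exists2 f, L2 f &
  n2 g = 2 * pi * n2 f /\ forall p, L12 p -> inner (fourier p) g = (2 * pi)%:C%C * inner p f.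
Proof.
move=> lg; have [k k0 kpi] : exists2 k : R, 0 < k & 2 * pi * k = 1.
  by exists (2 * pi)^-1; rewrite ?invr_gt0// mulfV// gt_eqF.
pose F n := fourier (cut n g).
have lF n : L2 (F n) by have [] := plancherel (cut_L12 n lg).
pose fm n t := k%:C%C * F n (- t).
have lfm n : L2 (fm n) by apply: L2Z; exact: L2_opp.
have dfm m n : n2 (fun x => fm m x - fm n x) = k * n2 (fun x => cut m g x - cut n g x).
  have [cm _] := cut_L12 m lg; have [cn _] := cut_L12 n lg.
  rewrite (_ : (fun x => _) = (fun x => k%:C%C * (fun y => F m y - F n y) (- x))); last first.
    by apply/funext => x; rewrite /fm mulrBr.
  have lB := L2B (lF m) (lF n).
  rewrite n2_Zreal; last exact: (L2_opp lB).
  rewrite (n2_opp lB) (_ : (fun y => _) = fourier (fun x => cut m g x - cut n g x)); last first.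
    by apply/funext => y; rewrite (fourierB y cm cn).
  have [_ ->] := plancherel (L12B (cut_L12 m lg) (cut_L12 n lg)).
  by rewrite mulrA expr2 -(mulrA k k) (mulrC k (2 * pi)) kpi mulr1.
have cutC (e : R) : 0 < e -> exists n0, forall m n, (n0 <= m)%N -> (n0 <= n)%N ->
    n2 (fun x => cut m g x - cut n g x) <= e.
  move=> e0; have [n0 h0] := cvg_cut lg (divr_gt0 e0 (ltr0n _ 4)); exists n0 => m n mm nn.
  apply: le_trans (n2_tri2 (cut_L2 m lg) lg (cut_L2 n lg)) _.
  rewrite [X in 2 * X + _]n2_sub_sym.
  by have := h0 m mm; have := h0 n nn; move: (n2 _) (n2 _) => a b; lra.
have [|f lf hf] := L2_complete lfm.
  move=> e e0; have [n0 h0] := cutC (e / k) (divr_gt0 e0 k0); exists n0 => m n mm nn.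
  by rewrite dfm -ler_pdivlMl// mulrC h0.
exists f => //; split.
  apply: n2_approx_eq => //; first exact: ltW.
  move=> e e0; have [n0 h0] := hf e e0; have [n1 h1] := cvg_cut lg e0.
  pose n := maxn n0 n1; exists (fm n), (cut n g); split.
  - exact: lfm.
  - exact: cut_L2.
  - by rewrite n2_sub_sym; apply: h0; exact: leq_maxl.
  - by apply: h1; exact: leq_maxr.
  - rewrite n2_Zreal; last exact: L2_opp.
    rewrite n2_opp//; have [_ ->] := plancherel (cut_L12 n lg).
    rewrite [RHS](_ : _ = (2 * pi * k) ^+ 2 * n2 (cut n g)); last by ring.
    by rewrite kpi expr1n mul1r.
move=> p [cp lp]; have [lFp _] := plancherel (conj cp lp).
have step m : inner (fourier p) (cut m g) = (2 * pi)%:C%C * inner p (fm m).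
  have [cm _] := cut_L12 m lg.
  rewrite innerE (fourier_adjoint cp cm) -(@conjc_real R (2 * pi)) -innerZr// innerE.
  by apply: eq_cint => t; rewrite /fm mulrA -rmorphM kpi mul1r ifourier_fourier.
apply/eqP; rewrite -subr_eq0; apply/eqP/eq0_normc.
apply: eq0_small => [|e e0]; first exact: normc_ge0.
pose K : R := L2norm (fourier p) + 2 * pi * L2norm p + 1.
have K0 : 0 < K.
  by rewrite ltr_wpDl// addr_ge0 ?L2norm_ge0// mulr_ge0 ?L2norm_ge0// ltW.
have d0 : 0 < (e / K) ^+ 2 by rewrite exprn_gt0// divr_gt0.
have eK : 0 < e / K by rewrite divr_gt0.
have [n0 h0] := hf _ d0; have [n1 h1] := cvg_cut lg d0.
pose n := maxn n0 n1.
have a1 : L2norm (fun x => g x - cut n g x) <= e / K.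
  rewrite -(@ler_pXn2r _ 2%N) ?nnegrE ?L2norm_ge0 ?(ltW eK)//.
  rewrite L2norm_sqr; first by apply: h1; exact: leq_maxr.
  by apply: L2B => //; exact: cut_L2.
have a2 : L2norm (fun x => fm n x - f x) <= e / K.
  rewrite -(@ler_pXn2r _ 2%N) ?nnegrE ?L2norm_ge0 ?(ltW eK)//.
  rewrite L2norm_sqr; first by apply: h0; exact: leq_maxl.
  exact: L2B.
have lcn := cut_L2 n lg; have lB1 := L2B lg lcn; have lB2 := L2B (lfm n) lf.
have -> : inner (fourier p) g - (2 * pi)%:C%C * inner p f =
    inner (fourier p) (fun x => g x - cut n g x) + (2 * pi)%:C%C * inner p (fun x => fm n x - f x).
  rewrite !innerDr//; [|exact: L2N|exact: L2N].
  by rewrite !innerNr// step mulrBr addrA subrK.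
apply: le_trans (le_normcD _ _) _; rewrite normcM normc_real ger0_norm ?(ltW pi1)//.
apply: (@le_trans _ _ (L2norm (fourier p) * (e / K) + 2 * pi * (L2norm p * (e / K)))).
  apply: lerD.
    apply: le_trans (normc_inner lFp lB1) _; rewrite ler_wpM2l ?L2norm_ge0//.
  rewrite ler_wpM2l ?(ltW pi1)//; apply: le_trans (normc_inner lp lB2) _.
  by rewrite ler_wpM2l ?L2norm_ge0.
apply: (@le_trans _ _ (K * (e / K))); last by rewrite mulrC divfK// gt_eqF.
by rewrite (mulrA (2 * pi) (L2norm p)) -mulrDl ler_wpM2r ?(ltW eK)// /K lerDl.
Qed.

(** If [f] is the preimage produced by the adjoint, the squared distance of [g] to [fourier (cut n
    f)] equals [2 pi] times that of [f] to [cut n f]. *)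
Lemma L2_fourier_surj g : L2 g -> exists f, L2_fourier f g.
Proof.
move=> lg; have [f lf [ng adj]] := adjoint lg; exists f.
apply/(L2_fourierP lf lg) => e e0.
have [n0 h0] := cvg_cut lf (divr_gt0 e0 pi1); exists n0 => n nn0.
have Lp := cut_L12 n lf; have [cp lp] := Lp; have [lF nF] := plancherel Lp.
have ifp : inner (cut n f) f = (n2 (cut n f))%:C%C.
  rewrite -inner_n2// !innerE; apply: eq_cint => t; rewrite /cut.
  have [h|h] := pselect (window n t); first by rewrite cind_in// mul1r.
  by rewrite cind_out// !mul0r.
have := h0 n nn0; rewrite ler_pdivlMr// mulrC.
rewrite !n2B// nF ng (inner_sym_Re lF lg) (adj _ Lp) ReM_real.
rewrite (inner_sym_Re lp lf) ifp (ReR (n2 _)).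
by move: (n2 f) (n2 _) (2 * pi) => a b c h; apply: le_trans h; rewrite le_eqVlt; apply/orP; left; apply/eqP; ring.
Qed.

Lemma fourier_affine f (a b x : R) : 0 < a -> cintegrable f ->
  fourier (fun t => f (a * t - b)) x =
  (a^-1)%:C%C * expi (- (a^-1 * b * x)) * fourier f (a^-1 * x).
Proof.
move=> a0 cf; have an0 : a != 0 by rewrite gt_eqF.
have ca := cintegrable_affine (- b) a0 cf.
rewrite !fourierE (cint_affine (- b) a0 (cintegrable_fourier_kernel (a^-1 * x) cf)).
have canc (E Z : C) : (a^-1)%:C%C * E * (a%:C%C * Z) = E * Z.
  by rewrite mulrACA -rmorphM/= mulVf// mul1r.
rewrite canc -cintZ; last first.
  exact: (cintegrable_affine (- b) a0 (cintegrable_fourier_kernel (a^-1 * x) cf)).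
apply: eq_cint => t; rewrite mulrA -expiD; congr (expi _ * _).
by field.
Qed.

(** Immediate from the integral on truncations, then extended by continuity, since translates of
    windows are not windows. *)
Lemma L2_fourier_shift f g (a : R) : L2_fourier f g ->
  L2_fourier (fun t => f (t - a)) (fun x => expi (- (a * x)) * g x).
Proof.
move=> fg; have lf := L2_fourier_L2l fg; have lg := L2_fourier_L2r fg.
have sh h : (fun t => h (t - a)) = (fun t => h (1 * t - a)) :> (R -> C).
  by apply/funext => t; rewrite mul1r.
have lsh h : L2 h -> L2 (fun t => h (t - a)) by move=> lh; rewrite sh; exact: (L2_affine (- a) ltr01 lh).
have nsh h : L2 h -> n2 (fun t => h (t - a)) = n2 h.
  by move=> lh; rewrite sh (n2_affine (- a) ltr01 lh) mul1r.
have me : cmeasurable (fun x : R => expi (- (a * x))).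
  by apply: cmeas_expi; apply: measurable_funN; apply: measurable_funM.
have le h : L2 h -> L2 (fun x => expi (- (a * x)) * h x).
  by apply: (L2M me (M := 1)) => x; rewrite nsq_expi.
have ne h : L2 h -> n2 (fun x => expi (- (a * x)) * h x) <= n2 h.
  by move=> lh; have := n2M me (M := 1) (fun x => eq_ind_r (fun y => y <= 1) (lexx 1) (nsq_expi _)) lh; rewrite mul1r.
apply: L2_fourier_closed => [||e e0]; [exact: lsh|exact: le|].
have [n0 h0] := cvg_cut lf e0; have [n1 h1] := (L2_fourierP lf lg).1 fg e e0.
pose n := maxn n0 n1; have Lc := cut_L12 n lf; have [cc lc] := Lc; have [lF _] := plancherel Lc.
exists (fun t => cut n f (t - a)), (fun x => expi (- (a * x)) * fourier (cut n f) x); split.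
- have Ls : L12 (fun t => cut n f (t - a)).
    by split; [rewrite sh; exact: (cintegrable_affine (- a) ltr01 cc)|exact: lsh].
  have := L2_fourier_L12 Ls; congr L2_fourier.
  by apply/funext => x; rewrite sh fourier_affine// !invr1 !mul1r.
- rewrite (nsh (fun t => f t - cut n f t)); last exact: L2B.
  by apply: h0; exact: leq_maxl.
- under eq_fun do rewrite -mulrBr.
  apply: le_trans (ne _ (L2B lg lF)) _; apply: h1; exact: leq_maxr.
Qed.

End Fourier_inversion.

(** * Taylor bounds for sine and cosine *)

Section Taylor.
Context {R : realType}.

Lemma mvt_power_bound (F dF : R -> R) (n : nat) : (forall x : R, is_derive x 1 F (dF x)) -> F 0 = 0 ->
  (forall x, `|dF x| <= `|x| ^+ n) -> forall y, `|F y| <= `|y| ^+ n.+1.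
Proof.
move=> dF1 F0 bd y.
have cF : continuous F by move=> x; apply/differentiable_continuous/derivable1_diffP; have [] := dF1 x.
have step (c : R) : `|c| <= `|y| -> `|F y| = `|dF c| * `|y| -> `|F y| <= `|y| ^+ n.+1.
  move=> cy ->; rewrite exprSr; apply: ler_wpM2r => //.
  by apply: (le_trans (bd c)); apply: lerXn2r; rewrite ?nnegrE.
case: (ltgtP y 0) => [y0|y0|->]; last by rewrite F0 normr0 exprn_ge0.
- have [c /[!in_itv]/= /andP[yc c0]] := MVT y0 (fun x _ => dF1 x) (continuous_subspaceT cF).
  rewrite F0 !sub0r => e; apply: (step c); first by rewrite !ltr0_norm ?lerN2 // ltW.
  by rewrite -normrN e normrM normrN.
- have [c /[!in_itv]/= /andP[yc c0]] := MVT y0 (fun x _ => dF1 x) (continuous_subspaceT cF).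
  rewrite F0 !subr0 => e; apply: (step c); first by rewrite !gtr0_norm // ltW.
  by rewrite e normrM.
Qed.

Lemma poly_primitive (p : {poly R}) :
  exists q : {poly R}, [/\ q^`()%R = p, q.[0] = 0 & (size q <= (size p).+1)%N].
Proof.
exists (\poly_(i < (size p).+1) (p`_i.-1 / i%:R)); split; last exact: size_poly.
  apply/polyP => i; rewrite coef_deriv coef_poly ltnS.
  case: ltnP => [ip|pi]; last by rewrite mul0rn nth_default.
  by rewrite /= -(mulr_natr (_ / _)) mulfVK// pnatr_eq0.
by rewrite horner_coef0 coef_poly/= invr0 mulr0.
Qed.

(** Each bound is the integral of the previous one, since sine and cosine are, up to sign, each
    other's derivatives. *)
Lemma taylor_cos_sin (N : nat) : exists pc ps : {poly R},
  [/\ (size pc <= N)%N, (size ps <= N)%N,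
     forall y, `|cos y - pc.[y]| <= `|y| ^+ N & forall y, `|sin y - ps.[y]| <= `|y| ^+ N].
Proof.
elim: N => [|N [pc [ps [sc ss bc bs]]]].
  exists 0, 0; split; rewrite ?size_poly0// => y; rewrite horner0 subr0 expr0.
    by rewrite ler_norml cos_geN1 cos_le1.
  by rewrite ler_norml sin_geN1 sin_le1.
have [qc [dqc qc0 sqc]] := poly_primitive pc.
have [qs [dqs qs0 sqs]] := poly_primitive ps.
exists (1 - qs), qc; split.
- rewrite (leq_trans (size_polyD _ _))// geq_max size_polyN size_poly1/=.
  exact: (leq_trans sqs).
- exact: (leq_trans sqc).
- apply: (@mvt_power_bound (fun y => cos y - (1 - qs).[y]) (fun y => - (sin y - ps.[y]))).
  + move=> x; apply: is_derive_eq; rewrite derivB derivC sub0r dqs hornerN opprK.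
    by rewrite opprB addrC.
  + by rewrite !hornerE qs0 cos0 subr0 subrr.
  + by move=> x; rewrite normrN.
- apply: (@mvt_power_bound (fun y => sin y - qc.[y]) (fun y => cos y - pc.[y])) => //.
  + by move=> x; apply: is_derive_eq; rewrite dqc.
  + by rewrite qc0 sin0 subr0.
Qed.

Lemma abs_sin_le (y : R) : `|sin y| <= `|y|.
Proof.
rewrite -[leRHS]expr1; apply: (@mvt_power_bound sin cos); rewrite ?sin0// => x.
by rewrite expr0 ler_norml cos_geN1 cos_le1.
Qed.

Lemma nsq_expi_sub1 (y : R) : nsq (expi y - 1) <= y ^+ 2.
Proof.
have h : `|2 * sin (y / 2)| <= `|y|.
  rewrite normrM (ger0_norm (@ler0n R 2)) -ler_pdivlMl//.
  apply: (le_trans (abs_sin_le _)).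
  by rewrite normrM normfV (ger0_norm (@ler0n R 2)) mulrC.
rewrite -(real_normK (num_real y)); apply: le_trans (lerXn2r 2 _ _ h); rewrite ?nnegrE//.
rewrite real_normK ?num_real// /nsq/= oppr0 addr0.
have e1 : cos y = cos (y / 2) ^+ 2 - sin (y / 2) ^+ 2.
  by rewrite {1}[y](splitr y) cosD !expr2.
have e2 := cos2Dsin2 (y / 2); have e3 := cos2Dsin2 y.
move: e1 e2 e3; move: (cos y) (sin y) (cos _) (sin _) => a b c d; lra.
Qed.
End Taylor.

(** * Orthogonal families and periodization *)

Section Orthogonal_families.
Context {R : realType} {I : eqType}.
Local Notation C := (complex R).
Implicit Types (e : I -> R -> C) (a b : I -> C) (s : seq I) (f g : R -> C).

(** Sums run over sequences rather than finite sets, because the index sets below arise as images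
    and level sets and only need to be duplicate-free. *)
Definition lcomb e a s : R -> C := fun t => \sum_(l <- s) a l * e l t.

Lemma L2_lcomb e a s : (forall l, L2 (e l)) -> L2 (lcomb e a s).
Proof. by move=> le; apply: L2_sum => l; exact: L2Z. Qed.

Lemma inner_lcombr e a s f : (forall l, L2 (e l)) -> L2 f ->
  inner f (lcomb e a s) = \sum_(l <- s) conjc (a l) * inner f (e l).
Proof.
move=> le lf; rewrite /lcomb (@inner_sumr _ _ _ (fun l t => a l * e l t))//; last first.
  by move=> l; exact: L2Z.
by apply: eq_bigr => l _; rewrite innerZr.
Qed.

Lemma inner_lcombl e a s f : (forall l, L2 (e l)) -> L2 f ->
  inner (lcomb e a s) f = \sum_(l <- s) a l * inner (e l) f.
Proof.
move=> le lf; rewrite /lcomb (@inner_suml _ _ _ (fun l t => a l * e l t))//; last first.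
  by move=> l; exact: L2Z.
by apply: eq_bigr => l _; rewrite innerZl.
Qed.

Lemma Re_sum (J : Type) (r : seq J) (F : J -> C) :
  complex.Re (\sum_(i <- r) F i) = \sum_(i <- r) complex.Re (F i).
Proof. by apply: (big_morph _ (@ReD R)). Qed.

Variables (e : I -> R -> C) (c : R).
Hypotheses (c0 : 0 < c) (le : forall l, L2 (e l)).
Hypothesis orth : forall l m, inner (e l) (e m) = if l == m then c%:C%C else 0.

Lemma inner_orth_lcomb a s l : uniq s -> l \in s -> inner (e l) (lcomb e a s) = c%:C%C * conjc (a l).
Proof.
move=> us ls; rewrite inner_lcombr// (bigD1_seq l)//= orth eqxx mulrC big1 ?addr0// => m ml.
by rewrite orth eq_sym (negbTE ml) mulr0.
Qed.

Lemma n2_orth_lcomb a s : uniq s -> n2 (lcomb e a s) = c * \sum_(l <- s) nsq (a l).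
Proof.
move=> us; have ll := L2_lcomb a s le.
rewrite -[LHS]ReR -inner_n2// inner_lcombl// mulr_sumr.
rewrite Re_sum big_seq [RHS]big_seq; apply: eq_bigr => l ls.
by rewrite inner_orth_lcomb// mulrCA mul_conjc -rmorphM ReR.
Qed.

Definition fcoef f l : C := c^-1%:C%C * inner f (e l).

(** Pythagoras: the residual is orthogonal to the projection. *)
Lemma n2_fcoef_residual f s : uniq s -> L2 f ->
  n2 (fun x => f x - lcomb e (fcoef f) s x) = n2 f - c^-1 * \sum_(l <- s) nsq (inner f (e l)).
Proof.
move=> us lf; have ll := L2_lcomb (fcoef f) s le.
rewrite n2B// n2_orth_lcomb// inner_lcombr// Re_sum.
have cn0 : c != 0 by rewrite gt_eqF.
have -> : \sum_(l <- s) nsq (fcoef f l) = c^-1 ^+ 2 * \sum_(l <- s) nsq (inner f (e l)).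
  by rewrite mulr_sumr; apply: eq_bigr => l _; rewrite /fcoef nsqM nsq_real.
have -> : \sum_(i <- s) complex.Re (conjc (fcoef f i) * inner f (e i)) = c^-1 * \sum_(l <- s) nsq (inner f (e l)).
  rewrite mulr_sumr; apply: eq_bigr => l _.
  by rewrite /fcoef conjcM conjc_real -mulrA [conjc _ * _]mulrC mul_conjc ReM_real ReR.
by move: (n2 f) (\sum_(l <- s) _) => x y; field.
Qed.

(** The difference of the two sides is a sum of squares, one for each coefficient. *)
Lemma fcoef_best f a s : uniq s -> L2 f ->
  n2 (fun x => f x - lcomb e (fcoef f) s x) <= n2 (fun x => f x - lcomb e a s x).
Proof.
move=> us lf; have ll := L2_lcomb a s le; have cn0 : c != 0 by rewrite gt_eqF.
rewrite n2_fcoef_residual// n2B// n2_orth_lcomb// inner_lcombr// Re_sum -subr_ge0.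
pose T l := c * nsq (a l) - 2 * complex.Re (conjc (a l) * inner f (e l)) + c^-1 * nsq (inner f (e l)).
rewrite (_ : _ - _ = \sum_(l <- s) T l).
  apply: sumr_ge0 => l _; rewrite /T.
  rewrite (_ : _ + _ = c * nsq (a l - c^-1%:C%C * inner f (e l))).
    by rewrite mulr_ge0 ?nsq_ge0// ltW.
  rewrite /nsq ReD ImD ReN ImN ReM_real ImM_real ReM ReC ImC.
  by move: (complex.Re _) (complex.Im _) (complex.Re _) (complex.Im _) => x y z w; field.
rewrite (_ : \sum_(l <- s) T l = c * \sum_(l <- s) nsq (a l)
    - 2 * \sum_(l <- s) complex.Re (conjc (a l) * inner f (e l)) + c^-1 * \sum_(l <- s) nsq (inner f (e l))); last first.
  by rewrite !mulr_sumr -sumrB -big_split.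
by move: (n2 f) (\sum_(l <- s) _) (\sum_(l <- s) _) (\sum_(l <- s) _) => x y z w; ring.
Qed.

End Orthogonal_families.

Section Periodization.
Context {R : realType}.
Local Notation C := (complex R).
Local Notation mu := (@lebesgue_measure R).

Lemma ge0_integral_shift_itv (F : R -> \bar R) (c P : R) : measurable_fun setT F -> (forall x, 0 <= F x)%E ->
  (\int[mu]_(x in `[c, (c + P)%R[) F x = \int[mu]_(x in `[0%R, P[) F (x + c)%R)%E.
Proof.
move=> mF F0; rewrite integral_mkcond [RHS]integral_mkcond.
rewrite (ge0_integral_affine c (@ltr01 R)); last 2 first.
- by apply/(measurable_restrictT _ _).1; [exact: measurable_itv|exact: measurable_funTS].
- by move=> x; rewrite patchE; case: ifP.
rewrite mul1e; apply: eq_integral => x _; rewrite !patchE mul1r.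
suff -> : (x + c \in `[c, (c + P)[%classic) = (x \in `[0%R, P[%classic) by [].
by apply/idP/idP; rewrite !inE/= !in_itv/= lerDr [x + c]addrC ltrD2l.
Qed.

(** Cut the interval into [m] translates of a period and bring each back by translation. *)
Lemma ge0_integral_periods (F : R -> \bar R) (c P : R) (m : nat) : 0 <= P ->
  measurable_fun setT F -> (forall x, 0 <= F x)%E ->
  (\int[mu]_(x in `[c, (c + m%:R * P)%R[) F x =
   \int[mu]_(x in `[0%R, P[) \sum_(i < m) F (x + (c + i%:R * P))%R)%E.
Proof.
move=> P0 mF F0; have mS (b : R) : measurable_fun setT (fun x : R => F (x + b)).
  by apply: (measurableT_comp mF); exact: measurable_funD.
rewrite ge0_integral_sum//; last first.
  by move=> i; apply: measurable_funTS; exact: mS.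
elim: m => [|m IH].
  by rewrite big_ord0 mul0r addr0 set_itvco0 integral_set0.
rewrite big_ord_recr/= -IH -ge0_integral_shift_itv// -ge0_integral_setU//=.
- congr integral; apply/seteqP; split=> x; rewrite /= !in_itv/= -natr1 mulrDl mul1r.
    by case: (ltP x (c + m%:R * P)) => h /andP[a b]; [left|right]; rewrite ?a//= addrA in b *.
  have mP : 0 <= m%:R * P by exact: mulr_ge0.
  by case=> /andP[a b]; apply/andP; split; move: mP P0 a b; move: (m%:R * P) => y; lra.
- exact: measurable_funTS.
- apply/disj_setPS => x [] /=; rewrite !in_itv/= => /andP[_ a] /andP[b _].
  by move: a; rewrite ltNge b.
Qed.

Lemma periodic_nat (T : Type) (p : R -> T) (P : R) : (forall x, p (x + P) = p x) ->
  forall (n : nat) x, p (x + n%:R * P) = p x.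
Proof.
move=> per; elim=> [|n IH] x; first by rewrite mul0r addr0.
by rewrite -natr1 mulrDl mul1r addrA per IH.
Qed.

Lemma periodic_int (T : Type) (p : R -> T) (P : R) : (forall x, p (x + P) = p x) ->
  forall (k : int) x, p (x + k%:~R * P) = p x.
Proof.
move=> per [n|n] x; first exact: periodic_nat.
rewrite NegzE rmorphN/= mulNr.
by rewrite -[in RHS](subrK (n.+1%:R * P) x) (periodic_nat per n.+1).
Qed.

(** On a window of [2 n] periods the integral is that of [|p|^2] against the periodized weight over
    a single period; Fatou's lemma lets [n] grow. *)
Lemma periodic_weight (p : R -> C) (w : R -> R) (P S : R) : 0 < P ->
  cmeasurable p -> measurable_fun setT w -> (forall x, 0 <= w x) ->
  (forall x, p (x + P) = p x) ->
  (forall (x : R) m, \sum_(i < m) w (x + i%:R * P) <= S) ->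
  L2 (fun x => cind `[0, P[ x * p x) ->
  rintegrable (fun x => nsq (p x) * w x) /\
  \int[mu]_x (nsq (p x) * w x) <= S * n2 (fun x => cind `[0, P[ x * p x).
Proof.
move=> P0 mp mw w0 per wS lp.
have S0 : 0 <= S by have := wS 0 0%N; rewrite big_ord0.
have mq : measurable_fun setT (fun x => nsq (p x) * w x).
  by apply: measurable_funM => //; exact: measurable_nsq.
have q0 x : 0 <= nsq (p x) * w x by rewrite mulr_ge0// nsq_ge0.
pose D n : set R := `[- (n%:R * P), (- (n%:R * P) + (n.*2)%:R * P)%R[%classic.
have mD n : measurable (D n) by exact: measurable_itv.
have bound : (\int[mu]_x (nsq (p x) * w x)%:E <= (S * n2 (fun x => (cind `[0%R, P[ x * p x)%R))%:E)%E.
  apply: (@fatou_bound _ (fun n x => \1_(D n) x * (nsq (p x) * w x)) _ _ 0%N).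
  - by move=> n; apply: measurable_funM => //; exact: measurable_indic.
  - by move=> n x; rewrite mulr_ge0// indicE ler0n.
  - move=> x; apply: cvg_near_cst; near=> n.
    rewrite indicE mem_set ?mul1r// /D/= in_itv/=.
    have : `|x| < n%:R * P by rewrite -ltr_pdivrMr//; near: n; exact: nbhs_infty_gtr.
    rewrite ltr_norml => /andP[a b]; rewrite ltW//= -addnn natrD mulrDl.
    by move: (n%:R * P) a b => y; lra.
  move=> n _.
  have -> : (\int[mu]_x (\1_(D n) x * (nsq (p x) * w x))%:E = \int[mu]_(x in D n) (nsq (p x) * w x)%:E)%E.
    rewrite [RHS]integral_mkcond; apply: eq_integral => x _.
    by rewrite patchE indicE; case: (x \in D n); rewrite ?mul1r ?mul0r.
  have mF : measurable_fun setT (fun x => (nsq (p x) * w x)%:E) by exact/measurable_EFinP.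
  rewrite (ge0_integral_periods _ _ (ltW P0) mF)//.
  rewrite EFinM -n2E// -ge0_integralZl//; last 2 first.
  - by apply: measurable_EFin_nsq; exact: L2_meas.
  - by move=> x _; rewrite lee_fin nsq_ge0.
  rewrite [leLHS]integral_mkcond; apply: (ge0_le_integral _ measurableT).
  - move=> x _; rewrite patchE; case: ifP => // _.
    by apply: sume_ge0 => i _; rewrite lee_fin.
  - apply/(measurable_restrictT _ _).1; first exact: measurable_itv.
    apply: measurable_funTS; apply: emeasurable_sum => i.
    apply/measurable_EFinP; apply: (measurableT_comp mq).
    exact: measurable_funD.
  - apply: measurable_funeM; apply: measurable_EFin_nsq; exact: L2_meas.
  move=> x _; rewrite patchE; case: ifPn => [xJ|_]; last first.
    by rewrite -EFinM lee_fin mulr_ge0// nsq_ge0.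
  rewrite sumEFin -EFinM lee_fin cind_in ?mul1r; last by rewrite inE in xJ.
  under eq_bigr => i _ do rewrite [_ + i%:R * P]addrC addrA.
  rewrite (eq_bigr (fun i : 'I_ _ => nsq (p x) * w (x - n%:R * P + i%:R * P))); last first.
    move=> i _; rewrite addrAC (periodic_nat per); congr (nsq _ * _).
    by rewrite -[in RHS](subrK (n%:R * P) x) (periodic_nat per).
  by rewrite -mulr_sumr mulrC; apply: ler_wpM2r; [exact: nsq_ge0|exact: wS].
have iq : rintegrable (fun x => nsq (p x) * w x).
  by apply: ge0_rintegrable => //; apply: (le_lt_trans bound); rewrite ltry.
by split=> //; rewrite -lee_fin EFin_Rint.
Unshelve. all: by end_near.
Qed.

End Periodization.

(** * The trigonometric system *)

Section Trigonometric_system.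
Context {R : realType}.
Local Notation C := (complex R).
Local Notation mu := (@lebesgue_measure R).
Implicit Types (f g : R -> C).

Let pi1 : 0 < 2 * (pi : R). Proof. by rewrite mulr_gt0// pi_gt0. Qed.

Lemma expi_periodic (x : R) : expi (x + 2 * pi) = expi x.
Proof. by rewrite /expi -[2 * pi]/(2%:R * pi) mulr_natl cosD2pi sinD2pi. Qed.

Lemma expi_period_int (k : int) : expi (k%:~R * (2 * pi)) = 1 :> C.
Proof. by rewrite -[X in expi X]add0r (periodic_int expi_periodic) expi0. Qed.

Definition period : set R := `[0, (2 * pi)%R[%classic.

(** The exponentials are cut to one period, so that their theory takes place in the L2 space of the
    line. *)
Definition trig (k : int) : R -> C := fun t => cind period t * expi (k%:~R * t).

Lemma measurable_period : measurable period. Proof. exact: measurable_itv. Qed.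

Lemma period_lty : (mu period < +oo)%E.
Proof. by rewrite /period lebesgue_measure_itv/=; case: ifP => _; rewrite ?ltry. Qed.

Lemma mu_period : mu period = (2 * pi)%:E.
Proof. by rewrite /period lebesgue_measure_itv/= lte_fin pi1 oppr0 adde0. Qed.

Lemma L2_indic (D : set R) : measurable D -> (mu D < +oo)%E -> L2 (cind D).
Proof.
move=> mD fD; apply: (@L2_le _ _ (\1_D)); [exact: cmeas_cind|exact: rintegrable_indic|].
by move=> x; rewrite /cind nsq_real indicE; case: (_ \in _); rewrite ?expr0n ?expr1n.
Qed.

Lemma L2_trig k : L2 (trig k).
Proof.
rewrite (_ : trig k = fun t => expi (k%:~R * t) * cind period t); last first.
  by apply/funext => t; rewrite /trig mulrC.
apply: (@L2M _ _ _ 1).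
- by apply: cmeas_expi; exact: mulrl_measurable.
- by move=> x; rewrite nsq_expi.
- exact: (L2_indic measurable_period period_lty).
Qed.

Let Rint_period (f F : R -> R) : (forall x : R, is_derive x 1 F (f x)) -> continuous f ->
  F (2 * pi) = F 0 -> \int[mu]_x (\1_period x * f x) = 0.
Proof.
move=> dF cf Fe.
have cF : continuous F by move=> x; apply/differentiable_continuous/derivable1_diffP; have [] := dF x.
have e : (\int[mu]_(x in `[0%R, (2 * pi)%R]) (f x)%:E = (F (2 * pi))%:E - (F 0)%:E)%E.
  apply: continuous_FTC2 => //.
  - exact: continuous_subspaceT.
  - split.
    + by move=> x _; have [] := dF x.
    + by apply: cvg_at_right_filter; exact: cF.
    + by apply: cvg_at_left_filter; exact: cF.
  - by move=> x _; rewrite derive1E; have [_ ->] := dF x.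
rewrite /Rintegral.
have -> : (\int[mu]_x (\1_period x * f x)%:E = \int[mu]_(x in period) (f x)%:E)%E.
  rewrite [RHS]integral_mkcond; apply: eq_integral => x _.
  by rewrite patchE indicE; case: (x \in period); rewrite ?mul1r ?mul0r.
rewrite integral_itv_bndo_bndc ?e ?Fe ?subee//.
apply/measurable_EFinP; apply: measurable_funTS; exact: continuous_measurable_fun.
Qed.

(** A nonconstant exponential of integral frequency has a periodic primitive, so that its integral
    over a period vanishes. *)
Lemma inner_trig k l : inner (trig k) (trig l) = if k == l then (2 * pi)%:C%C else 0.
Proof.
rewrite innerE.
pose m : R := k%:~R - l%:~R.
rewrite (@eq_cint _ _ _ (fun t => Complex (\1_period t * cos (m * t)) (\1_period t * sin (m * t)))); last first.
  move=> t; rewrite /trig conjcM conj_expi mulrACA -expiD -mulrBl -/m /cind conjc_real -rmorphM/=.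
  rewrite -/(real_complex _ _) -rmorphM/= indicE.
  by case: (_ \in _); apply: eq_ReIm; rewrite /= ?(mul1r,mul0r,subr0,addr0,mulr0).
rewrite /cint /rpart /ipart/=.
case: eqP => [kl|/eqP kl].
  have m0 : m = 0 by rewrite /m kl subrr.
  apply: eq_ReIm => /=.
    under eq_Rintegral => x _ do rewrite m0 mul0r cos0 mulr1.
    rewrite /Rintegral integral_indic// ?setIT; last exact: measurable_period.
    by rewrite -[RHS]/(fine (2 * pi)%:E) -mu_period.
  under eq_Rintegral => x _ do rewrite m0 mul0r sin0 mulr0.
  by rewrite Rintegral_cst// mul0r.
have m0 : m != 0 by rewrite /m -rmorphB/= intr_eq0 subr_eq0.
have em : expi (m * (2 * pi)) = 1 :> C by rewrite /m -rmorphB expi_period_int.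
have [c1 s1] : cos (m * (2 * pi)) = 1 /\ sin (m * (2 * pi)) = 0 by case: em.
clear em; clearbody m.
apply: eq_ReIm => /=.
  apply: (@Rint_period _ (fun x => m^-1 * sin (m * x))).
  - move=> x; apply: is_derive_eq; rewrite -![_ *: _]/(_ * _); by rewrite mulr1 mulrCA mulVf ?mulr1.
  - by move=> x; apply: continuous_comp; [exact: mulrl_continuous|exact: continuous_cos].
  - by rewrite s1 !mulr0 sin0 mulr0.
apply: (@Rint_period _ (fun x => - m^-1 * cos (m * x))).
- move=> x; apply: is_derive_eq; rewrite -![_ *: _]/(_ * _); by rewrite mulr1 mulNr -mulrN mulNr opprK mulrCA mulVf ?mulr1.
- by move=> x; apply: continuous_comp; [exact: mulrl_continuous|exact: continuous_sin].
- by rewrite c1 mulr0 cos0.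
Qed.

End Trigonometric_system.

(** * Density of trigonometric polynomials *)

Section Trigonometric_density.
Context {R : realType}.
Local Notation C := (complex R).
Local Notation mu := (@lebesgue_measure R).
Implicit Types (f g : R -> C).

Let pi1 : 0 < 2 * (pi : R). Proof. by rewrite mulr_gt0// pi_gt0. Qed.

Lemma period_L12 f : L2 f -> (forall t, ~ period t -> f t = 0) -> L12 f.
Proof.
move=> lf sf; split=> //.
rewrite (_ : f = fun t => f t * conjc (cind period t)).
  exact: (L2_cintegrable lf (L2_indic measurable_period period_lty)).
apply/funext => t; have [pt|pt] := pselect (period t); first by rewrite cind_in// conjc1 mulr1.
by rewrite sf// mul0r.
Qed.

Let modulate (x : R) f : R -> C := fun t => expi (- (x * t)) * f t.

Let L2_modulate x f : L2 f -> L2 (modulate x f).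
Proof.
move=> lf; apply: (@L2M _ _ _ 1) => //; last by move=> t; rewrite nsq_expi.
by apply: cmeas_expi; apply: measurableT_comp => //; exact: mulrl_measurable.
Qed.

Let n2_modulate x f : n2 (modulate x f) = n2 f.
Proof. by rewrite !n2I; apply: eq_Rintegral => t _; rewrite /modulate nsqM nsq_expi mul1r. Qed.

Let inner_modulate x f (k : int) : (forall t, ~ period t -> f t = 0) ->
  inner (modulate x f) (trig k) = fourier f (x + k%:~R).
Proof.
move=> sf; rewrite innerE fourierE; apply: eq_cint => t; rewrite /modulate /trig.
have [pt|pt] := pselect (period t); last by rewrite sf// !mulr0 mul0r.
by rewrite cind_in// mul1r conj_expi mulrAC -expiD mulrDl opprD.
Qed.

Let shifts (n : nat) : seq int := [seq k%:Z - n%:Z | k <- index_iota 0 n.*2].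

Let shifts_uniq n : uniq (shifts n).
Proof. by rewrite map_inj_uniq ?iota_uniq// => i j /addIr []. Qed.

Lemma integral_cind (D : set R) f : measurable D -> L2 f ->
  (\int[mu]_(x in D) (nsq (f x))%:E = (n2 (fun x => (cind D x * f x)%R))%:E)%E.
Proof.
move=> mD lf; rewrite -n2E; last exact: L2_cind.
rewrite integral_mkcond; apply: eq_integral => x _.
by rewrite patchE nsqM /cind nsq_real indicE; case: (_ \in _); rewrite ?expr0n ?expr1n ?mul1r ?mul0r.
Qed.

Lemma Rint_indic (D : set R) : measurable D -> \int[mu]_x (\1_D x) = fine (mu D).
Proof. by move=> mD; rewrite /Rintegral integral_indic// setIT. Qed.

(** The transform of [f] at the points [x + k] gives the coefficients of [expi (- x t) f t] on the
    trigonometric system, so that Bessel's inequality bounds the sum of the squared samples by [2 pi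
    |f|^2]. The mean of that sum over [x] between 0 and 1 is, up to a tail, the whole of [\int
    |fourier f|^2 = 2 pi |f|^2]. Hence the inequality is almost an equality for some [x] as small as
    desired, and a small residual means that [expi (- x t) f t] is almost a trigonometric
    polynomial. *)
Lemma sampled_parseval f (A delta : R) : L2 f -> (forall t, ~ period t -> f t = 0) ->
  0 < A -> 0 < delta <= 1 ->
  exists x s, [/\ 0 <= x <= delta, uniq s &
    n2 (fun t => modulate x f t - lcomb trig (fcoef trig (2 * pi) (modulate x f)) s t) <= A].
Proof.
move=> lf sf A0 /andP[d0 d1].
have [lF nF] := plancherel (period_L12 lf sf).
have e0 : 0 < pi * A * delta by rewrite !mulr_gt0// pi_gt0.
have [n0 /(_ n0 (leqnn _)) cutF] := cvg_cut lF e0.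
pose n := n0.+1.
pose G x := \sum_(i < n.*2) nsq (fourier f (x + (- (n%:R * 1) + i%:R * 1))).
have sumE x : \sum_(l <- shifts n) nsq (inner (modulate x f) (trig l)) = G x.
  rewrite big_map big_mkord; apply: eq_bigr => i _.
  by rewrite inner_modulate// rmorphB/= !mulr1 [- _ + _]addrC.
have resE x : n2 (fun t => modulate x f t - lcomb trig (fcoef trig (2 * pi) (modulate x f)) (shifts n) t)
    = n2 f - (2 * pi)^-1 * G x.
  rewrite (n2_fcoef_residual pi1 L2_trig inner_trig (shifts_uniq n) (L2_modulate x lf)).
  by rewrite sumE n2_modulate.
have bes x : G x <= 2 * pi * n2 f.
  rewrite -subr_ge0 -(pmulr_rge0 _ (_ : 0 < (2 * pi)^-1)) ?invr_gt0// mulrBr mulKf ?gt_eqF//.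
  by rewrite -resE n2_ge0.
apply: contrapT => no.
have big x : 0 <= x <= delta -> G x <= 2 * pi * (n2 f - A).
  move=> xd; apply: contrapT => /negP; rewrite -ltNge => h.
  apply: no; exists x, (shifts n); split => //; rewrite resE lerBlDr -lerBlDl.
  by rewrite ler_pdivlMl// ltW.
have mnF : measurable_fun setT (fun x => (nsq (fourier f x))%:E).
  by apply: measurable_EFin_nsq; exact: L2_meas.
have nF0 x : (0%R <= (nsq (fourier f x))%:E)%E by rewrite lee_fin nsq_ge0.
(* If the residual were larger than [A] for all [x] up to [delta], the samples would average to too
   little: on the rest of [0, 1] they are bounded by Bessel's inequality. *)
have key : (((2 * pi * n2 f) - pi * A * delta)%:E <= (2 * pi * (n2 f - A * delta))%:E)%E.
  apply: (@le_trans _ _ (\int[mu]_(x in `[(- (n%:R * 1))%R, (- (n%:R * 1) + (n.*2)%:R * 1)%R[) (nsq (fourier f x))%:E)%E).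
    rewrite (integral_cind (measurable_itv _) lF).
    rewrite lee_fin; set D := (X in cind X).
    have lD : L2 (fun x => cind D x * fourier f x) by apply: L2_cind => //; exact: measurable_itv.
    have lE : L2 (fun x => fourier f x - cut n0 (fourier f) x) by apply: L2B => //; exact: cut_L2.
    suff : n2 (fourier f) <= n2 (fun x => cind D x * fourier f x) + n2 (fun x => fourier f x - cut n0 (fourier f) x).
      rewrite nF; move: cutF; move: (n2 _) (n2 _) (n2 _) => a b c; lra.
    rewrite [n2 (fun x => _ * _)]n2I [n2 (fun x => _ - _)]n2I -RintD; last 2 first.
    - exact: L2_int.
    - exact: L2_int.
    apply: n2_le => //; first by apply: rintegrableD; exact: L2_int.
    move=> x; have [wx|wx] := pselect (window n0 x).
      rewrite cind_in ?mul1r ?lerDl ?nsq_ge0//; move: wx => /windowP; rewrite ler_norml => /andP[a b].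
      rewrite /D/= in_itv/= -addnn /n !mulr1 natrD -natr1; move: n0%:R a b => y; lra.
    by rewrite /cut (cind_out wx) mul0r subr0 lerDr nsq_ge0.
  rewrite (ge0_integral_periods _ _ ler01 mnF nF0).
  pose H (x : R) := 2 * pi * n2 f * \1_(`[0%R, 1%R[) x - 2 * pi * A * \1_(`[0%R, delta[) x.
  have m01 (b : R) : measurable (`[0%R, b[%classic : set R) by exact: measurable_itv.
  have i01 (b : R) : rintegrable (\1_(`[0%R, b[%classic) : R -> R).
    apply: rintegrable_indic => //.
    by rewrite lebesgue_measure_itv/=; case: ifP => _; rewrite ?ltry.
  have iH : rintegrable H by apply: rintegrableB; exact: rintegrableZ.
  have l01 (b : R) : 0 < b -> \int[mu]_x (\1_(`[0%R, b[) x) = b.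
    by move=> b0; rewrite Rint_indic// lebesgue_measure_itv/= lte_fin b0 oppr0 addr0.
  have -> : 2 * pi * (n2 f - A * delta) = \int[mu]_x H x.
    rewrite RintB; [|exact: rintegrableZ|exact: rintegrableZ].
    by rewrite !RintZ// !l01//; move: (n2 f) => a; ring.
  rewrite EFin_Rint// integral_mkcond.
  have mG : measurable_fun setT G.
    apply: measurable_sum => i; apply: measurable_nsq.
    by apply: cmeas_comp; [exact: measurable_funD|exact: L2_meas].
  have G0 x : 0 <= G x by apply: sumr_ge0 => i _; exact: nsq_ge0.
  have GH x : (((fun x => \sum_(i < n.*2) (nsq (fourier f (x + (- (n%:R * 1) + i%:R * 1))%R))%:E) \_ `[0%R, 1%R[) x <= (H x)%:E)%E.
    rewrite patchE sumEFin -/(G x) /H !indicE.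
    case: ifPn => x1; last first.
      suff /negbTE -> : x \notin `[0%R, delta[%classic by rewrite !mulr0 subr0.
      move: x1; apply: contra; rewrite !inE/= !in_itv/= => /andP[-> b]; exact: (lt_le_trans b).
    rewrite lee_fin mulr1; have [xd|_] := boolP (x \in `[0%R, delta[%classic); last by rewrite mulr0 subr0.
    rewrite mulr1 -mulrBr; apply: big; move: xd; rewrite inE/= in_itv/= => /andP[-> b]; exact: ltW.
  apply: (ge0_le_integral _ measurableT).
  - by move=> x _; rewrite patchE sumEFin; case: ifP => // _; rewrite lee_fin; exact: G0.
  - apply/(measurable_restrictT _ _).1 => //; apply: measurable_funTS.
    rewrite (_ : (fun x => _) = EFin \o G); first exact/measurable_EFinP.
    by apply/funext => x; rewrite sumEFin.
  - by apply/measurable_EFinP; exact: rintegrable_meas iH.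
  - by move=> x _; exact: GH.
move: key; rewrite lee_fin; have : 0 < pi * A * delta by [].
rewrite !mulrBr -!mulrA; move: (pi * (A * delta)) (pi * n2 f) => a b; lra.
Qed.

(** For [x] small, [expi (- x t) f t] is close to [f], since [t] is bounded; and it is close to a
    trigonometric polynomial for a suitable small [x] by [sampled_parseval]. *)
Lemma trig_dense f (eps : R) : L2 f -> (forall t, ~ period t -> f t = 0) -> 0 < eps ->
  exists s a, uniq s /\ n2 (fun t => f t - lcomb trig a s t) <= eps.
Proof.
move=> lf sf e0.
pose P : R := 2 * pi.
(* On a period the squared modulus of [1 - expi (- x t)] is at most [(delta P)^2] when [x <= delta]. *)
pose D := 4 * (P ^+ 2 * n2 f) + eps.
have q0 : 0 <= P ^+ 2 * n2 f by rewrite mulr_ge0 ?n2_ge0// exprn_ge0// ltW.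
have D0 : 0 < D by rewrite /D ltr_wpDl// mulr_ge0.
pose delta := Num.min 1 (eps / D).
have del : 0 < delta <= 1 by rewrite lt_min ltr01 divr_gt0//= ge_min lexx.
have e4 : 0 < eps / 4 by rewrite divr_gt0.
have [x [s [/andP[x0 xd] us res]]] := sampled_parseval lf sf e4 del.
exists s, (fcoef trig (2 * pi) (modulate x f)); split=> //.
have lm := L2_modulate x lf.
have lc := L2_lcomb (fcoef trig (2 * pi) (modulate x f)) s L2_trig.
apply: (le_trans (n2_tri2 lf lm lc)).
have d1 : n2 (fun t => f t - modulate x f t) <= delta ^+ 2 * P ^+ 2 * n2 f.
  rewrite (_ : (fun t => _) = fun t => (cind period t * (1 - expi (- (x * t)))) * f t); last first.
    apply/funext => t; rewrite /modulate; have [pt|pt] := pselect (period t).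
      by rewrite cind_in// mul1r mulrBl mul1r.
    by rewrite sf// !mulr0 subr0.
  apply: n2M => //.
    apply: cmeas_mul; first exact: cmeas_cind measurable_period.
    apply: cmeas_sub; first exact: cmeas_cst.
    by apply: cmeas_expi; apply: measurableT_comp => //; exact: mulrl_measurable.
  move=> t; have [pt|pt] := pselect (period t); last first.
    by rewrite cind_out// mul0r nsq0 mulr_ge0 ?sqr_ge0.
  rewrite cind_in// mul1r -nsqN opprB; apply: (le_trans (nsq_expi_sub1 _)).
  move: pt; rewrite /period/= in_itv/= => /andP[t0 tP].
  rewrite sqrrN exprMn; apply: ler_pM; rewrite ?sqr_ge0//; apply: lerXn2r; rewrite ?nnegrE//; try exact: ltW.
  by case/andP: del => /ltW.
have dd : delta * D <= eps by rewrite -ler_pdivlMr// ge_min lexx orbT.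
have d2 : delta ^+ 2 * P ^+ 2 * n2 f <= eps / 4.
  case/andP: del => del0 del1.
  apply: (@le_trans _ _ (delta * (P ^+ 2 * n2 f))).
    by rewrite -mulrA; apply: ler_wpM2r => //; rewrite expr2 ler_piMl// ltW.
  move: dd; rewrite /D mulrDr; have : 0 <= delta * eps by rewrite mulr_ge0// ltW.
  by rewrite mulrCA; move: (delta * eps) (delta * _) => a b; lra.
by move: d1 d2 res; move: (n2 _) (n2 _) (_ * _ * n2 f) => a b c; lra.
Qed.

End Trigonometric_density.

(** * Closed spans and dual systems *)

Section Closed_span.
Context {R : realType} {I : choiceType}.
Local Notation C := (complex R).
Implicit Types (a : I -> C) (F G : {fset I}) (e : I -> R -> C) (f g : R -> C).

(** Membership in the closed linear span of the family [e]. *)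
Definition approx_by e f := forall eps : R, 0 < eps ->
  exists F a, n2 (fun x => f x - fin_comb e a F x) <= eps.

Lemma dense_spanP e : (forall l, L2 (e l)) ->
  dense_span e <-> (forall f, L2 f -> approx_by e f).
Proof.
move=> le; split=> [de f lf eps eps0|ap f lf eps eps0].
  have s0 : 0 < Num.sqrt eps by rewrite sqrtr_gt0.
  have [F [a]] := de f lf _ s0; have lc := L2_fin_comb a F le.
  rewrite L2diste_lt// => h; exists F, a.
  rewrite -L2norm_sqr; last exact: L2B.
  by rewrite -(sqr_sqrtr (ltW eps0)) lerXn2r// ?nnegrE ?L2norm_ge0// ltW.
have [F [a h]] := ap f lf (eps ^+ 2 / 2) (divr_gt0 (exprn_gt0 2 eps0) (@ltr0Sn R 1)).
exists F, a; have lc := L2_fin_comb a F le; rewrite L2diste_lt//.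
rewrite ltNge; apply/negP => le2; have := lerXn2r 2 (ltW eps0) (L2norm_ge0 _) le2.
rewrite L2norm_sqr; last exact: L2B.
by apply/negP; rewrite -ltNge; apply: (le_lt_trans h); have := exprn_gt0 2 eps0; move: (eps ^+ 2) => y; lra.
Qed.

Lemma fin_comb_widen e a F G : (F `<=` G)%fset ->
  fin_comb e a F = fin_comb e (fun l => if l \in F then a l else 0) G.
Proof.
move=> FG; apply/funext => x; rewrite /fin_comb (@big_fset_diff _ _ _ _ _ FG).
rewrite [X in _ = _ + X]big_seq [X in _ = _ + X]big1 ?addr0; last first.
  by move=> l; rewrite in_fsetD => /andP[/negbTE -> _]; rewrite mul0r.
by rewrite big_seq [RHS]big_seq; apply: eq_bigr => l ->.
Qed.

Lemma approx_comb e a F : approx_by e (fin_comb e a F).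
Proof.
move=> eps e0; exists F, a; rewrite (_ : (fun x => _) = fun=> 0) ?n20 ?ltW//.
by apply/funext => x; rewrite subrr.
Qed.

Lemma approx_lim e f : (forall l, L2 (e l)) -> L2 f ->
  (forall eps : R, 0 < eps -> exists g, [/\ L2 g, approx_by e g & n2 (fun x => f x - g x) <= eps]) ->
  approx_by e f.
Proof.
move=> le lf h eps e0; have e4 : 0 < eps / 4 by rewrite divr_gt0.
have [g [lg /(_ _ e4)[F [a ga]] fg]] := h _ e4; exists F, a.
apply: (le_trans (n2_tri2 lf lg (L2_fin_comb a F le))).
by move: fg ga; move: (n2 _) (n2 _) => u v; lra.
Qed.

Lemma approxD e f g : (forall l, L2 (e l)) -> L2 f -> L2 g -> approx_by e f -> approx_by e g ->
  approx_by e (fun x => f x + g x).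
Proof.
move=> le lf lg af ag eps e0; have e4 : 0 < eps / 4 by rewrite divr_gt0.
have [F [a fa]] := af _ e4; have [G [b gb]] := ag _ e4.
pose a' l := if l \in F then a l else 0; pose b' l := if l \in G then b l else 0.
have FE := fin_comb_widen e a (fsubsetUl F G); have GE := fin_comb_widen e b (fsubsetUr F G).
exists (F `|` G)%fset, (fun l => a' l + b' l).
rewrite (_ : (fun x => _) = fun x => (f x - fin_comb e a F x) + (g x - fin_comb e b G x)); last first.
  apply/funext => x; rewrite FE GE addrACA -opprD; congr (_ - _).
  by rewrite /fin_comb -big_split; apply: eq_bigr => l _; rewrite mulrDl.
apply: (le_trans (n2_sum2 (L2B lf (L2_fin_comb a F le)) (L2B lg (L2_fin_comb b G le)))).
by move: fa gb; move: (n2 _) (n2 _) => u v; lra.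
Qed.

Lemma approxZ e f (c : C) : (forall l, L2 (e l)) -> L2 f -> approx_by e f ->
  approx_by e (fun x => c * f x).
Proof.
move=> le lf af eps e0; have d0 : 0 < nsq c + 1 by rewrite ltr_wpDl// nsq_ge0.
have [F [a fa]] := af _ (divr_gt0 e0 d0); exists F, (fun l => c * a l).
rewrite (_ : (fun x => _) = fun x => c * (f x - fin_comb e a F x)); last first.
  apply/funext => x; rewrite mulrBr /fin_comb mulr_sumr; congr (_ - _).
  by apply: eq_bigr => l _; rewrite mulrA.
rewrite n2Z; last by apply: L2B => //; exact: L2_fin_comb.
apply: (@le_trans _ _ ((nsq c + 1) * (eps / (nsq c + 1)))); last by rewrite mulrCA divff ?mulr1// gt_eqF.
by apply: ler_pM; rewrite ?nsq_ge0 ?n2_ge0// lerDl.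
Qed.

Lemma approx0 e : approx_by e (fun=> 0).
Proof.
by have := @approx_comb e (fun=> 0) fset0; rewrite (_ : fin_comb _ _ _ = fun=> 0)//;
  apply/funext => x; rewrite /fin_comb big_seq_fset0.
Qed.

Lemma approx_atom e l : approx_by e (e l).
Proof.
have := @approx_comb e (fun=> 1) [fset l]%fset; rewrite (_ : fin_comb _ _ _ = e l)//.
by apply/funext => x; rewrite /fin_comb big_seq_fset1 mul1r.
Qed.

Lemma approx_sum (J : Type) (s : seq J) e (f : J -> R -> C) : (forall l, L2 (e l)) ->
  (forall j, L2 (f j)) -> (forall j, approx_by e (f j)) ->
  approx_by e (fun x => \sum_(j <- s) f j x).
Proof.
move=> le lf af; elim: s => [|j s IH].
  by rewrite (_ : (fun x => _) = fun=> 0); [exact: approx0|apply/funext => x; rewrite big_nil].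
rewrite (_ : (fun x => _) = fun x => f j x + \sum_(j <- s) f j x); last by apply/funext => x; rewrite big_cons.
by apply: approxD => //; exact: L2_sum.
Qed.

Lemma inner_approx0 e f g : (forall l, L2 (e l)) -> L2 f -> L2 g -> approx_by e f ->
  (forall l, inner (e l) g = 0) -> inner f g = 0.
Proof.
move=> le lf lg af eg; apply: nsq_eq0; apply: eq0_small => [|eps e0]; first exact: nsq_ge0.
have d0 : 0 < n2 g + 1 by rewrite ltr_wpDl// n2_ge0.
have [F [a fa]] := af _ (divr_gt0 e0 d0); have lc := L2_fin_comb a F le.
have -> : inner f g = inner (fun x => f x - fin_comb e a F x) g.
  have -> : inner f g = inner (fun x => (f x - fin_comb e a F x) + fin_comb e a F x) g.
    by congr inner; apply/funext => x; rewrite subrK.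
  rewrite innerDl//; last exact: L2B.
  have -> : inner (fin_comb e a F) g = 0; last by rewrite addr0.
  rewrite (@inner_lcombl _ _ e a F g)// big1// => l _.
  by rewrite eg mulr0.
apply: (le_trans (nsq_inner (L2B lf lc) lg)).
apply: (@le_trans _ _ ((eps / (n2 g + 1)) * (n2 g + 1))); last by rewrite divfK// gt_eqF.
by apply: ler_pM; rewrite ?n2_ge0// lerDl.
Qed.

End Closed_span.

Lemma approx_trans (R : realType) (I J : choiceType) (e : I -> R -> complex R) (e' : J -> R -> complex R) (f : R -> complex R) :
  (forall l, L2 (e l)) -> (forall l, L2 (e' l)) -> L2 f ->
  approx_by e' f -> (forall l, approx_by e (e' l)) -> approx_by e f.
Proof.
move=> le le' lf af ae; apply: approx_lim => // eps e0; have [F [a fa]] := af _ e0.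
exists (fin_comb e' a F); split => //; first exact: L2_fin_comb.
by apply: approx_sum => // l; [exact: L2Z|exact: approxZ].
Qed.

Section Dual_systems.
Context {R : realType} {I : choiceType}.
Local Notation C := (complex R).
Implicit Types (a : I -> C) (F : {fset I}).

(** A Bessel-type bound with a weight for each index, the form in which unnormalized families are
    bounded. *)
Definition synthesis_bound (G : I -> R -> C) (om : I -> R) (B : R) :=
  forall a F, n2 (fin_comb G a F) <= B * \sum_(l <- F) nsq (a l) * om l ^+ 2.

Variables (G D : I -> R -> C) (om : I -> R) (B B' : R).
Hypotheses (om0 : forall l, 0 < om l) (B0 : 0 < B) (B'0 : 0 < B').
Hypotheses (lG : forall l, L2 (G l)) (lD : forall l, L2 (D l)).
Hypothesis sG : synthesis_bound G om B.
Hypothesis sD : synthesis_bound D (fun l => (om l)^-1) B'.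

(** The synthesis bound by duality: test [f] against [\sum_l om_l^2 <f, D_l> D_l]. *)
Lemma dual_bessel f F : L2 f -> \sum_(l <- F) nsq (inner f (D l)) * om l ^+ 2 <= B' * n2 f.
Proof.
move=> lf; set S := (X in X <= _).
have S0 : 0 <= S by apply: sumr_ge0 => l _; rewrite mulr_ge0 ?nsq_ge0 ?sqr_ge0.
pose a l := (om l ^+ 2)%:C%C * inner f (D l).
have lc := L2_fin_comb a F lD.
have e1 : inner f (fin_comb D a F) = S%:C%C.
  rewrite (@inner_lcombr _ _ D a F f)// rmorph_sum; apply: eq_bigr => l _.
  rewrite /a conjcM conjc_real -mulrA [conjc _ * _]mulrC mul_conjc -rmorphM.
  by rewrite mulrC.
have := nsq_inner lf lc; rewrite e1 nsq_real => h.
have h2 : n2 (fin_comb D a F) <= B' * S.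
  apply: (le_trans (sD a F)); apply: ler_wpM2l; first exact: ltW.
  apply: ler_sum => l _; rewrite /a nsqM nsq_real exprVn.
  have o2 : om l ^+ 2 != 0 by rewrite expf_neq0// gt_eqF.
  rewrite le_eqVlt; apply/orP; left; apply/eqP.
  by move: (nsq _) (om l ^+ 2) o2 => u v v0; field.
have [S1|S1] := eqVneq S 0; first by rewrite S1 mulr_ge0 ?n2_ge0// ltW.
have Sp : 0 < S by rewrite lt_neqAle eq_sym S1.
rewrite -(ler_pM2r Sp) -expr2; apply: (le_trans h).
rewrite mulrC mulrAC; apply: ler_wpM2r => //; exact: n2_ge0.
Qed.

Variable c : R.
Hypothesis c0 : 0 < c.
Hypothesis biorth : forall l m, inner (G l) (D m) = if l == m then c%:C%C else 0.

Let inner_comb_dual a b F : inner (fin_comb G a F) (fin_comb D b F)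
  = c%:C%C * \sum_(l <- F) a l * conjc (b l).
Proof.
rewrite (@inner_lcombl _ _ G a F)//; last exact: L2_fin_comb.
rewrite mulr_sumr big_seq [RHS]big_seq; apply: eq_bigr => l lF.
rewrite (@inner_lcombr _ _ D b F)// (bigD1_seq l)//= ?fset_uniq// biorth eqxx big1 ?addr0.
  by rewrite mulrCA [conjc _ * _]mulrC mulrCA mulrA.
by move=> m ml; rewrite biorth eq_sym (negbTE ml) mulr0.
Qed.

(** Test the combination against [\sum_l om_l^2 a_l D_l]: biorthogonality makes the inner product
    equal to the weighted sum of squares, and the synthesis bound of the dual family controls the
    norm of the test function. *)
Lemma dual_lower_bound a F :
  c ^+ 2 / B' * \sum_(l <- F) nsq (a l) * om l ^+ 2 <= n2 (fin_comb G a F).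
Proof.
set S := (X in _ * X).
have S0 : 0 <= S by apply: sumr_ge0 => l _; rewrite mulr_ge0 ?nsq_ge0 ?sqr_ge0.
pose b l := (om l ^+ 2)%:C%C * a l.
have e1 : inner (fin_comb G a F) (fin_comb D b F) = (c * S)%:C%C.
  rewrite inner_comb_dual rmorphM; congr (_ * _); rewrite rmorph_sum; apply: eq_bigr => l _.
  by rewrite /b conjcM conjc_real mulrCA mul_conjc -rmorphM mulrC.
have := nsq_inner (L2_fin_comb a F lG) (L2_fin_comb b F lD); rewrite e1 nsq_real => h.
have h2 : n2 (fin_comb D b F) <= B' * S.
  apply: (le_trans (sD b F)); apply: ler_wpM2l; first exact: ltW.
  apply: ler_sum => l _; rewrite /b nsqM nsq_real exprVn.
  have o2 : om l ^+ 2 != 0 by rewrite expf_neq0// gt_eqF.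
  rewrite le_eqVlt; apply/orP; left; apply/eqP.
  by move: (nsq _) (om l ^+ 2) o2 => u v v0; field.
have [S1|S1] := eqVneq S 0; first by rewrite S1 mulr0 n2_ge0.
have Sp : 0 < S by rewrite lt_neqAle eq_sym S1.
rewrite mulrAC ler_pdivrMr// -(ler_pM2r Sp).
rewrite (_ : c ^+ 2 * S * S = (c * S) ^+ 2); last by rewrite exprMn expr2 expr2 !mulrA.
by apply: (le_trans h); rewrite -mulrA; apply: ler_wpM2l => //; exact: n2_ge0.
Qed.

Lemma n2_atom_bounds l : c ^+ 2 / B' * om l ^+ 2 <= n2 (G l) <= B * om l ^+ 2.
Proof.
have e : fin_comb G (fun=> 1) [fset l]%fset = G l.
  by apply/funext => x; rewrite /fin_comb big_seq_fset1 mul1r.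
have n1 : nsq (1 : C) = 1 by rewrite -[1]/(1%:C%C) nsq_real expr1n.
have := dual_lower_bound (fun=> 1) [fset l]%fset; have := sG (fun=> 1) [fset l]%fset.
by rewrite e !big_seq_fset1 n1 !mul1r => -> ->.
Qed.

(** Applied to a single index the two bounds compare [n2 (G l)] with [om l ^ 2], so that normalizing
    the functions amounts to removing the weights. The Fourier isometry carries the bounds and the
    density back to the functions [e]. *)
Theorem riesz_of_dual_systems (f e : I -> R -> C) :
  (forall l, L2_fourier (f l) (G l)) ->
  (forall l, e l = fun t => (L2norm (f l))^-1%:C%C * f l t) ->
  dense_span G -> c = 2 * pi -> riesz_basis e.
Proof.
move=> fG eE dG cE.
have lf l : L2 (f l) by exact: L2_fourier_L2l (fG l).
pose r l := L2norm (f l).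
have r2 l : n2 (G l) = c * r l ^+ 2 by rewrite (L2_fourier_isometry (fG l)) cE L2norm_sqr.
have q l : c / B' * om l ^+ 2 <= r l ^+ 2 <= B / c * om l ^+ 2.
  have := n2_atom_bounds l; rewrite r2 => /andP[a b]; apply/andP; split.
    rewrite -(ler_pM2l c0); apply: le_trans a.
    by rewrite expr2 !mulrA.
  by rewrite -(ler_pM2l c0); apply: (le_trans b); rewrite !mulrA [c * B]mulrC mulfK// gt_eqF.
have om2 l : 0 < om l ^+ 2 by exact: exprn_gt0.
have r20 l : 0 < r l ^+ 2 by have /andP[a _] := q l; apply: lt_le_trans a; rewrite mulr_gt0// divr_gt0.
have r0 l : 0 < r l.
  by rewrite lt_neqAle L2norm_ge0 andbT eq_sym -sqrf_eq0 gt_eqF.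
pose e' l : R -> C := fun x => (r l)^-1%:C%C * G l x.
have ee l : L2_fourier (e l) (e' l) by rewrite eE; exact: L2_fourierZ.
have le l : L2 (e l) by exact: L2_fourier_L2l (ee l).
have le' l : L2 (e' l) by exact: L2_fourier_L2r (ee l).
have comb a F : fin_comb e' a F = fin_comb G (fun l => (r l)^-1%:C%C * a l) F.
  by apply/funext => x; apply: eq_bigr => l _; rewrite /e' mulrA [a l * _]mulrC.
have combF a F : L2_fourier (fin_comb e a F) (fin_comb e' a F).
  by apply: L2_fourier_sum => l; exact: L2_fourierZ.
(* By [q] the ratio [om l ^ 2 / r l ^ 2] lies between [c / B] and [B' / c]. *)
pose m := c / (B * B') * c; pose M := B * B' / c / c.
have m0 : 0 < m by rewrite mulr_gt0// divr_gt0// mulr_gt0.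
have M0 : 0 < M by rewrite !divr_gt0// mulr_gt0.
have bd a F : m * \sum_(l <- F) nsq (a l) <= n2 (fin_comb e a F) <= M * \sum_(l <- F) nsq (a l).
  have n2E' : n2 (fin_comb e' a F) = c * n2 (fin_comb e a F) by rewrite (L2_fourier_isometry (combF a F)) cE.
  have ra l : nsq ((r l)^-1%:C%C * a l) * om l ^+ 2 = nsq (a l) * (om l ^+ 2 / r l ^+ 2).
    by rewrite nsqM nsq_real exprVn mulrAC mulrC [_^-1 * _]mulrC.
  apply/andP; split; rewrite -(ler_pM2l c0) -n2E' comb.
    apply: le_trans (dual_lower_bound _ _); rewrite /m mulrA !mulr_sumr; apply: ler_sum => l _.
    rewrite ra; have /andP[_ b] := q l.
    rewrite [leRHS]mulrCA [leLHS]mulrC; apply: ler_wpM2l; first exact: nsq_ge0.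
    rewrite [leRHS]mulrA ler_pdivlMr//.
    apply: (@le_trans _ _ (c * (c / (B * B') * c) * (B / c * om l ^+ 2))).
      by apply: ler_wpM2l => //; rewrite ltW// mulr_gt0.
    rewrite le_eqVlt; apply/orP; left; apply/eqP; field.
    by rewrite !gt_eqF.
  apply: (le_trans (sG _ _)); rewrite /M mulrA !mulr_sumr; apply: ler_sum => l _.
  rewrite ra; have /andP[b _] := q l.
  rewrite [leLHS]mulrCA [leRHS]mulrC; apply: ler_wpM2l; first exact: nsq_ge0.
  rewrite [leLHS]mulrA ler_pdivrMr//.
  apply: (@le_trans _ _ (c * (B * B' / c / c) * (c / B' * om l ^+ 2))); last first.
    by apply: ler_wpM2l => //; rewrite ltW// mulr_gt0.
  rewrite le_eqVlt; apply/orP; left; apply/eqP; field.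
  by rewrite !gt_eqF.
apply: (@riesz_of_bounds _ _ e (Num.sqrt m) (Num.sqrt (m + M))) => //.
- by rewrite sqrtr_gt0.
- by apply: ler_wsqrtr; rewrite lerDl ltW.
- move=> a F; rewrite !sqr_sqrtr ?(ltW m0) ?(ltW (addr_gt0 m0 M0))//.
  have /andP[-> b] := bd a F; apply: (le_trans b); apply: ler_wpM2r; last by rewrite lerDr ltW.
  by apply: sumr_ge0 => l _; exact: nsq_ge0.
apply/dense_spanP => // g lg eps eps0.
have [g' gg'] := L2_fourier_exists lg; have lg' := L2_fourier_L2r gg'.
have [F [a h]] := (dense_spanP lG).1 dG g' lg' (c * eps) (mulr_gt0 c0 eps0).
exists F, (fun l => (r l)%:C%C * a l).
have cE' : fin_comb e' (fun l => (r l)%:C%C * a l) F = fin_comb G a F.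
  rewrite comb; apply/funext => x; apply: eq_bigr => l _.
  by rewrite mulrA -rmorphM/= mulVf ?gt_eqF// rmorph1 mul1r.
have := L2_fourier_isometry (L2_fourierB gg' (combF (fun l => (r l)%:C%C * a l) F)).
rewrite cE' => E; rewrite -(ler_pM2l c0) {1}cE -E; exact: h.
Qed.
End Dual_systems.

(** * Synthesis bound for filtered wavelets *)

(** Cauchy-Schwarz for the measure of weights [w]. *)
Lemma weighted_cauchy (R : realType) (J : Type) (r : seq J) (z : J -> complex R) (u w : J -> R) :
  (forall j, 0 <= u j) -> (forall j, 0 <= w j) -> (forall j, normc (z j) <= u j * w j) ->
  nsq (\sum_(j <- r) z j) <= (\sum_(j <- r) w j) * \sum_(j <- r) u j ^+ 2 * w j.
Proof.
move=> u0 w0 zle.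
have le1 : normc (\sum_(j <- r) z j) <= \sum_(j <- r) u j * w j.
  elim: r => [|j r IH]; first by rewrite !big_nil normcE nsq0 sqrtr0.
  rewrite !big_cons; apply: (le_trans (le_normcD _ _)); exact: lerD.
rewrite -normc_sqr; apply: (@le_trans _ _ ((\sum_(j <- r) u j * w j) ^+ 2)).
  apply: lerXn2r; rewrite ?nnegrE ?normc_ge0//.
  by apply: sumr_ge0 => j _; exact: mulr_ge0.
elim: r {le1} => [|j r IH]; first by rewrite !big_nil expr0n mul0r.
rewrite !big_cons; set S := (\sum_(j <- r) u j * w j) in IH *.
set W := (\sum_(j <- r) w j) in IH *; set Q := (\sum_(j <- r) u j ^+ 2 * w j) in IH *.
have W0 : 0 <= W by apply: sumr_ge0.
have Q0 : 0 <= Q by apply: sumr_ge0 => i _; rewrite mulr_ge0// sqr_ge0.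
have amgm : 2 * S * u j <= W * u j ^+ 2 + Q.
  have [W1|W1] := eqVneq W 0.
    move: IH; rewrite W1 mul0r => IH; have : S ^+ 2 = 0 by apply/eqP; rewrite eq_le IH sqr_ge0.
    by move/eqP; rewrite sqrf_eq0 => /eqP ->; rewrite mulr0 !mul0r add0r.
  have Wp : 0 < W by rewrite lt_neqAle eq_sym W1.
  rewrite -(ler_pM2l Wp) -subr_ge0; apply: (@le_trans _ _ ((W * u j - S) ^+ 2)); first exact: sqr_ge0.
  by move: IH; move: (u j) => v IH; rewrite -subr_ge0; move: IH; rewrite -subr_ge0 => IH; nra.
have : 2 * S * u j * w j <= (W * u j ^+ 2 + Q) * w j by apply: ler_wpM2r.
by move: IH; move: (u j) (w j) => v t; nra.
Qed.

Section Trigonometric_polynomials.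
Context {R : realType}.
Local Notation C := (complex R).
Local Notation mu := (@lebesgue_measure R).
Implicit Types (s : seq int) (a : int -> C).

Definition tpoly s a (x : R) : C := \sum_(k <- s) a k * expi (- (k%:~R * x)).

Lemma tpoly_periodic s a x : tpoly s a (x + 2 * pi) = tpoly s a x.
Proof.
apply: eq_bigr => k _; rewrite mulrDr opprD expiD -[- (_ * (2 * pi))]mulNr -rmorphN/=.
by rewrite expi_period_int mulr1.
Qed.

Lemma cmeas_tpoly s a : cmeasurable (tpoly s a).
Proof.
apply: cmeas_sum => k; apply: cmeas_mul; first exact: cmeas_cst.
by apply: cmeas_expi; apply: measurableT_comp => //; exact: mulrl_measurable.
Qed.

Let tpoly_lcomb s a : (fun x => cind period x * tpoly s a x)
  = lcomb trig (fun k => a (- k)) [seq - k | k <- s].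
Proof.
apply/funext => x; rewrite /lcomb big_map mulr_sumr; apply: eq_bigr => k _.
by rewrite opprK /trig mulrCA rmorphN/= mulNr.
Qed.

Lemma L2_tpoly s a : L2 (fun x => cind period x * tpoly s a x).
Proof. by rewrite tpoly_lcomb; apply: L2_lcomb => k; exact: L2_trig. Qed.

Lemma n2_tpoly s a : uniq s ->
  n2 (fun x => cind period x * tpoly s a x) = 2 * pi * \sum_(k <- s) nsq (a k).
Proof.
move=> us.
rewrite tpoly_lcomb (n2_orth_lcomb L2_trig inner_trig); last by rewrite map_inj_uniq//; exact: oppr_inj.
by rewrite big_map; congr (_ * _); apply: eq_bigr => k _; rewrite opprK.
Qed.

Lemma tpoly_weight s a (w : R -> R) (S : R) : uniq s ->
  measurable_fun setT w -> (forall x, 0 <= w x) ->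
  (forall (x : R) m, \sum_(i < m) w (x + i%:R * (2 * pi)) <= S) ->
  rintegrable (fun x => nsq (tpoly s a x) * w x) /\
  \int[mu]_x (nsq (tpoly s a x) * w x) <= S * (2 * pi * \sum_(k <- s) nsq (a k)).
Proof.
move=> us mw w0 wS; rewrite -n2_tpoly//.
have pi1 : 0 < 2 * (pi : R) by rewrite mulr_gt0// pi_gt0.
exact: (periodic_weight pi1 (cmeas_tpoly s a) mw w0 (tpoly_periodic s a) wS (L2_tpoly s a)).
Qed.

End Trigonometric_polynomials.

Section Split_sums.
Context {A B : eqType}.

Definition lefts (s : seq (A + B)) : seq A := pmap (fun l => if l is inl k then Some k else None) s.
Definition rights (s : seq (A + B)) : seq B := pmap (fun l => if l is inr k then Some k else None) s.

Lemma big_split_sum (V : nmodType) (s : seq (A + B)) (f : A + B -> V) :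
  \sum_(l <- s) f l = \sum_(k <- lefts s) f (inl k) + \sum_(q <- rights s) f (inr q).
Proof.
elim: s => [|[k|q] s IH]; rewrite ?big_nil ?addr0// /lefts /rights/= !big_cons IH ?addrA//.
by congr (_ + _); exact: addrC.
Qed.

Lemma lefts_uniq s : uniq s -> uniq (lefts s).
Proof. by apply: (@pmap_uniq _ _ _ inl) => -[]. Qed.

Lemma rights_uniq s : uniq s -> uniq (rights s).
Proof. by apply: (@pmap_uniq _ _ _ inr) => -[]. Qed.

End Split_sums.

Section Levels.
Context {A : eqType}.
Implicit Types s : seq (nat * A).

(** Indices [(j, k)] are grouped by scale, since the terms of one scale form a periodic function
    times a fixed profile. *)
Definition level s (j : nat) : seq A := [seq q.2 | q <- s & q.1 == j].
Definition depth s : nat := (\max_(q <- s) q.1).+1.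

Lemma level_uniq s j : uniq s -> uniq (level s j).
Proof.
move=> us; rewrite map_inj_in_uniq ?filter_uniq// => -[a b] [c e].
by rewrite !mem_filter/= => /andP[/eqP -> _] /andP[/eqP -> _] ->.
Qed.

Lemma big_levels (V : nmodType) s (f : nat * A -> V) :
  \sum_(q <- s) f q = \sum_(j < depth s) \sum_(k <- level s j) f ((j : nat), k).
Proof.
transitivity (\sum_(j < depth s) \sum_(q <- s | q.1 == j) f q).
  rewrite (exchange_big_dep xpredT)//= big_seq [RHS]big_seq; apply: eq_bigr => q qs.
  have qd : (q.1 < depth s)%N by rewrite /depth ltnS; exact: (@leq_bigmax_seq _ _ xpredT (fun q : nat * A => q.1) q).
  rewrite (big_pred1 (Ordinal qd))// => j /=; by rewrite eq_sym -val_eqE.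
apply: eq_bigr => j _; rewrite big_map big_filter; apply: eq_bigr => -[i k] /= /eqP ->.
by [].
Qed.

End Levels.

Section Integral_sums.
Context {R : realType}.
Local Notation mu := (@lebesgue_measure R).

Lemma rintegrable_sum (J : Type) (r : seq J) (f : J -> R -> R) : (forall j, rintegrable (f j)) ->
  rintegrable (fun x => \sum_(j <- r) f j x).
Proof.
move=> i; elim: r => [|j r IH].
  rewrite (_ : (fun x => _) = fun=> 0); last by apply/funext => x; rewrite big_nil.
  by have [] := @cintegrable0 R.
rewrite (_ : (fun x => _) = fun x => f j x + \sum_(j <- r) f j x); first exact: rintegrableD.
by apply/funext => x; rewrite big_cons.
Qed.

Lemma Rint_sum (J : Type) (r : seq J) (f : J -> R -> R) : (forall j, rintegrable (f j)) ->
  \int[mu]_x (\sum_(j <- r) f j x) = \sum_(j <- r) \int[mu]_x f j x.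
Proof.
move=> i; elim: r => [|j r IH].
  rewrite big_nil; under eq_Rintegral => x _ do rewrite big_nil.
  by rewrite Rintegral_cst// mul0r.
rewrite big_cons -IH -RintD//; last exact: rintegrable_sum.
by apply: eq_Rintegral => x _; rewrite big_cons.
Qed.
End Integral_sums.

Section Wavelet_frame_synthesis.
Context {R : realType}.
Local Notation C := (complex R).
Local Notation mu := (@lebesgue_measure R).

(** The factor by which the transform of [dil f j 0] differs from a dilate of that of [f], namely
    [2^(- j / 2)], in the form that the change of variables produces. *)
Definition dyadic_scale (j : nat) : R := 2 `^ (j%:R / 2) / 2 ^+ j.

(** With [p] and [q] the transforms of the scaling function and of the wavelet, these are the
    transforms of [phi_(0,k)] and [psi_(j,k)] multiplied by [h1] and [h2]. *)
Definition filtered_system (h1 h2 p q : R -> C) (l : int + nat * int) : R -> C :=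
  match l with
  | inl k => fun x => expi (- (k%:~R * x)) * (h1 x * p x)
  | inr (j, k) => fun x => expi (- (2 ^- j * k%:~R * x)) *
                          (h2 x * ((dyadic_scale j)%:C%C * q (2 ^- j * x)))
  end.

(** The size of [h2] on the frequencies of scale [j], where [|x|] is about [2^j]. *)
Definition level_weight (d : R) (l : int + nat * int) : R :=
  match l with inl _ => 1 | inr (j, _) => 2 `^ (- (j%:R * d)) end.

Lemma level_weight_gt0 d l : 0 < level_weight d l.
Proof. by case: l => [k|[j k]] /=; rewrite ?powR_gt0. Qed.

Lemma dyadic_scale_ge0 j : 0 <= dyadic_scale j.
Proof. by rewrite /dyadic_scale divr_ge0 ?powR_ge0. Qed.

Lemma dyadic_scale_sqr j : 2 ^+ j * dyadic_scale j ^+ 2 = 1.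
Proof.
have e : (2 `^ (j%:R / 2)) ^+ 2 = 2 ^+ j :> R.
  by rewrite -(powR_mulrn 2 (powR_ge0 _ _)) -powRrM divfK ?pnatr_eq0// powR_mulrn.
rewrite /dyadic_scale exprMn exprVn e.
have : (2 ^+ j : R) != 0 by rewrite expf_neq0.
by move: (2 ^+ j) => y y0; field.
Qed.

(** All that the synthesis bound needs: the periodization of [|h1 p|^2] is bounded, and after
    rescaling the profiles [h2 q] at all scales are dominated, up to the level weights, by one
    function [th] whose sums over translates by periods and over dyadic dilates are both bounded. *)
Record dominated (h1 h2 p q : R -> C) (d : R) (th : R -> R) (S1 S2 T : R) : Prop := Dominated {
  dom_h1 : cmeasurable h1; dom_h2 : cmeasurable h2;
  dom_p : cmeasurable p; dom_q : cmeasurable q;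
  dom_th : measurable_fun setT th;
  dom_th0 : forall x, 0 <= th x;
  dom_low : forall (x : R) m, \sum_(i < m) nsq (h1 (x + i%:R * (2 * pi)) * p (x + i%:R * (2 * pi))) <= S1;
  dom_periods : forall (x : R) m, \sum_(i < m) th (x + i%:R * (2 * pi)) <= S2;
  dom_scales : forall (x : R) m, \sum_(j < m) th (2 ^- j * x) <= T;
  dom_high : forall (j : nat) (y : R), normc (h2 (2 ^+ j * y) * q y) <= 2 `^ (- (j%:R * d)) * th y }.

Variables (h1 h2 p q : R -> C) (d : R) (th : R -> R) (S1 S2 T : R).
Hypothesis dom : dominated h1 h2 p q d th S1 S2 T.

Let S10 : 0 <= S1. Proof. by have := dom_low dom 0 0; rewrite big_ord0. Qed.
Let S20 : 0 <= S2. Proof. by have := dom_periods dom 0 0; rewrite big_ord0. Qed.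
Let T0 : 0 <= T. Proof. by have := dom_scales dom 0 0; rewrite big_ord0. Qed.

Let mhp : cmeasurable (fun x => h1 x * p x).
Proof. by apply: cmeas_mul; [exact: dom_h1 dom|exact: dom_p dom]. Qed.

Let wave (j : nat) : R -> C := fun x => h2 x * ((dyadic_scale j)%:C%C * q (2 ^- j * x)).

Let mwave j : cmeasurable (wave j).
Proof.
apply: cmeas_mul; first exact: dom_h2 dom.
apply: cmeas_mul; first exact: cmeas_cst.
by apply: cmeas_comp; [exact: mulrl_measurable|exact: dom_q dom].
Qed.

Let wave_le j x : normc (wave j x) <= dyadic_scale j * 2 `^ (- (j%:R * d)) * th (2 ^- j * x).
Proof.
have := dom_high dom j (2 ^- j * x); rewrite mulrA divff ?expf_neq0// mul1r => h.
rewrite /wave mulrCA normcM normc_real ger0_norm ?dyadic_scale_ge0// -mulrA.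
by apply: ler_wpM2l => //; exact: dyadic_scale_ge0.
Qed.

(** The translates sum up to a trigonometric polynomial times [h1 p]. *)
Let low_part (s : seq int) (a : int -> C) : uniq s ->
  let f := fun x => \sum_(k <- s) a k * filtered_system h1 h2 p q (inl k) x in
  L2 f /\ n2 f <= S1 * (2 * pi * \sum_(k <- s) nsq (a k)).
Proof.
move=> us f.
have fE x : nsq (f x) = nsq (tpoly s a x) * nsq (h1 x * p x).
  by rewrite -nsqM mulr_suml; congr nsq; apply: eq_bigr => k _ /=; rewrite mulrA.
have mf : cmeasurable f.
  apply: cmeas_sum => k; apply: cmeas_mul; first exact: cmeas_cst.
  apply: cmeas_mul mhp; apply: cmeas_expi.
  by apply: measurableT_comp => //; exact: mulrl_measurable.
have [i b] := @tpoly_weight _ s a (fun x => nsq (h1 x * p x)) S1 us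
  (measurable_nsq mhp) (fun x => nsq_ge0 _) (dom_low dom).
have lf : L2 f by apply: (L2_le mf i) => x; rewrite fE.
by split=> //; apply: (le_trans _ b); apply: n2_le => // x; rewrite fE.
Qed.

(** The terms of scale [j] sum up to a dilated trigonometric polynomial [P j] times the dilated
    profile. A Cauchy-Schwarz inequality over the scales, with weights [th (2^-j x)], decouples the
    scales; after rescaling, [periodic_weight] bounds each of them separately. *)
Let high_part (s : seq (nat * int)) (a : nat * int -> C) : uniq s ->
  let f := fun x => \sum_(l <- s) a l * filtered_system h1 h2 p q (inr l) x in
  L2 f /\ n2 f <= T * (S2 * (2 * pi)) * \sum_(l <- s) nsq (a l) * (2 `^ (- (l.1%:R * d))) ^+ 2.
Proof.
move=> us f.
pose P (j : nat) x := tpoly (level s j) (fun k => a (j, k)) x.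
have fE x : f x = \sum_(j < depth s) P j (2 ^- j * x) * wave j x.
  rewrite /f big_levels; apply: eq_bigr => j _; rewrite mulr_suml; apply: eq_bigr => k _ /=.
  rewrite mulrA; congr (_ * expi (- _) * _); by rewrite mulrAC mulrC.
have mf : cmeasurable f.
  apply: cmeas_sum => -[j k]; apply: cmeas_mul; first exact: cmeas_cst.
  apply: cmeas_mul (mwave j); apply: cmeas_expi.
  by apply: measurableT_comp => //; exact: mulrl_measurable.
pose om (j : nat) : R := 2 `^ (- (j%:R * d)).
pose u j x := normc (P j (2 ^- j * x)) * (dyadic_scale j * om j).
have u0 j x : 0 <= u j x by rewrite !mulr_ge0 ?normc_ge0 ?dyadic_scale_ge0 ?powR_ge0.
pose W x := T * \sum_(j < depth s) u j x ^+ 2 * th (2 ^- j * x).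
have fW x : nsq (f x) <= W x.
  rewrite fE; apply: (le_trans (@weighted_cauchy _ _ _ _ (fun j : 'I_ _ => u j x) (fun j : 'I_ _ => th (2 ^- j * x)) _ _ _)).
  - by move=> j; exact: u0.
  - by move=> j; exact: dom_th0 dom _.
  - by move=> j; rewrite normcM -mulrA; apply: ler_wpM2l; [exact: normc_ge0|exact: wave_le].
  apply: ler_wpM2r; last exact: dom_scales dom _ _.
  by apply: sumr_ge0 => j _; rewrite mulr_ge0 ?sqr_ge0//; exact: dom_th0 dom _.
have uE j x : u j x ^+ 2 * th (2 ^- j * x) =
    (dyadic_scale j * om j) ^+ 2 * (nsq (P j (2 ^- j * x)) * th (2 ^- j * x)).
  by rewrite /u exprMn normc_sqr mulrAC mulrC.
have pw j : rintegrable (fun x => nsq (P j x) * th x) /\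
    \int[mu]_x (nsq (P j x) * th x) <= S2 * (2 * pi * \sum_(k <- level s j) nsq (a (j, k))).
  exact: (@tpoly_weight _ (level s j) (fun k => a (j, k)) th S2 (level_uniq j us)
    (dom_th dom) (dom_th0 dom) (dom_periods dom)).
have j0 (j : nat) : 0 < (2 ^- j : R) by rewrite invr_gt0 exprn_gt0.
have ij j : rintegrable (fun x => u j x ^+ 2 * th (2 ^- j * x)).
  rewrite (_ : (fun x => _) = fun x => (dyadic_scale j * om j) ^+ 2 * (fun x => nsq (P j x) * th x) (2 ^- j * x + 0)); last first.
    by apply/funext => x; rewrite uE addr0.
  by apply: rintegrableZ; exact: (rintegrable_affine 0 (j0 j) (pw j).1).
have Ij j : \int[mu]_x (u j x ^+ 2 * th (2 ^- j * x)) <=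
    S2 * (2 * pi) * \sum_(k <- level s j) nsq (a (j, k)) * om j ^+ 2.
  under eq_Rintegral => x _ do rewrite uE -[2 ^- j * x]addr0.
  rewrite (@RintZ _ _ (fun x => nsq (P j (2 ^- j * x + 0)) * th (2 ^- j * x + 0))); last first.
    exact: (rintegrable_affine 0 (j0 j) (pw j).1).
  have := (pw j).2; rewrite (Rint_affine 0 (j0 j) (pw j).1).
  set I := (\int[mu]_x _); rewrite -mulr_suml => h.
  have j1 : (2 ^+ j : R) != 0 by rewrite expf_neq0.
  have sE : dyadic_scale j ^+ 2 = 2 ^- j.
    by apply: (mulfI j1); rewrite dyadic_scale_sqr mulfV.
  rewrite exprMn sE.
  have := ler_wpM2l (sqr_ge0 (om j)) h.
  by clear h sE; move: (\sum_(i <- _) _) I (om j) (2 ^- j) => A J o y; lra.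
have iW : rintegrable W.
  by apply: rintegrableZ; apply: (@rintegrable_sum _ _ _ (fun (j : 'I_ _) x => u j x ^+ 2 * th (2 ^- j * x))).
have lf : L2 f by exact: (L2_le mf iW).
split=> //; apply: (le_trans (n2_le iW lf fW)).
rewrite RintZ; last by apply: (@rintegrable_sum _ _ _ (fun (j : 'I_ _) x => u j x ^+ 2 * th (2 ^- j * x))).
rewrite -[leRHS]mulrA; apply: ler_wpM2l => //.
rewrite (@Rint_sum _ _ _ (fun (j : 'I_ _) x => u j x ^+ 2 * th (2 ^- j * x)))//.
rewrite big_levels mulr_sumr; apply: ler_sum => j _; exact: Ij.
Qed.

Let single (V : nmodType) (J : eqType) (f : J -> V) (l : J) : \sum_(k <- [:: l]) f k = f l.
Proof. by rewrite big_cons big_nil addr0. Qed.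

Lemma L2_filtered_system l : L2 (filtered_system h1 h2 p q l).
Proof.
case: l => [k|l].
  have [+ _] := @low_part [:: k] (fun=> 1) isT.
  by congr L2; apply/funext => x; rewrite single mul1r.
have [+ _] := @high_part [:: l] (fun=> 1) isT.
by congr L2; apply/funext => x; rewrite single mul1r.
Qed.

Lemma filtered_system_synthesis :
  synthesis_bound (filtered_system h1 h2 p q) (level_weight d) (4 * pi * (S1 + T * S2) + 1).
Proof.
move=> a F; have uF := fset_uniq F.
have [lL bL] := low_part (fun k => a (inl k)) (lefts_uniq uF).
have [lH bH] := high_part (fun l => a (inr l)) (rights_uniq uF).
rewrite (_ : fin_comb _ a F = fun x =>
    \sum_(k <- lefts F) a (inl k) * filtered_system h1 h2 p q (inl k) x +
    \sum_(l <- rights F) a (inr l) * filtered_system h1 h2 p q (inr l) x); last first.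
  by apply/funext => x; rewrite /fin_comb big_split_sum.
apply: (le_trans (n2_sum2 lL lH)); rewrite big_split_sum.
rewrite (eq_bigr (fun k => nsq (a (inl k)))) => [|k _]; last by rewrite /= expr1n mulr1.
rewrite (eq_bigr (fun l => nsq (a (inr l)) * (2 `^ (- (l.1%:R * d))) ^+ 2)) => [|[j k] _//].
move: bL bH; set U := n2 _; set V := n2 _.
set A := \sum_(k <- _) _; set B := \sum_(k <- _) _ => hU hV.
have A0 : 0 <= A by apply: sumr_ge0 => k _; exact: nsq_ge0.
have B0 : 0 <= B by apply: sumr_ge0 => k _; rewrite mulr_ge0 ?nsq_ge0 ?sqr_ge0.
have p0 := pi_ge0 R.
have q1 : 0 <= pi * S1 * B by rewrite !mulr_ge0.
have q2 : 0 <= pi * (T * S2) * A by rewrite !mulr_ge0.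
have -> : (4 * pi * (S1 + T * S2) + 1) * (A + B) =
  2 * (S1 * (2 * pi * A)) + 2 * (T * (S2 * (2 * pi)) * B) + 4 * (pi * S1 * B) + 4 * (pi * (T * S2) * A) + (A + B).
  by clear; move: A B pi => a1 b1 z; ring.
move: hU hV q1 q2 A0 B0.
by move: A B U V (pi * S1 * B) (pi * (T * S2) * A) (S1 * _) (T * _ * _) => v1 v2 v3 v4 v5 v6 v7 v8; lra.
Qed.

End Wavelet_frame_synthesis.

(** * Periodic multipliers, biorthogonality and density *)

Section Periodic_multipliers.
Context {R : realType}.
Local Notation C := (complex R).
Local Notation mu := (@lebesgue_measure R).

Let pi1 : 0 < 2 * (pi : R). Proof. by rewrite mulr_gt0// pi_gt0. Qed.

Lemma L2_periodized (P : R -> C) (S : R) : cmeasurable P ->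
  (forall (x : R) m, \sum_(i < m) nsq (P (x + i%:R * (2 * pi))) <= S) -> L2 P.
Proof.
move=> mP PS; have [||i _] := @periodic_weight _ (fun=> 1) (fun x => nsq (P x)) (2 * pi) S pi1 (cmeas_cst 1)
  (measurable_nsq mP) (fun x => nsq_ge0 _) _ PS => //.
  rewrite (_ : (fun x => _) = cind period); first exact: (L2_indic measurable_period period_lty).
  by apply/funext => x; rewrite mulr1.
by apply: (L2_le mP i) => x; rewrite -nsqM mul1r.
Qed.

Lemma cmeas_modulation (k : int) : cmeasurable (fun x : R => expi (- (k%:~R * x)) : C).
Proof. by apply: cmeas_expi; apply: measurableT_comp => //; exact: mulrl_measurable. Qed.

Lemma modulation_periodic (k : int) (x : R) : expi (- (k%:~R * (x + 2 * pi))) = expi (- (k%:~R * x)) :> C.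
Proof. by rewrite mulrDr opprD expiD -[- (_ * (2 * pi))]mulNr -rmorphN/= expi_period_int mulr1. Qed.

(** A bounded periodic function is a limit, in the mean over a period, of trigonometric polynomials;
    multiplying by [P] preserves this because the periodization of [|P|^2] is bounded. *)
Lemma periodic_multiplier (r P : R -> C) (M S : R) (k : int) :
  cmeasurable r -> (forall x, nsq (r x) <= M) -> (forall x, r (x + 2 * pi) = r x) ->
  cmeasurable P -> (forall (x : R) m, \sum_(i < m) nsq (P (x + i%:R * (2 * pi))) <= S) ->
  L2 (fun x => expi (- (k%:~R * x)) * (r x * P x)) /\
  approx_by (fun (m : int) x => expi (- (m%:~R * x)) * P x) (fun x => expi (- (k%:~R * x)) * (r x * P x)).
Proof.
move=> mr rM rper mP PS; have lP := L2_periodized mP PS.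
have S0 : 0 <= S by have := PS 0 0%N; rewrite big_ord0.
have lE m (f : R -> C) : L2 f -> L2 (fun x => expi (- (m%:~R * x)) * f x).
  by move=> lf; apply: (@L2M _ _ _ 1) => //; [exact: cmeas_modulation|move=> x; rewrite nsq_expi].
have lrP : L2 (fun x => expi (- (k%:~R * x)) * (r x * P x)) by apply: lE; exact: (L2M mr rM lP).
split=> //; apply: approx_lim => // [m|eps e0]; first exact: lE.
have d0 : 0 < eps / (S + 1) by rewrite divr_gt0// ltr_wpDl.
pose r' x := expi (- (k%:~R * x)) * r x.
have mr' : cmeasurable r' by apply: cmeas_mul => //; exact: cmeas_modulation.
pose f x := cind period x * r' x.
have lf : L2 f.
  rewrite (_ : f = fun x => r' x * cind period x); last by apply/funext => x; rewrite /f mulrC.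
  apply: (@L2M _ _ _ M) => //; last exact: (L2_indic measurable_period period_lty).
  by move=> x; rewrite nsqM nsq_expi mul1r.
have [|s [a [us h]]] := trig_dense lf _ d0.
  by move=> t pt; rewrite /f cind_out// mul0r.
pose Q x := r' x - \sum_(m <- s) a m * expi (m%:~R * x).
have mQ : cmeasurable Q.
  apply: cmeas_sub => //; apply: cmeas_sum => m; apply: cmeas_mul; first exact: cmeas_cst.
  by apply: cmeas_expi; exact: mulrl_measurable.
have QE : (fun x => cind period x * Q x) = (fun x => f x - lcomb trig a s x).
  apply/funext => x; rewrite /Q mulrBr; congr (_ - _).
  by rewrite /lcomb mulr_sumr; apply: eq_bigr => m _; rewrite mulrCA.
have Qper x : Q (x + 2 * pi) = Q x.
  rewrite /Q /r' modulation_periodic rper; congr (_ - _); apply: eq_bigr => m _.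
  by rewrite mulrDr expiD expi_period_int mulr1.
have lQ : L2 (fun x => cind period x * Q x).
  by rewrite QE; apply: L2B => //; apply: L2_lcomb => m; exact: L2_trig.
have [iQ bQ] := periodic_weight pi1 mQ (measurable_nsq mP) (fun x => nsq_ge0 _) Qper PS lQ.
have lg m : L2 (fun x => a m * (expi (m%:~R * x) * P x)).
  by apply: L2Z; have := lE (- m) P lP; congr L2; apply/funext => x; rewrite rmorphN/= mulNr opprK.
exists (fun x => \sum_(m <- s) a m * (expi (m%:~R * x) * P x)); split.
- exact: L2_sum.
- apply: approx_sum => // [m|m]; first exact: lE.
  apply: approxZ => [l||]; [exact: lE| |].
    by have := lE (- m) P lP; congr L2; apply/funext => x; rewrite rmorphN/= mulNr opprK.
  have := @approx_atom _ _ (fun (m : int) x => expi (- (m%:~R * x)) * P x) (- m).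
  by congr approx_by; apply/funext => x; rewrite rmorphN/= mulNr opprK.
rewrite (_ : (fun x => _) = fun x => Q x * P x); last first.
  apply/funext => x; rewrite /Q mulrBl /r' mulrA mulr_suml; congr (_ - _).
  by apply: eq_bigr => m _; rewrite mulrA.
rewrite n2I; under eq_Rintegral => x _ do rewrite nsqM.
apply: (le_trans bQ); rewrite QE.
apply: (@le_trans _ _ ((S + 1) * (eps / (S + 1)))); last first.
  by rewrite mulrCA divff ?mulr1// gt_eqF// ltr_wpDl.
by apply: ler_pM; rewrite ?n2_ge0// lerDl.
Qed.

End Periodic_multipliers.

Section Orthogonal_expansion.
Context {R : realType} {I : choiceType}.
Local Notation C := (complex R).

(** Enlarging the index set can only improve the approximation by Fourier coefficients. *)
Lemma orth_expansion (e : I -> R -> C) (c : R) (f : R -> C) (eps : R) : 0 < c -> (forall l, L2 (e l)) ->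
  (forall l m, inner (e l) (e m) = if l == m then c%:C%C else 0) -> dense_span e -> L2 f -> 0 < eps ->
  exists F0 : {fset I}, forall F : {fset I}, (F0 `<=` F)%fset ->
    n2 (fun x => f x - fin_comb e (fcoef e c f) F x) <= eps.
Proof.
move=> c0 le orth de lf e0; have [F0 [a h]] := (dense_spanP le).1 de f lf eps e0.
exists F0 => F F0F; apply: (le_trans (fcoef_best c0 le orth (fun l => if l \in F0 then a l else 0) (fset_uniq F) lf)).
by move: h; rewrite (fin_comb_widen e a F0F).
Qed.

End Orthogonal_expansion.

Section Filtered_wavelet_systems.
Context {R : realType}.
Local Notation C := (complex R).
Local Notation mu := (@lebesgue_measure R).
Local Notation index := (int + nat * int)%type.

Variables (p q : R -> C).
Let base := filtered_system (fun=> 1) (fun=> 1) p q.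
Hypothesis lb : forall l, L2 (base l).
Hypothesis ob : forall l m, inner (base l) (base m) = if l == m then (2 * pi)%:C%C else 0.

Lemma filtered_systemE (h : R -> C) l x : filtered_system h h p q l x = h x * base l x.
Proof. by case: l => [k|[j k]] /=; rewrite mul1r mulrCA. Qed.

(** The product of the two filters is a bounded periodic multiplier, so that the filtered low-pass
    function stays in the closed span of the translates of [p], which is orthogonal to all wavelets.
    *)
Lemma low_high_orthogonal (h1 h2 k1 k2 : R -> C) (M S : R) (k : int) (l : nat * int) :
  cmeasurable h1 -> cmeasurable k2 -> cmeasurable p ->
  (forall x, nsq (h1 x * conjc (k2 x)) <= M) ->
  (forall x, h1 (x + 2 * pi) * conjc (k2 (x + 2 * pi)) = h1 x * conjc (k2 x)) ->
  (forall (x : R) m, \sum_(i < m) nsq (p (x + i%:R * (2 * pi))) <= S) ->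
  inner (filtered_system h1 h2 p q (inl k)) (filtered_system k1 k2 p q (inr l)) = 0.
Proof.
move=> mh mk mp rM rper pS.
have [lr ap] := periodic_multiplier k (cmeas_mul mh (cmeas_conj mk)) rM rper mp pS.
transitivity (inner (fun x => expi (- (k%:~R * x)) * (h1 x * conjc (k2 x) * p x)) (base (inr l))).
  rewrite !innerE; apply: eq_cint => x; case: l => j m; rewrite /base/= !mul1r !conjcM.
  by move: (expi _) (conjc _) (conjc (q _)) (conjc (k2 x)) (conjc (expi _)) => a b c d e; ring.
have bE m : (fun x => expi (- (m%:~R * x)) * p x) = base (inl m).
  by apply/funext => x; rewrite /= mul1r.
apply: (inner_approx0 _ lr (lb _) ap) => m; rewrite bE ?ob//; exact: lb.
Qed.

Variables (h1 h2 k1 k2 : R -> C).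
Hypotheses (hk1 : forall x, h1 x * conjc (k1 x) = 1) (hk2 : forall x, h2 x * conjc (k2 x) = 1).

(** Inside each of the two groups of indices the filters cancel out; across the groups
    [low_high_orthogonal] applies. *)
Lemma filtered_biorthogonal (M S : R) :
  cmeasurable h1 -> cmeasurable h2 -> cmeasurable k1 -> cmeasurable k2 -> cmeasurable p ->
  (forall l, L2 (filtered_system h1 h2 p q l)) -> (forall l, L2 (filtered_system k1 k2 p q l)) ->
  (forall x, nsq (h1 x * conjc (k2 x)) <= M) ->
  (forall x, h1 (x + 2 * pi) * conjc (k2 (x + 2 * pi)) = h1 x * conjc (k2 x)) ->
  (forall x, nsq (k1 x * conjc (h2 x)) <= M) ->
  (forall x, k1 (x + 2 * pi) * conjc (h2 (x + 2 * pi)) = k1 x * conjc (h2 x)) ->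
  (forall (x : R) m, \sum_(i < m) nsq (p (x + i%:R * (2 * pi))) <= S) ->
  forall l m, inner (filtered_system h1 h2 p q l) (filtered_system k1 k2 p q m)
    = if l == m then (2 * pi)%:C%C else 0.
Proof.
move=> mh1 mh2 mk1 mk2 mp lh lk b1 p1 b2 p2 pS [k|l] [m|m].
- rewrite -ob !innerE; apply: eq_cint => x; rewrite /base/= !mul1r !conjcM.
  rewrite -[X in _ = X]mul1r -(hk1 x).
  by move: (expi _) (conjc (p _)) (conjc (k1 x)) (conjc (expi _)) => a b c d; ring.
- exact: (@low_high_orthogonal h1 h2 k1 k2 M S k m mh1 mk2 mp b1 p1 pS).
- rewrite inner_conj//.
  by rewrite (@low_high_orthogonal k1 k2 h1 h2 M S m l mk1 mh2 mp b2 p2 pS) conjc0.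
- rewrite -ob !innerE; apply: eq_cint => x; case: l m => [j k] [j' k'].
  rewrite /base/= !mul1r !conjcM -[X in _ = X]mul1r -(hk2 x).
  by move: (expi _) (conjc _) (conjc (q _)) (conjc (k2 x)) (conjc (expi _)) => a b c d e; ring.
Qed.

Hypothesis db : dense_span base.

Let pi1 : 0 < 2 * (pi : R). Proof. by rewrite mulr_gt0// pi_gt0. Qed.

(** For [f] of bounded support, [f / h2] is square integrable, and its orthogonal expansion times
    [h2] tends to [f] in the mean on every bounded interval. The coefficients are also [<f, D_l> /
    (2 pi)] for the dual family [D], hence square summable with weights by [dual_bessel], and the
    synthesis bound makes the expansion times [h2] converge in norm. *)
Lemma dense_filtered_same (d B B' : R) : 0 < B -> 0 < B' ->
  cmeasurable h2 -> cmeasurable k2 ->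
  (forall l, L2 (filtered_system h2 h2 p q l)) -> (forall l, L2 (filtered_system k2 k2 p q l)) ->
  synthesis_bound (filtered_system h2 h2 p q) (level_weight d) B ->
  synthesis_bound (filtered_system k2 k2 p q) (fun l => (level_weight d l)^-1) B' ->
  (forall n : nat, exists M : R, forall x, window n x -> nsq (h2 x) <= M /\ nsq (k2 x) <= M) ->
  forall f, L2 f -> approx_by (filtered_system h2 h2 p q) f.
Proof.
move=> B0 B'0 mh mk lG lD sG sD loc f lf.
set G := filtered_system h2 h2 p q in lG sG *; set D := filtered_system k2 k2 p q in lD sD *.
have M0 n (x : R) : window n 0 by rewrite windowP normr0.
have loc0 n (h : R -> C) : cmeasurable h -> (exists M : R, forall x, window n x -> nsq (h x) <= M) ->
    exists M : R, [/\ 0 <= M, cmeasurable (fun x => cind (window n) x * h x) &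
      forall x, nsq (cind (window n) x * h x) <= M].
  move=> mh' [M hM]; exists `|M|; split=> // [|x].
    by apply: cmeas_mul => //; exact: (cmeas_cind (measurable_window n)).
  have [wx|wx] := pselect (window n x).
    by rewrite cind_in// mul1r (le_trans (hM x wx))// ler_norm.
  by rewrite cind_out// mul0r nsq0.
apply: approx_lim => // eps0' e00; pose n := 0%N.
have [n0 /(_ n0 (leqnn _)) hn0] := cvg_cut lf e00.
exists (cut n0 f); split => //; first exact: cut_L2.
move: (cut_L2 n0 lf); set f0 := cut n0 f => lf0 {eps0' e00 hn0 n} eps e0.
have [||Mk [Mk0 mMk hMk]] := loc0 n0 (fun x => conjc (k2 x)).
- exact: cmeas_conj.
- by have [M hM] := loc n0; exists M => x /hM[_]; rewrite nsq_conj.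
pose g x := conjc (k2 x) * f0 x.
have lg : L2 g.
  have := L2M mMk hMk lf; congr L2; apply/funext => x.
  by rewrite /g /f0 /cut mulrA [conjc _ * _]mulrC.
have hg x : h2 x * g x = f0 x by rewrite mulrA hk2 mul1r.
pose s := fcoef base (2 * pi) g.
have sE l : s l = (2 * pi)^-1%:C%C * inner f0 (D l).
  rewrite /s /fcoef; congr (_ * _); rewrite !innerE; apply: eq_cint => x.
  by rewrite /D filtered_systemE conjcM /g mulrA [f0 x * _]mulrC.
pose w l := nsq (s l) * level_weight d l ^+ 2.
have w0 l : 0 <= w l by rewrite mulr_ge0 ?nsq_ge0 ?sqr_ge0.
have wb (F : {fset index}) : \sum_(l <- F) w l <= (2 * pi)^-1 ^+ 2 * (B' * n2 f0).
  apply: le_trans (ler_wpM2l (sqr_ge0 _) (dual_bessel (fun l => level_weight_gt0 d l) B'0 lD sD F lf0)).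
  by rewrite mulr_sumr; apply: ler_sum => l _; rewrite /w sE nsqM nsq_real -mulrA.
have e10 : 0 < eps / 10 by rewrite divr_gt0.
have [F0 hF0] := bounded_sums_tail w0 wb (divr_gt0 e10 B0).
exists F0, s; set v := (fun x => _); have lv : L2 v by apply: L2B => //; exact: L2_fin_comb.
have [n1 /(_ n1 (leqnn _)) hn1] := cvg_cut lv e10.
have [|Mh [Mh0 mMh hMh]] := loc0 n1 h2 mh.
  by have [M hM] := loc n1; exists M => x /hM[].
have Mp : 0 < Mh + 1 by rewrite ltr_wpDl.
have [F1 hF1] := orth_expansion pi1 lb ob db lg (divr_gt0 e10 Mp).
pose F := (F0 `|` F1)%fset.
have FG : fin_comb G s F = fun x => h2 x * fin_comb base s F x.
  by apply/funext => x; rewrite /fin_comb mulr_sumr; apply: eq_bigr => l _; rewrite /G filtered_systemE mulrCA.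
have lbF : L2 (fun x => g x - fin_comb base s F x) by apply: L2B => //; exact: L2_fin_comb.
pose v1 x := cind (window n1) x * h2 x * (g x - fin_comb base s F x).
have lv1 : L2 v1 by exact: (L2M mMh hMh lbF).
have b1 : n2 v1 <= eps / 10.
  apply: (le_trans (n2M mMh hMh lbF)).
  apply: (@le_trans _ _ ((Mh + 1) * (eps / 10 / (Mh + 1)))); last first.
    by rewrite mulrCA divff ?mulr1// gt_eqF.
  by apply: ler_pM; rewrite ?n2_ge0// ?lerDl//; apply: hF1; exact: fsubsetUr.
pose v2 := fin_comb G s (F `\` F0)%fset.
have lv2 : L2 v2 by exact: L2_fin_comb.
have b2 : n2 v2 <= eps / 10.
  apply: (le_trans (sG _ _)); rewrite mulrC -ler_pdivlMr//; apply: hF0; exact: fsubsetUl.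
(* [v1] is the local error of the expansion over [F], and [v2] the difference of the expansions
   over [F] and [F0], which is small in norm whatever [F] is. *)
have cutv : cut n1 v = fun x => v1 x + cut n1 v2 x.
  apply/funext => x; rewrite /v1 /v2 -(fin_comb_diff G s (fsubsetUl F0 F1)) -/F /cut /v FG -hg.
  move: (cind _ x) (h2 x) (g x) (fin_comb base s F x) (fin_comb G s F0 x) => a b c e f1; ring.
have lc2 := cut_L2 n1 lv2; have b3 := n2_cut n1 lv2.
have b4 : n2 (cut n1 v) <= 2 * n2 v1 + 2 * n2 (cut n1 v2) by rewrite cutv; exact: n2_sum2.
have b5 : n2 v <= 2 * n2 (fun x => v x - cut n1 v x) + 2 * n2 (cut n1 v).
  rewrite {1}(_ : v = fun x => (v x - cut n1 v x) + cut n1 v x); last by apply/funext => x; rewrite subrK.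
  apply: n2_sum2; last exact: cut_L2.
  by apply: L2B => //; exact: cut_L2.
by move: hn1 b1 b2 b3 b4 b5; move: (n2 _) (n2 _) (n2 _) (n2 _) (n2 _) (n2 _) => x1 x2 x3 x4 x5 x6; lra.
Qed.

(** Replacing [h2] by [h1] on the low frequencies does not change the closed span, by
    [periodic_multiplier] with the multiplier [h2 / h1]. *)
Lemma dense_filtered (M S : R) :
  cmeasurable h1 -> cmeasurable h2 -> cmeasurable k1 -> cmeasurable p ->
  (forall l, L2 (filtered_system h1 h2 p q l)) -> (forall l, L2 (filtered_system h2 h2 p q l)) ->
  (forall f, L2 f -> approx_by (filtered_system h2 h2 p q) f) ->
  (forall x, nsq (h2 x * conjc (k1 x)) <= M) ->
  (forall x, h2 (x + 2 * pi) * conjc (k1 (x + 2 * pi)) = h2 x * conjc (k1 x)) ->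
  (forall (x : R) m, \sum_(i < m) nsq (h1 (x + i%:R * (2 * pi)) * p (x + i%:R * (2 * pi))) <= S) ->
  dense_span (filtered_system h1 h2 p q).
Proof.
move=> mh1 mh2 mk1 mp l12 l22 d22 b per hS.
apply/(dense_spanP l12) => f lf; apply: (approx_trans l12 l22 lf (d22 f lf)) => -[k|l]; last first.
  rewrite (_ : filtered_system h2 h2 p q (inr l) = filtered_system h1 h2 p q (inr l)); first exact: approx_atom.
  by case: l.
have [lr ap] := periodic_multiplier k (cmeas_mul mh2 (cmeas_conj mk1)) b per (cmeas_mul mh1 mp) hS.
have e : (fun x => expi (- (k%:~R * x)) * (h2 x * conjc (k1 x) * (h1 x * p x))) = filtered_system h2 h2 p q (inl k).
  apply/funext => x /=; congr (_ * _).
  transitivity (h2 x * (h1 x * conjc (k1 x)) * p x); last by rewrite hk1 mulr1.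
  by move: (h1 x) (h2 x) (conjc _) (p x) => y1 y2 y3 y4; ring.
rewrite e in lr ap.
apply: (approx_trans l12 _ lr ap) => m; first exact: (l12 (inl m)).
exact: (approx_atom (filtered_system h1 h2 p q) (inl m)).
Qed.

End Filtered_wavelet_systems.

(** * From frequency to time *)

Section Time_frequency_dictionary.
Context {R : realType}.
Local Notation C := (complex R).
Local Notation index := (int + nat * int)%type.
Variables (phi psi : R -> C).
Hypotheses (lphi : L12 phi) (lpsi : L12 psi).
Let base := filtered_system (fun=> 1) (fun=> 1) (fourier phi) (fourier psi).

Let two_pow (j : nat) : 0 < (2 ^+ j : R). Proof. exact: exprn_gt0. Qed.

Lemma L12_affine (f : R -> C) (a b : R) : 0 < a -> L12 f -> L12 (fun t => f (a * t - b)).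
Proof. by move=> a0 [i l]; split; [exact: cintegrable_affine|exact: L2_affine]. Qed.

Lemma L12Z (c : C) (f : R -> C) : L12 f -> L12 (fun t => c * f t).
Proof. by move=> [i l]; split; [exact: cintegrableZ|exact: L2Z]. Qed.

Lemma L12_dil (f : R -> C) j k : L12 f -> L12 (dil f j k).
Proof. by move=> lf; apply: L12Z; exact: L12_affine. Qed.

Lemma fourier_dil (f : R -> C) j (k : int) x : L12 f -> fourier (dil f j k) x =
  expi (- (2 ^- j * k%:~R * x)) * ((dyadic_scale j)%:C%C * fourier f (2 ^- j * x)).
Proof.
move=> lf; have [i _] := L12_affine k%:~R (two_pow j) lf.
rewrite /dil fourierZ// fourier_affine//; last by case: lf.
have -> : (dyadic_scale j)%:C%C = (2 `^ (j%:R / 2))%:C%C * (2 ^- j)%:C%C :> C.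
  by rewrite /dyadic_scale rmorphM.
by move: (fourier f _) (expi _) (2 ^- j)%:C%C (2 `^ _)%:C%C => F E c1 c2; ring.
Qed.

Lemma dil00 (f : R -> C) (k : int) : dil f 0 k = fun t => f (t - k%:~R).
Proof. by apply/funext => t; rewrite /dil mul0r powRr0 mul1r expr0 mul1r. Qed.

Lemma dyadic_scale0 : dyadic_scale 0 = 1 :> R.
Proof. by rewrite /dyadic_scale mul0r powRr0 expr0 divr1. Qed.

Lemma L2_fourier_wavelet l : L2_fourier (wavelet_system phi psi l) (base l).
Proof.
case: l => [k|[j k]] /=.
  rewrite -dil00 (_ : (fun x => _) = fourier (dil phi 0 k)).
    by apply: L2_fourier_L12; exact: L12_dil.
  by apply/funext => x; rewrite fourier_dil// dyadic_scale0 expr0 invr1 !mul1r.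
rewrite (_ : (fun x => _) = fourier (dil psi j k)).
  by apply: L2_fourier_L12; exact: L12_dil.
by apply/funext => x; rewrite fourier_dil// mul1r.
Qed.

Hypothesis onb : orthonormal_basis (wavelet_system phi psi).

Lemma base_orthogonal l m : inner (base l) (base m) = if l == m then (2 * pi)%:C%C else 0.
Proof.
rewrite (parseval (L2_fourier_wavelet l) (L2_fourier_wavelet m)).
by have [_ -> _] := onb; case: (l == m); rewrite ?mulr1 ?mulr0.
Qed.

Lemma base_dense : dense_span base.
Proof.
have lb l : L2 (base l) by exact: L2_fourier_L2r (L2_fourier_wavelet l).
have [lw _ dw] := onb; have p0 : 0 < 2 * (pi : R) by rewrite mulr_gt0// pi_gt0.
apply/(dense_spanP lb) => g lg eps e0; have [f fg] := L2_fourier_surj lg.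
have [F [a h]] := (dense_spanP lw).1 dw f (L2_fourier_L2l fg) _ (divr_gt0 e0 p0).
exists F, a.
have FE : L2_fourier (fin_comb (wavelet_system phi psi) a F) (fin_comb base a F).
  by apply: L2_fourier_sum => l; apply: L2_fourierZ; exact: L2_fourier_wavelet.
by rewrite (L2_fourier_isometry (L2_fourierB fg FE)) mulrC -ler_pdivlMr.
Qed.

(** The Fourier transform being onto, the representative chosen in [inv_fourier] is a genuine
    preimage. *)
Lemma inv_fourierP (g : R -> C) : L2 g -> L2_fourier (inv_fourier g) g.
Proof. by move=> lg; apply: (@xgetPex _ _ [set f | L2_fourier f g]); exact: L2_fourier_surj. Qed.

Lemma L2norm_shift (f g : R -> C) (a : R) : L2_fourier f g -> L2norm (fun t => f (t - a)) = L2norm f.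
Proof.
move=> fg; have fg' := L2_fourier_shift a fg.
rewrite !L2normE; [|exact: L2_fourier_L2l fg|exact: L2_fourier_L2l fg'].
congr Num.sqrt; rewrite (n2_affine (- a) (@ltr01 R) (L2_fourier_L2l fg)) mul1r; congr n2.
by apply/funext => t; rewrite mul1r.
Qed.

Variables (h1 h2 : R -> C).
Hypothesis lh : forall l, L2 (filtered_system h1 h2 (fourier phi) (fourier psi) l).

(** The functions [translates] before normalization. *)
Definition filtered_translates (l : index) : R -> C :=
  match l with
  | inl k => fun t => filtered h1 phi 0 0 (t - k%:~R)
  | inr (j, k) => fun t => filtered h2 psi j 0 (t - 2 ^- j * k%:~R)
  end.

Let filtered_low : L2_fourier (filtered h1 phi 0 0) (fun x => h1 x * fourier phi x).
Proof.
have e : (fun x => h1 x * fourier phi x) = filtered_system h1 h2 (fourier phi) (fourier psi) (inl 0).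
  by apply/funext => x /=; rewrite mul0r oppr0 expi0 mul1r.
rewrite /filtered (_ : (fun x => h1 x * fourier (dil phi 0 0) x) = (fun x => h1 x * fourier phi x)).
  by apply: inv_fourierP; rewrite e.
apply/funext => x; rewrite fourier_dil// dyadic_scale0 expr0 invr1 !mul1r.
by rewrite mul0r oppr0 expi0 mul1r.
Qed.

Let filtered_high j : L2_fourier (filtered h2 psi j 0)
  (fun x => h2 x * ((dyadic_scale j)%:C%C * fourier psi (2 ^- j * x))).
Proof.
have e : (fun x => h2 x * ((dyadic_scale j)%:C%C * fourier psi (2 ^- j * x)))
    = filtered_system h1 h2 (fourier phi) (fourier psi) (inr (j, 0)).
  by apply/funext => x /=; rewrite mulr0 mul0r oppr0 expi0 mul1r.
rewrite /filtered (_ : (fun x => h2 x * fourier (dil psi j 0) x) =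
    (fun x => h2 x * ((dyadic_scale j)%:C%C * fourier psi (2 ^- j * x)))).
  by apply: inv_fourierP; rewrite e.
by apply/funext => x; rewrite fourier_dil// mulr0 mul0r oppr0 expi0 mul1r.
Qed.

Lemma L2_fourier_filtered_translates l :
  L2_fourier (filtered_translates l) (filtered_system h1 h2 (fourier phi) (fourier psi) l).
Proof.
case: l => [k|[j k]]; first exact: (L2_fourier_shift k%:~R filtered_low).
exact: (L2_fourier_shift (2 ^- j * k%:~R) (filtered_high j)).
Qed.

Lemma translates_atomE l : translates (atom h1 phi 0) (atom h2 psi) l =
  fun t => (L2norm (filtered_translates l))^-1%:C%C * filtered_translates l t.
Proof.
case: l => [k|[j k]]; apply/funext => t /=; rewrite /atom /normalized; congr ((_^-1)%:C%C * _).
  by rewrite (L2norm_shift _ filtered_low).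
by rewrite (L2norm_shift _ (filtered_high j)).
Qed.

End Time_frequency_dictionary.

Section Riesz_bases_of_filtered_wavelets.
Context {R : realType}.
Local Notation C := (complex R).
Variables (phi psi h1 h2 k1 k2 : R -> C) (d : R) (th : R -> R) (S S2 T M : R).
Let p := fourier phi.
Let q := fourier psi.

(** Filters [h] and [k] with [h conjc k = 1] play symmetric roles, so that this single statement
    yields both families. The families filtered by [h2] alone, at all frequencies, enter through
    [dense_filtered_same]. *)
Theorem riesz_basis_filtered :
  L12 phi -> L12 psi -> orthonormal_basis (wavelet_system phi psi) ->
  (forall x, h1 x * conjc (k1 x) = 1) -> (forall x, h2 x * conjc (k2 x) = 1) ->
  dominated h1 h2 p q d th S S2 T -> dominated k1 k2 p q (- d) th S S2 T ->
  dominated h2 h2 p q d th S S2 T -> dominated k2 k2 p q (- d) th S S2 T ->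
  (forall (x : R) m, \sum_(i < m) nsq (p (x + i%:R * (2 * pi))) <= S) ->
  (forall x, nsq (h1 x * conjc (k2 x)) <= M) ->
  (forall x, h1 (x + 2 * pi) * conjc (k2 (x + 2 * pi)) = h1 x * conjc (k2 x)) ->
  (forall x, nsq (k1 x * conjc (h2 x)) <= M) ->
  (forall x, k1 (x + 2 * pi) * conjc (h2 (x + 2 * pi)) = k1 x * conjc (h2 x)) ->
  (forall n : nat, exists M : R, forall x, window n x -> nsq (h2 x) <= M /\ nsq (k2 x) <= M) ->
  riesz_basis (translates (atom h1 phi 0) (atom h2 psi)).
Proof.
move=> lphi lpsi onb hk1 hk2 dh dk dh2 dk2 pS b1 p1 b2 p2 loc.
pose B := 4 * pi * (S + T * S2) + 1.
have S0 : 0 <= S by have := pS 0 0%N; rewrite big_ord0.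
have S20 : 0 <= S2 by have := dom_periods dh 0 0%N; rewrite big_ord0.
have T0 : 0 <= T by have := dom_scales dh 0 0%N; rewrite big_ord0.
have B0 : 0 < B by rewrite /B ltr_wpDl// mulr_ge0 ?addr_ge0 ?mulr_ge0// pi_ge0.
have lG := L2_filtered_system dh; have lD := L2_filtered_system dk.
have sD k : dominated k k2 p q (- d) th S S2 T ->
    synthesis_bound (filtered_system k k2 p q) (fun l => (level_weight d l)^-1) B.
  move=> /filtered_system_synthesis; congr synthesis_bound; apply/funext => -[n|[j n]] /=.
    by rewrite invr1.
  by rewrite -powRN mulrN.
have lb l := L2_fourier_L2r (L2_fourier_wavelet lphi lpsi l).
have ob := base_orthogonal lphi lpsi onb.
have db := base_dense lphi lpsi onb.
have mp := dom_p dh; have mh1 := dom_h1 dh; have mh2 := dom_h2 dh.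
have mk1 := dom_h1 dk; have mk2 := dom_h2 dk.
have bi := filtered_biorthogonal lb ob hk1 hk2 mh1 mh2 mk1 mk2 mp lG lD b1 p1 b2 p2 pS.
have same := dense_filtered_same lb ob hk2 db B0 B0 mh2 mk2 (L2_filtered_system dh2)
  (L2_filtered_system dk2) (filtered_system_synthesis dh2) (sD _ dk2) loc.
have r1 x : nsq (h2 x * conjc (k1 x)) <= M.
  by have := b2 x; rewrite !nsqM !nsq_conj mulrC.
have r2 x : h2 (x + 2 * pi) * conjc (k1 (x + 2 * pi)) = h2 x * conjc (k1 x).
  have := congr1 (@conjc R) (p2 x); rewrite !conjcM !conjcK.
  by rewrite mulrC => ->; rewrite mulrC.
have dG := dense_filtered hk1 mh1 mh2 mk1 mp lG (L2_filtered_system dh2) same r1 r2 (dom_low dh).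
have pi2 : 0 < 2 * (pi : R) by rewrite mulr_gt0// pi_gt0.
exact: (riesz_of_dual_systems (fun l => level_weight_gt0 d l) B0 B0 lG lD
  (filtered_system_synthesis dh) (sD _ dk) pi2 bi
  (L2_fourier_filtered_translates lphi lpsi lG) (translates_atomE lphi lpsi lG) dG erefl).
Qed.

End Riesz_bases_of_filtered_wavelets.

(** * Periodization of decaying functions *)

Section Power_weights.
Context {R : realType}.
Local Notation mu := (@lebesgue_measure R).

Let base_gt0 (x : R) : 0 < 1 + `|x|. Proof. by rewrite ltr_wpDr. Qed.

Lemma powR_decay_cvg0 (c : R) : 0 < c -> (1 + x) `^ (- c) @[x --> +oo] --> (0 : R).
Proof.
move=> c0; apply/cvgrPdist_le => e e0; near=> x.
have y0 : 0 < e `^ (- c^-1) by exact: powR_gt0.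
have xy : e `^ (- c^-1) <= 1 + x.
  by apply: (@le_trans _ _ x); [near: x; exact: nbhs_pinfty_ge|rewrite lerDr].
rewrite sub0r normrN ger0_norm ?powR_ge0// powRN.
rewrite -[leRHS]invrK lef_pV2 ?posrE ?invr_gt0//; last by rewrite powR_gt0// (lt_le_trans y0).
have := ge0_ler_powR (ltW c0) (_ : e `^ (- c^-1) \in Num.nneg) (_ : 1 + x \in Num.nneg) xy.
rewrite -powRrM mulNr mulVf ?gt_eqF// powR_inv1 ?(ltW e0)//; apply.
  by rewrite nnegrE powR_ge0.
by rewrite nnegrE (le_trans _ xy)// powR_ge0.
Unshelve. all: by end_near. Qed.

Lemma rintegrable_power_decay (c : R) : 0 < c -> rintegrable (fun x : R => (1 + `|x|) `^ (- (1 + c))).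
Proof.
move=> c0.
have d1 (a x : R) : -1 < x -> is_derive x 1 (fun x => (1 + x) `^ a) (a * (1 + x) `^ (a - 1)).
  move=> x1; have x0 : 0 < 1 + x by rewrite -ltrBlDl sub0r.
  have g1 : is_derive x 1 (fun x : R => 1 + x) 1 by apply: is_derive_eq; rewrite ?add0r ?addr0 ?mulr1 ?scaler1 ?scale1r.
  by have := is_derive1_comp (is_derive1_powR a x0) g1; rewrite mulr1.
have cf : continuous (fun x : R => (1 + `|x|) `^ (- (1 + c))).
  move=> x; apply: (@continuous_comp _ _ _ (fun x : R => `|x|) (fun x => (1 + x) `^ (- (1 + c)))).
    exact: norm_continuous.
  apply: differentiable_continuous; apply/derivable1_diffP.
  by have [] := d1 (- (1 + c)) `|x| (lt_le_trans (ltrN10 _) (normr_ge0 _)).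
apply: ge0_rintegrable => [|x|]; [exact: continuous_measurable_fun|exact: powR_ge0|].
rewrite ge0_symfun_integralT; last 3 first.
- by move=> x; exact: powR_ge0.
- exact: cf.
- by move=> x /=; rewrite normrN.
rewrite -set_itvcy.
have Fc : (- c^-1 * (1 + x) `^ (- c)) @[x --> +oo] --> (0 : R).
  by rewrite -[X in _ --> X](mulr0 (- c^-1)); apply: cvgM; [exact: cvg_cst|exact: powR_decay_cvg0].
have dF (x : R) : -1 < x -> is_derive x 1 (fun x => - c^-1 * (1 + x) `^ (- c)) ((1 + x) `^ (- (1 + c))).
  move=> x1; have H := is_deriveZ (- c^-1) (d1 (- c) x x1).
  apply: is_derive_eq H _; rewrite -[_ *: _]/(_ * _) mulrA mulNr mulrN opprK mulVf ?gt_eqF// mul1r.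
  by congr (_ `^ _); rewrite opprD addrC.
have cF0 : (fun x : R => - c^-1 * (1 + x) `^ (- c)) x @[x --> (0 : R)] --> - c^-1 * (1 + 0) `^ (- c).
  apply: (@differentiable_continuous _ _ _ (0 : R) (fun x : R => - c^-1 * (1 + x) `^ (- c))).
  by apply/derivable1_diffP; have [] := dF 0 (ltrN10 _).
rewrite (ge0_continuous_FTC2y _ _ Fc)//=; first by rewrite -EFinD -EFinM ltry.
- exact: continuous_subspaceT.
- move=> x x0; by have [] := dF x (lt_trans (ltrN10 _) x0).
- by apply: cvg_at_right_filter.
- move=> x; rewrite in_itv/= andbT => x0; rewrite derive1E gtr0_norm//.
  by have [_ ->] := dF x (lt_trans (ltrN10 _) x0).
Qed.

(** Each value of [w] is at most a constant times the mean of [w] over the period that follows, and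
    these periods are disjoint. *)
Lemma periodization_bound (w : R -> R) (P c : R) : 0 < P -> 0 <= c -> rintegrable w -> (forall x, 0 <= w x) ->
  (forall x t, 0 <= t <= P -> w x <= c * w (x + t)) ->
  forall (x : R) m, \sum_(i < m) w (x + i%:R * P) <= c / P * \int[mu]_x w x.
Proof.
move=> P0 c0 iw w0 wc x m; have mw := rintegrable_meas iw.
have mcw : measurable_fun setT (fun x => (c * w x)%:E).
  by apply/measurable_EFinP; exact: measurable_funM.
have cw0 y : (0%R <= (c * w y)%:E)%E by rewrite lee_fin mulr_ge0.
rewrite mulrAC -RintZ// ler_pdivlMr//.
rewrite -lee_fin EFin_Rint; last exact: rintegrableZ.
apply: (@le_trans _ _ (\int[mu]_(y in `[x, (x + m%:R * P)%R[) (c * w y)%:E)%E); last first.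
  by apply: ge0_subset_integral => //; exact: measurable_itv.
rewrite (ge0_integral_periods _ _ (ltW P0) mcw cw0).
have -> : ((\sum_(i < m) w (x + i%:R * P)) * P)%:E =
    (\int[mu]_(t in `[0%R, P[) (\sum_(i < m) w (x + i%:R * P))%:E)%E.
  have muP : mu `[0%R, P[ = P%:E by rewrite lebesgue_measure_itv/= lte_fin P0 oppr0 adde0.
  rewrite integral_cst; last exact: measurable_itv.
  by rewrite EFinM; congr (_ * _)%E; exact: esym muP.
apply: ge0_le_integral; first exact: measurable_itv.
- by move=> t _; rewrite lee_fin sumr_ge0.
- by apply: measurable_funTS; exact: measurable_cst.
- apply: measurable_funTS; apply: emeasurable_sum => i.
  by apply: (measurableT_comp mcw); exact: measurable_funD.
move=> t; rewrite /= in_itv/= => /andP[t0 tP]; rewrite sumEFin lee_fin; apply: ler_sum => i _.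
by rewrite [t + _]addrC; apply: wc; rewrite t0 ltW.
Qed.

Lemma power_decay_periodization (c P : R) : 0 < c -> 0 < P ->
  exists2 B : R, 0 <= B & forall (x : R) m, \sum_(i < m) (1 + `|x + i%:R * P|) `^ (- (1 + c)) <= B.
Proof.
move=> c0 P0; pose w (x : R) := (1 + `|x|) `^ (- (1 + c)).
have iw : rintegrable w by exact: rintegrable_power_decay.
have w0 x : 0 <= w x by exact: powR_ge0.
have c1 : 0 <= 1 + c by rewrite addr_ge0// ltW.
have P1 : 0 < 1 + P by rewrite addr_gt0.
exists ((1 + P) `^ (1 + c) / P * \int[mu]_x w x).
  by rewrite mulr_ge0 ?divr_ge0 ?powR_ge0 ?Rint_ge0// ltW.
apply: (periodization_bound P0 (powR_ge0 _ _) iw w0) => x t /andP[t0 tP].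
rewrite /w !powRN ler_pdivlMr ?powR_gt0// mulrC ler_pdivrMr ?powR_gt0//.
rewrite -powRM ?(ltW P1)// ?(ltW (base_gt0 _))//.
apply: ge0_ler_powR => //; rewrite ?nnegrE ?mulr_ge0 ?(ltW P1) ?(ltW (base_gt0 _))//.
have := ler_normD x t; rewrite (ger0_norm t0) => h; rewrite mulrDl mul1r mulrDr mulr1.
have : 0 <= P * `|x| by rewrite mulr_ge0// ltW.
by move: h; move: `|x| `|x + t| (P * _) => u v z; lra.
Qed.

End Power_weights.

Section Bump.
Context {R : realType}.
Local Notation mu := (@lebesgue_measure R).

(** A smooth function comparable to [min (y^2) (y^-2)]. *)
Definition bump (y : R) : R := y ^+ 2 / (1 + y ^+ 2) ^+ 2.

Let den (y : R) : 0 < 1 + y ^+ 2. Proof. by rewrite ltr_wpDr// sqr_ge0. Qed.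

Lemma bump_ge0 y : 0 <= bump y.
Proof. by rewrite /bump divr_ge0// ?sqr_ge0// exprn_ge0// ltW. Qed.

Lemma continuous_bump : continuous bump.
Proof.
move=> y; have c2 : continuous (fun x : R => x ^+ 2) by move=> x; exact: exprn_continuous.
apply: cvgM; first exact: c2.
apply: cvgV; first by rewrite expf_neq0// gt_eqF.
apply: (@continuous_comp _ _ _ (fun x : R => 1 + x ^+ 2) (fun x => x ^+ 2)); last exact: c2.
by apply: cvgD; [exact: cvg_cst|exact: c2].
Qed.

(** [bump y] is at most a constant times the increment of [y^2 / (1 + y^2)] from [y / 2] to [y], so
    that the sum over scales telescopes. *)
Lemma bump_scales (x : R) m : \sum_(j < m) bump (2 ^- j * x) <= 4 / 3.
Proof.
pose F (y : R) := 4 / 3 * (y ^+ 2 / (1 + y ^+ 2)).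
have F0 y : 0 <= F y by rewrite /F mulr_ge0// divr_ge0// ?sqr_ge0// ltW.
have F1 y : F y <= 4 / 3.
  rewrite /F -[leRHS]mulr1; apply: ler_wpM2l => //.
  by rewrite ler_pdivrMr// mul1r lerDr.
have step y : bump y <= F y - F (2^-1 * y).
  have d2 : 0 < 4 + y ^+ 2 by rewrite ltr_wpDr// sqr_ge0.
  have -> : F y - F (2^-1 * y) = 4 * y ^+ 2 / ((1 + y ^+ 2) * (4 + y ^+ 2)).
    rewrite /F exprMn; move: (den y) d2; rewrite (_ : 2^-1 ^+ 2 = 4^-1 :> R); last by field.
    have : 0 < 1 + 4^-1 * y ^+ 2 by rewrite ltr_wpDr// mulr_ge0// sqr_ge0.
    move: (y ^+ 2) => z a b e; field.
    by rewrite !gt_eqF//; lra.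
  rewrite /bump ler_pdivrMr ?exprn_gt0// mulrAC ler_pdivlMr ?mulr_gt0//.
  have := sqr_ge0 y; have := den y; move: (y ^+ 2) => z a b; nra.
suff : \sum_(j < m) bump (2 ^- j * x) <= F x - F (2 ^- m * x).
  by move/le_trans; apply; rewrite lerBlDr (le_trans (F1 x))// lerDl.
elim: m => [|m IH]; first by rewrite big_ord0 expr0 invr1 mul1r subrr.
rewrite big_ord_recr/=; have := step (2 ^- m * x); rewrite mulrA -invfM -exprS => h.
by move: IH h; move: (\sum_(_ < _) _) (F x) (F _) (F _) (bump _) => u v w z t; lra.
Qed.

(** [bump] is dominated by the Poisson kernel, to which [periodization_bound] applies. *)
Lemma bump_periodization (P : R) : 0 < P ->
  exists2 B : R, 0 <= B & forall (x : R) m, \sum_(i < m) bump (x + i%:R * P) <= B.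
Proof.
move=> P0; pose w := poisson 1 : R -> R.
have [iw _] := @integral_poisson1 R.
have w0 x : 0 <= w x by exact: poisson_ge0.
have wE x : w x = 2 / (1 + x ^+ 2) by rewrite /w /poisson expr1n mulr1.
have c0 : 0 <= 2 + 2 * P ^+ 2 by rewrite addr_ge0// mulr_ge0// sqr_ge0.
have key (x t : R) : 0 <= t <= P -> w x <= (2 + 2 * P ^+ 2) * w (x + t).
  move=> /andP[t0 tP]; rewrite !wE mulrA ler_pdivrMr// mulrAC ler_pdivlMr//.
  have tP2 : t ^+ 2 <= P ^+ 2 by apply: lerXn2r; rewrite ?nnegrE// ltW.
  have h : (x + t) ^+ 2 <= 2 * x ^+ 2 + 2 * t ^+ 2.
    by rewrite -subr_ge0 (_ : _ - _ = (x - t) ^+ 2) ?sqr_ge0//; ring.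
  have xP : 0 <= P ^+ 2 * x ^+ 2 by rewrite mulr_ge0 ?sqr_ge0.
  by move: h tP2 xP (sqr_ge0 x); move: (P ^+ 2) (t ^+ 2) (x ^+ 2) (_ ^+ 2) => a b c e; nra.
have b := periodization_bound P0 c0 iw w0 key.
exists ((2 + 2 * P ^+ 2) / P * \int[mu]_x w x).
  by rewrite mulr_ge0 ?Rint_ge0// divr_ge0// ltW.
move=> x m; apply: le_trans (b x m); apply: ler_sum => i _.
move: (x + _) => y; rewrite -[leRHS]/(w y) wE /bump ler_pdivrMr ?exprn_gt0// mulrAC ler_pdivlMr//.
have := sqr_ge0 y; move: (y ^+ 2) => z z0; nra.
Qed.

Lemma bump_small (y : R) : `|y| <= 1 -> y ^+ 2 <= 4 * bump y.
Proof.
move=> y1; rewrite /bump mulrA ler_pdivlMr ?exprn_gt0//.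
have : y ^+ 2 <= 1 by rewrite -real_normK ?num_real// exprn_ile1.
have := sqr_ge0 y; move: (y ^+ 2) => z z0 z1; nra.
Qed.

Lemma bump_large (y : R) : 1 <= `|y| -> (y ^+ 2)^-1 <= 4 * bump y.
Proof.
move=> y1; have y2 : 1 <= y ^+ 2 by rewrite -real_normK ?num_real// exprn_ege1.
have y0 : 0 < y ^+ 2 by exact: lt_le_trans y2.
rewrite /bump mulrA ler_pdivlMr ?exprn_gt0// mulrC ler_pdivrMr//.
by move: y2; move: (y ^+ 2) => z z1; nra.
Qed.

End Bump.

(** * Decay and vanishing moments *)

Section Decay_and_moments.
Context {R : realType}.
Local Notation C := (complex R).
Local Notation mu := (@lebesgue_measure R).
Implicit Types (f : R -> C) (N : nat).

(** The exponent in the decay hypothesis leaves an integrable function after [N] moments have been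
    taken out. *)
Lemma decay_weight (N : nat) (t : R) :
  (1 + `|t| ^+ N) * (1 + t ^+ 2) `^ (- (N%:R / 2) - 1) <= poisson 1 t.
Proof.
have t1 : 1 <= 1 + t ^+ 2 by rewrite lerDl sqr_ge0.
have t0 : 0 < 1 + t ^+ 2 by exact: lt_le_trans t1.
have N0 : 0 <= N%:R / 2 :> R by rewrite divr_ge0.
pose X := (1 + t ^+ 2) `^ (N%:R / 2).
have X0 : 0 < X by exact: powR_gt0.
have X1 : 1 <= X by rewrite -(powRr0 (1 + t ^+ 2)); exact: ler_powR.
have XN : `|t| ^+ N <= X.
  rewrite -(powR_mulrn N (normr_ge0 t)) -{1}(divfK (_ : 2 != 0 :> R) N%:R)// mulrC powRrM.
  rewrite powR_mulrn// real_normK ?num_real//.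
  by apply: ge0_ler_powR; rewrite ?nnegrE ?sqr_ge0// ?(ltW t0)// lerDr.
rewrite powRD; last by apply/implyP => _; rewrite gt_eqF.
rewrite powRN powR_inv1 ?(ltW t0)// -/X /poisson expr1n mulr1 mulrA.
apply: ler_wpM2r; first by rewrite invr_ge0 ltW.
by rewrite ler_pdivrMr//; move: XN X1; move: (_ ^+ N) => u; lra.
Qed.

(** Far out the decay applies; on a bounded interval [normc f] is at most [1 + |f|^2]. *)
Lemma decay_rintegrable N f : L2 f ->
  bigO_infty f (fun t : R => (1 + t ^+ 2) `^ (- (N%:R / 2) - 1)) ->
  rintegrable (fun t => (1 + `|t| ^+ N) * normc (f t)).
Proof.
move=> lf [M [A hA]]; have mf := L2_meas lf.
have [n nA] : exists n : nat, A <= n%:R.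
  by exists (Num.truncn `|A|).+1; rewrite (le_trans (ler_norm A))// ltW// truncnS_gt.
pose K : R := 1 + n%:R ^+ N; have K0 : 0 <= K by rewrite addr_ge0// exprn_ge0.
apply: (@rintegrable_le _ _ (fun t => K * (\1_(window n) t + nsq (f t)) + `|M| * poisson 1 t)).
- apply: measurable_funM; last exact: measurable_normc.
  apply: measurable_funD => //; exact: measurable_funX.
- move=> t; have p0 := @poisson_ge0 _ 1 t ltr01; have f0 := normc_ge0 (f t).
  have t0 : 0 <= 1 + `|t| ^+ N by rewrite addr_ge0// exprn_ge0.
  rewrite ger0_norm ?mulr_ge0//; have [wt|wt] := pselect (window n t).
    rewrite indicE mem_set//=; apply: ler_wpDr; first by rewrite mulr_ge0.
    apply: ler_pM => //.
      by rewrite lerD2l; apply: lerXn2r; rewrite ?nnegrE//; exact/windowP.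
    by rewrite -normc_sqr; have := sqr_ge0 (normc (f t) - 1); move: (normc _) f0 => y; nra.
  rewrite indicE memNset//= add0r; apply: ler_wpDl; first by rewrite mulr_ge0 ?nsq_ge0.
  have nt : A <= `|t|.
    by apply: (le_trans nA); rewrite ltW// ltNge; apply/negP => h; apply: wt; exact/windowP.
  apply: (@le_trans _ _ (`|M| * ((1 + `|t| ^+ N) * (1 + t ^+ 2) `^ (- (N%:R / 2) - 1)))); last first.
    by apply: ler_wpM2l => //; exact: decay_weight.
  rewrite mulrCA; apply: ler_wpM2l => //; apply: (le_trans (hA t nt)).
  by apply: ler_wpM2r; [exact: powR_ge0|exact: ler_norm].
apply: rintegrableD; last by apply: rintegrableZ; have [] := @integral_poisson1 R.
apply: rintegrableZ; apply: rintegrableD; last exact: L2_int.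
by apply: rintegrable_indic; [exact: measurable_window|exact: window_lty].
Qed.

Lemma power_le_1D (N i : nat) (t : R) : (i <= N)%N -> `|t| ^+ i <= 1 + `|t| ^+ N.
Proof.
move=> iN; have [t1|t1] := leP `|t| 1.
  by apply: (@le_trans _ _ 1); [exact: exprn_ile1|rewrite lerDl exprn_ge0].
by apply: ler_wpDl => //; rewrite ler_eXn2l.
Qed.

Lemma L12_of_decay N f : L2 f ->
  bigO_infty f (fun t : R => (1 + t ^+ 2) `^ (- (N%:R / 2) - 1)) -> L12 f.
Proof.
move=> lf /(decay_rintegrable lf) i; split=> //.
apply: (cintegrable_le (L2_meas lf) _ i) => t.
by rewrite -[leLHS]mul1r; apply: ler_wpM2r; [exact: normc_ge0|rewrite lerDl exprn_ge0].
Qed.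

(** Subtracting from the exponential its Taylor polynomial of degree [N - 1] does not change
    [fourier f y], by the vanishing of the moments, and leaves a kernel of size [|y t|^N]. *)
Lemma fourier_vanishing N f : cmeasurable f ->
  rintegrable (fun t => (1 + `|t| ^+ N) * normc (f t)) ->
  (forall nu : nat, (nu < N)%N -> cint setT (fun t : R => (t ^+ nu)%:C%C * f t) = 0) ->
  exists2 K : R, 0 <= K & forall y, normc (fourier f y) <= K * `|y| ^+ N.
Proof.
move=> mf iN mom; set I := \int[mu]_t ((1 + `|t| ^+ N) * normc (f t)).
have I0 : 0 <= I by apply: Rint_ge0 => t; rewrite mulr_ge0 ?normc_ge0// addr_ge0// exprn_ge0.
exists (4 * I) => [|y]; first by rewrite mulr_ge0.
have [pc [ps [sc ss bc bs]]] := @taylor_cos_sin R N.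
have mpow i : measurable_fun setT (fun t : R => t ^+ i) by exact: exprn_measurable.
have cif : cintegrable f.
  apply: (cintegrable_le mf _ iN) => t; rewrite -[leLHS]mul1r.
  by apply: ler_wpM2r; [exact: normc_ge0|rewrite lerDl exprn_ge0].
have cim (i : 'I_N) : cintegrable (fun t : R => (t ^+ i)%:C%C * f t).
  apply: (cintegrable_le (cmeas_mul (cmeas_real (mpow i)) mf) _ iN) => t.
  rewrite normcM normc_real normrX; apply: ler_wpM2r; first exact: normc_ge0.
  exact: power_le_1D (ltnW (ltn_ord i)).
pose cc (i : nat) : C := Complex (pc`_i * (- y) ^+ i) (ps`_i * (- y) ^+ i).
have pE (p : {poly R}) t : (size p <= N)%N -> p.[- (y * t)] = \sum_(i < N) p`_i * (- y) ^+ i * t ^+ i.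
  by move=> sp; rewrite (horner_coef_wide _ sp); apply: eq_bigr => i _; rewrite -mulNr exprMn mulrA.
have TE t : Complex pc.[- (y * t)] ps.[- (y * t)] * f t = \sum_(i < N) cc i * ((t ^+ i)%:C%C * f t).
  rewrite (_ : Complex _ _ = \sum_(i < N) cc i * (t ^+ i)%:C%C).
    by rewrite mulr_suml; apply: eq_bigr => i _; rewrite mulrA.
  rewrite !pE//; apply: eq_ReIm => /=.
    by rewrite Re_sum; apply: eq_bigr => i _; rewrite [cc i * _]mulrC ReM_real mulrC.
  rewrite (big_morph _ (@ImD R) (erefl : complex.Im (0 : C) = 0)).
  by apply: eq_bigr => i _; rewrite [cc i * _]mulrC ImM_real mulrC.
have ciT : cintegrable (fun t => Complex pc.[- (y * t)] ps.[- (y * t)] * f t).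
  rewrite (_ : (fun t => _) = fun t => \sum_(i < N) cc i * ((t ^+ i)%:C%C * f t)); last first.
    by apply/funext => t; rewrite TE.
  by apply: cintegrable_sum => i; exact: cintegrableZ.
have T0 : cint setT (fun t => Complex pc.[- (y * t)] ps.[- (y * t)] * f t) = 0.
  rewrite (eq_cint _ TE) cint_sum; last by move=> i; exact: cintegrableZ.
  by rewrite big1// => i _; rewrite cintZ// mom ?mulr0.
pose D t := expi (- (y * t)) * f t + (-1) * (Complex pc.[- (y * t)] ps.[- (y * t)] * f t).
have ciD : cintegrable D by apply: cintegrableD; [exact: cintegrable_fourier_kernel|exact: cintegrableZ].
have -> : fourier f y = cint setT D.
  rewrite fourierE /D cintD; [|exact: cintegrable_fourier_kernel|exact: cintegrableZ].
  by rewrite cintZ// T0 mulr0 addr0.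
pose q t := 2 * `|y| ^+ N * ((1 + `|t| ^+ N) * normc (f t)).
have iq : rintegrable q by exact: rintegrableZ.
have Dq t : normc (D t) <= q t.
  rewrite /D mulN1r -mulrBl normcM /q mulrA; apply: ler_wpM2r; first exact: normc_ge0.
  apply: (le_trans (normc_le_ReIm _)); rewrite ReD ImD ReN ImN /=.
  have b1 := bc (- (y * t)); have b2 := bs (- (y * t)).
  have b3 : `|- (y * t)| ^+ N <= `|y| ^+ N * (1 + `|t| ^+ N).
    by rewrite normrN normrM exprMn; apply: ler_wpM2l; [exact: exprn_ge0|rewrite lerDr].
  apply: (le_trans (lerD b1 b2)); rewrite -mulrA; move: b3.
  by move: (_ ^+ N) (_ * (_ + _)) => u v; lra.
apply: (le_trans (cint_le ciD iq Dq)); rewrite RintZ// -/I.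
by rewrite le_eqVlt; apply/orP; left; apply/eqP; ring.
Qed.

End Decay_and_moments.

Section Continuous_filters.
Context {R : realType}.
Local Notation C := (complex R).

Lemma Cn_continuous n (f : R -> C) : (0 < n)%N -> Cn n f -> continuous (rpart f) /\ continuous (ipart f).
Proof.
have h (g : R -> R) : (0 < n)%N -> Cn_real n g -> continuous g.
  move=> n0 [dg _] x; apply: differentiable_continuous; apply/derivable1_diffP.
  exact: (dg 0%N x n0).
by move=> n0 [a b]; split; exact: h.
Qed.

Lemma continuous_cmeas (f : R -> C) : continuous (rpart f) -> continuous (ipart f) -> cmeasurable f.
Proof. by move=> a b; split; exact: continuous_measurable_fun. Qed.

Lemma continuous_nsq_bound (f : R -> C) (a b : R) : a <= b -> continuous (rpart f) -> continuous (ipart f) ->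
  exists M, forall x, a <= x <= b -> nsq (f x) <= M.
Proof.
move=> ab cr ci.
have c : continuous (fun x => nsq (f x)).
  move=> x; rewrite /nsq; apply: cvgD.
    apply: (@continuous_comp _ _ _ (rpart f) (fun y => y ^+ 2)); [exact: cr|exact: exprn_continuous].
  apply: (@continuous_comp _ _ _ (ipart f) (fun y => y ^+ 2)); [exact: ci|exact: exprn_continuous].
have [z _ hz] := EVT_max ab (continuous_subspaceT c).
by exists (nsq (f z)) => x xab; apply: hz; rewrite in_itv/=.
Qed.

End Continuous_filters.

(** * Domination of the filtered wavelets *)

Section Domination.
Context {R : realType}.
Local Notation C := (complex R).

Let base_gt0 (x : R) : 0 < 1 + `|x|. Proof. by rewrite ltr_wpDr. Qed.

(** The growth of the filter costs at most [(1 + |x|)^(2 a)], which the decay of [p] compensates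
    with room for summing over periods. *)
Lemma low_periodization (g p : R -> C) (a z A K B : R) :
  (forall x, nsq (g x) <= A ^+ 2 * (1 + `|x|) `^ (2 * a)) ->
  (forall x, normc (p x) <= K / (1 + `|x|) `^ (a + 1 / 2 + z)) ->
  (forall (x : R) m, \sum_(i < m) (1 + `|x + i%:R * (2 * pi)|) `^ (- (1 + 2 * z)) <= B) ->
  forall (x : R) m, \sum_(i < m) nsq (g (x + i%:R * (2 * pi)) * p (x + i%:R * (2 * pi)))
    <= A ^+ 2 * K ^+ 2 * B.
Proof.
move=> gb pb sB x m.
have h y : nsq (g y * p y) <= A ^+ 2 * K ^+ 2 * (1 + `|y|) `^ (- (1 + 2 * z)).
  have X0 := base_gt0 y; rewrite nsqM.
  apply: (@le_trans _ _ (A ^+ 2 * (1 + `|y|) `^ (2 * a) * (K / (1 + `|y|) `^ (a + 1 / 2 + z)) ^+ 2)).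
    apply: ler_pM; rewrite ?nsq_ge0// -normc_sqr.
    apply: lerXn2r; rewrite ?nnegrE ?normc_ge0//.
    by apply: le_trans (pb y); exact: normc_ge0.
  have -> : (1 + `|y|) `^ (- (1 + 2 * z)) =
      (1 + `|y|) `^ (2 * a) * ((1 + `|y|) `^ (a + 1 / 2 + z) ^+ 2)^-1.
    rewrite -(powR_mulrn 2 (powR_ge0 _ _)) -powRrM -powRN -powRD; last by apply/implyP => _; rewrite gt_eqF.
    by congr (_ `^ _); field.
  by rewrite exprMn exprVn mulrACA.
apply: (@le_trans _ _ (\sum_(i < m) A ^+ 2 * K ^+ 2 * (1 + `|x + i%:R * (2 * pi)|) `^ (- (1 + 2 * z)))).
  by apply: ler_sum => i _; exact: h.
by rewrite -mulr_sumr; apply: ler_wpM2l => //; rewrite mulr_ge0 ?sqr_ge0.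
Qed.

(** Near the origin the vanishing moments of the wavelet compensate the blow-up allowed to the
    rescaled filter; away from it the decay of its transform compensates the growth of the filter.
    *)
Lemma dominated_of_bounds (g1 g2 p q : R -> C) (N : nat) (a z A K B1 B2 d : R) :
  (2 <= N)%N -> 0 <= A -> 0 <= K -> `|d| = a ->
  cmeasurable g1 -> cmeasurable g2 -> cmeasurable p -> cmeasurable q ->
  (forall x, nsq (g1 x) <= A ^+ 2 * (1 + `|x|) `^ (2 * a)) ->
  (forall (j : nat) y, `|y| <= 1 -> y != 0 ->
     normc (g2 (2 ^+ j * y)) <= 2 `^ (- (j%:R * d)) * (A / `|y| ^+ (N - 2))) ->
  (forall x, 1 < `|x| -> normc (g2 x) <= A * `|x| `^ (- d)) ->
  (forall x, normc (p x) <= K / (1 + `|x|) `^ (a + 1 / 2 + z)) ->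
  (forall y, normc (q y) <= K / (1 + `|y|) `^ (a + 2)) ->
  (forall y, normc (q y) <= K * `|y| ^+ N) ->
  (forall (x : R) m, \sum_(i < m) (1 + `|x + i%:R * (2 * pi)|) `^ (- (1 + 2 * z)) <= B1) ->
  (forall (x : R) m, \sum_(i < m) bump (x + i%:R * (2 * pi)) <= B2) ->
  dominated g1 g2 p q d (fun y => 4 * (A * K) * bump y)
    (A ^+ 2 * K ^+ 2 * B1) (4 * (A * K) * B2) (4 * (A * K) * (4 / 3)).
Proof.
move=> N2 A0 K0 da mg1 mg2 mp mq gb gs gl pb qb qN sB1 sB2.
have AK : 0 <= 4 * (A * K) by rewrite !mulr_ge0.
split => //.
- by apply: measurable_funM => //; exact: (continuous_measurable_fun continuous_bump).
- by move=> x; rewrite mulr_ge0// bump_ge0.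
- exact: (low_periodization gb pb sB1).
- by move=> x m; rewrite -mulr_sumr; apply: ler_wpM2l.
- by move=> x m; rewrite -mulr_sumr; apply: ler_wpM2l => //; exact: bump_scales.
move=> j y; rewrite normcM.
have c0 : 0 <= 2 `^ (- (j%:R * d)) :> R by exact: powR_ge0.
have target (v : R) : v <= 2 `^ (- (j%:R * d)) * (A * K * (4 * bump y)) ->
    v <= 2 `^ (- (j%:R * d)) * (4 * (A * K) * bump y).
  by rewrite (_ : A * K * (4 * bump y) = 4 * (A * K) * bump y)//; ring.
apply: target; have [->|y0] := eqVneq y 0.
  have := qN 0; rewrite normr0 expr0n (gtn_eqF (ltnW N2)) mulr0 => q0.
  have -> : normc (q 0) = 0 by apply/eqP; rewrite eq_le q0 normc_ge0.
  by rewrite mulr0 !mulr_ge0// bump_ge0.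
have yp : 0 < `|y| by rewrite normr_gt0.
have [y1|y1] := leP `|y| 1.
  apply: (le_trans (ler_pM (normc_ge0 _) (normc_ge0 _) (gs j y y1 y0) (qN y))).
  rewrite -[leLHS]mulrA; apply: ler_wpM2l => //.
  have -> : A / `|y| ^+ (N - 2) * (K * `|y| ^+ N) = A * K * y ^+ 2.
    rewrite -{2}(subnK N2) exprD real_normK ?num_real//.
    have : `|y| ^+ (N - 2) != 0 by rewrite expf_neq0// gt_eqF.
    by move: (`|y| ^+ _) => u u0; field.
  by apply: ler_wpM2l; [exact: mulr_ge0|exact: bump_small].
have x1 : 1 < `|2 ^+ j * y|.
  rewrite normrM ger0_norm ?exprn_ge0//; apply: (lt_le_trans y1).
  by rewrite ler_peMl// exprn_ege1// ler1n.
apply: (le_trans (ler_pM (normc_ge0 _) (normc_ge0 _) (gl _ x1) (qb y))).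
have X0 := base_gt0 y.
rewrite normrM ger0_norm ?exprn_ge0// powRM ?exprn_ge0//.
rewrite -(powR_mulrn j (ler0n R 2)) -powRrM mulrN.
rewrite [leLHS](_ : _ = 2 `^ (- (j%:R * d)) * (A * K * (`|y| `^ (- d) / (1 + `|y|) `^ (a + 2)))); last by ring.
apply: ler_wpM2l => //.
apply: ler_wpM2l; first exact: mulr_ge0.
apply: le_trans (bump_large (ltW y1)).
have a0 : 0 <= a by rewrite -da.
have e1 : `|y| `^ (- d) <= (1 + `|y|) `^ a.
  apply: (@le_trans _ _ (`|y| `^ a)).
    by apply: ler_powR; [exact: ltW|rewrite -da -normrN ler_norm].
  by apply: ge0_ler_powR; rewrite ?nnegrE ?(ltW X0)// lerDr.
rewrite powRD; last by apply/implyP => _; rewrite gt_eqF.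
rewrite invfM mulrA; apply: (@le_trans _ _ (1 * ((1 + `|y|) `^ 2)^-1)).
  apply: ler_wpM2r; first by rewrite invr_ge0 powR_ge0.
  by rewrite ler_pdivrMr ?powR_gt0// mul1r.
rewrite mul1r lef_pV2 ?posrE ?powR_gt0//; last by rewrite exprn_even_gt0.
rewrite powR_mulrn ?(ltW X0)// -(real_normK (num_real y)).
by apply: lerXn2r; rewrite ?nnegrE ?(ltW X0)// lerDr.
Qed.

Lemma filter_growth (g : R -> C) (A d : R) : 0 <= A ->
  (forall x, `|x| <= 1 -> normc (g x) <= A) ->
  (forall x, 1 < `|x| -> normc (g x) <= A * `|x| `^ (- d)) ->
  forall x, nsq (g x) <= A ^+ 2 * (1 + `|x|) `^ (2 * `|d|).
Proof.
move=> A0 gs gl x; have X0 := base_gt0 x.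
have h : normc (g x) <= A * (1 + `|x|) `^ `|d|.
  have [x1|x1] := leP `|x| 1.
    apply: (le_trans (gs x x1)); rewrite -[leLHS]mulr1; apply: ler_wpM2l => //.
    apply: (@le_trans _ _ ((1 + `|x|) `^ 0)); first by rewrite powRr0.
    by apply: ler_powR; rewrite ?lerDl.
  apply: (le_trans (gl x x1)); apply: ler_wpM2l => //.
  apply: (@le_trans _ _ (`|x| `^ `|d|)).
    by apply: ler_powR; [exact: ltW|rewrite -normrN ler_norm].
  by apply: ge0_ler_powR; rewrite ?nnegrE ?(ltW X0)// lerDr.
rewrite -normc_sqr [2 * _]mulrC powRrM powR_mulrn ?powR_ge0// -exprMn.
apply: lerXn2r h; rewrite ?nnegrE ?normc_ge0//.
by rewrite mulr_ge0 ?powR_ge0.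
Qed.


Lemma periodic_nsq_bound (f : R -> C) (M : R) : (forall x, f (x + 2 * pi) = f x) ->
  (forall x, 0 <= x <= 2 * pi -> nsq (f x) <= M) -> forall x, nsq (f x) <= M.
Proof.
move=> per b x; have p0 : 0 < 2 * (pi : R) by rewrite mulr_gt0// pi_gt0.
pose k := Num.floor (x / (2 * pi)).
rewrite -(subrK (k%:~R * (2 * pi)) x) (periodic_int per); apply: b.
have h1 : k%:~R <= x / (2 * pi) := Num.Theory.floor_le (x / (2 * pi)).
have h2 : x / (2 * pi) < (k + 1)%:~R := Num.Theory.floorD1_gt (x / (2 * pi)).
rewrite subr_ge0 -ler_pdivlMr// h1/= lerBlDr -[X in X + _]mul1r -mulrDl -ler_pdivrMr//.
by rewrite addrC -[1]/(1%:~R) -rmorphD/= ltW.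
Qed.

End Domination.

(** * The filtered wavelets are Riesz bases *)

Section Scaled_filters.
Context {R : realType}.
Local Notation C := (complex R).

Lemma cderiven0 (f : R -> C) x : cderiven 0 f x = f x.
Proof. by rewrite /cderiven /= /rpart /ipart -complexE. Qed.

Lemma normc_le1D (z : C) : normc z <= 1 + nsq z.
Proof.
by rewrite -normc_sqr; have := sqr_ge0 (normc z - 1); have := normc_ge0 z; move: (normc z) => y; nra.
Qed.

(** Scale 0 is covered by the bound on the unit interval, the other scales by the hypothesis on the
    rescaled filter; the exponent [s] is 1 for the filter and -1 for its inverse. *)
Lemma scaled_filter_bound (h g : R -> C) (s : int) (N : nat) (d C3 A : R) : C3 <= A ->
  (forall y, g y = h y ^ s) ->
  (forall y, `|y| <= 1 -> normc (g y) <= A) ->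
  (forall (j : nat) (x : R), (1 <= j)%N -> `|x| <= 1 -> (x != 0) || (N == 2)%N ->
     1 / 2 `^ (- (s%:~R * j%:R * d)) * 2 ^+ (j * 0)
       * normc (cderiven 0 (fun y => h y ^ s) (2 ^+ j * x)) <= C3 / `|x| ^+ (N - 2)) ->
  forall (j : nat) y, `|y| <= 1 -> y != 0 ->
    normc (g (2 ^+ j * y)) <= 2 `^ (- (j%:R * (s%:~R * d))) * (A / `|y| ^+ (N - 2)).
Proof.
move=> CA gE g1 gs j y y1 y0; have A0 : 0 <= A by apply: le_trans (g1 y y1); exact: normc_ge0.
have n0 : 0 < `|y| ^+ (N - 2) by rewrite exprn_gt0// normr_gt0.
case: j => [|j].
  rewrite expr0 !mul1r mul0r oppr0 powRr0 mul1r; apply: (le_trans (g1 y y1)).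
  by rewrite ler_pdivlMr// ler_piMr// exprn_ile1.
have := gs j.+1 y isT y1; rewrite y0 => /(_ isT).
rewrite muln0 expr0 mulr1 mul1r cderiven0 -gE mulrC ler_pdivrMr ?powR_gt0// => h'.
apply: (le_trans h'); rewrite mulrC (_ : s%:~R * j.+1%:R * d = j.+1%:R * (s%:~R * d)); last by ring.
by apply: ler_wpM2l; [exact: powR_ge0|apply: ler_wpM2r => //; rewrite invr_ge0 ltW].
Qed.

End Scaled_filters.

Theorem theorem2p2 (R : realType)
  (phi psi : R -> complex R) (u : int -> complex R) (uhat : R -> complex R)
  (N : nat) (h1 h2 : R -> complex R) (d : R)
  (hMRA : MRA phi psi u uhat)
  (hN2 : (2 <= N)%N)
  (h1_meas : cmeasurable h1)
  (* (1) *)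
  (h1_herm : forall x : R, h1 x = conjc (h1 (- x)))
  (h1_neq0 : forall x : R, h1 x != 0)
  (h1_bnd : forall a b : R, exists M : R, forall x : R, a <= x <= b ->
     normc (h1 x) <= M /\ normc (h1 x)^-1 <= M)
  (* (2) *)
  (h2_herm : forall x : R, h2 x = conjc (h2 (- x)))
  (h2_neq0 : forall x : R, h2 x != 0)
  (h2_C2 : Cn 2 h2 /\ Cn 2 (fun x => (h2 x)^-1))
  (h2_bnd : forall eps : R, 0 < eps -> exists C1 C2 C3 : R,
     [/\ 0 < C1, C1 <= C2 & 0 < C3] /\
     [/\ forall x : R, eps < `|x| ->
           C1 * `|x| `^ (- d) <= normc (h2 x) <= C2 * `|x| `^ (- d),
         forall (p : int) (k : nat) (x : R),
           p \in [:: -1; 1] -> k \in [:: 1%N; 2%N] -> eps < `|x| ->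
           normc (cderiven k (fun y => h2 y ^ p) x)
             <= C3 * `|x| `^ (- (p%:~R * d) - k%:R) &
         forall (p : int) (k j : nat) (x : R),
           p \in [:: -1; 1] -> k \in [:: 0%N; 1%N; 2%N] -> (1 <= j)%N ->
           `|x| <= eps ->
           (* for N > 2 the bound is +oo at x = 0 *)
           (x != 0) || (N == 2)%N ->
           1 / 2 `^ (- (p%:~R * j%:R * d)) * 2 ^+ (j * k)
             * normc (cderiven k (fun y => h2 y ^ p) (2 ^+ j * x))
             <= C3 / `|x| ^+ (N - 2)])
  (* (3) *)
  (h21_per : forall x : R, h2 (x + 2 * pi) / h1 (x + 2 * pi) = h2 x / h1 x)
  (* (4) *)
  (phi_decay : bigO_infty phi (fun t : R => (1 + t ^+ 2) `^ (- (N%:R / 2) - 1)))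
  (psi_decay : bigO_infty psi (fun t : R => (1 + t ^+ 2) `^ (- (N%:R / 2) - 1)))
  (psi_moments : forall nu : nat, (nu < N)%N ->
     cint setT (fun t : R => (t ^+ nu)%:C%C * psi t) = 0)
  (hNd : Num.max 2 (- (1 / 2) + `|d|) <= N%:R)
  (* (5) *)
  (phihat_CN : Cn N (fourier phi))
  (psihat_CN : Cn N (fourier psi))
  (uhat_CN : Cn_on `[- pi, pi[ N uhat)
  (* (6) *)
  (phihat_K : exists K : set R, congruent_to_period K /\
     0 < inf [set normc (fourier phi x) | x in K])
  (* (7) *)
  (hat_decay : exists zeta eta C : R, [/\ 0 < zeta, 0 < eta & 0 < C] /\
     forall x : R,
       normc (fourier phi x) <= C / (1 + `|x|) `^ (`|d| + 1 / 2 + zeta) /\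
       forall k : nat, k \in [:: 0%N; 1%N; 2%N] ->
         normc (cderiven k (fourier psi) x)
           <= C / (1 + `|x|) `^ (`|d| + (2 + eta))) :
  riesz_basis (translates (atom h1 phi 0) (atom h2 psi)) /\
  riesz_basis (translates (atom (dual_filter h1) phi 0)
                          (atom (dual_filter h2) psi)).
Proof.
have [onb _ _ _ _] := hMRA; have [lw _ _] := onb.
have lphi2 : L2 phi by have := lw (inl 0); congr L2; apply/funext => t /=; rewrite subr0.
have lpsi2 : L2 psi.
  by have := lw (inr (0%N, 0)); rewrite /= dil00; congr L2; apply/funext => t /=; rewrite subr0.
have lphi := L12_of_decay lphi2 phi_decay; have lpsi := L12_of_decay lpsi2 psi_decay.
have mp := fourier_meas lphi.1; have mq := fourier_meas lpsi.1.
have [K1 K10 van] := fourier_vanishing (L2_meas lpsi2) (decay_rintegrable lpsi2 psi_decay) psi_moments.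
have [z [eta [C0 [[z0 eta0 C00] hd]]]] := hat_decay.
have [C1 [C2 [C3 [[C10 C12 C30] [hl _ hs]]]]] := h2_bnd 1 ltr01.
have C20 : 0 < C2 by exact: lt_le_trans C12.
have pi2 : 0 < 2 * (pi : R) by rewrite mulr_gt0// pi_gt0.
have [B1 B10 sB1] := power_decay_periodization (mulr_gt0 (@ltr0Sn R 1) z0) pi2.
have [B2 B20 sB2] := bump_periodization pi2.
pose a : R := `|d|; pose K := C0 + K1.
have K0 : 0 <= K by rewrite addr_ge0// ltW.
have X0 (x : R) : 0 < 1 + `|x| by rewrite ltr_wpDr.
have X1 (x : R) : 1 <= 1 + `|x| by rewrite lerDl.
have pb x : normc (fourier phi x) <= K / (1 + `|x|) `^ (a + 1 / 2 + z).
  apply: (le_trans (hd x).1); apply: ler_wpM2r; last by rewrite lerDl.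
  by rewrite invr_ge0 powR_ge0.
have qb y : normc (fourier psi y) <= K / (1 + `|y|) `^ (a + 2).
  have := (hd y).2 0%N isT; rewrite cderiven0 => h; apply: (le_trans h); apply: ler_pM.
  - exact: ltW.
  - by rewrite invr_ge0; exact: powR_ge0.
  - by rewrite lerDl.
  - rewrite lef_pV2 ?posrE ?powR_gt0//; apply: ler_powR => //.
    by rewrite lerD2l lerDl ltW.
have qN y : normc (fourier psi y) <= K * `|y| ^+ N.
  by apply: (le_trans (van y)); apply: ler_wpM2r; [exact: exprn_ge0|rewrite lerDr ltW].
(* Continuity bounds the filter and its inverse on [-1, 1], where the power bounds say nothing,
   and on one period, where the quotient of the two filters has to be controlled. *)
have [cr ci] := Cn_continuous (ltn0Sn 1) h2_C2.1; have [cr' ci'] := Cn_continuous (ltn0Sn 1) h2_C2.2.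
have mh2 := continuous_cmeas cr ci.
have h11 : -1 <= 1 :> R by lra.
have [Ma hMa] := continuous_nsq_bound h11 cr ci; have [Mb hMb] := continuous_nsq_bound h11 cr' ci'.
have [Mc hMc] := continuous_nsq_bound (ltW pi2) cr ci.
have [Md hMd] := continuous_nsq_bound (ltW pi2) cr' ci'.
have [M1 hM1] := h1_bnd 0 (2 * pi).
have Ma0 : 0 <= Ma by apply: le_trans (hMa 0 _); rewrite ?nsq_ge0// lerN10 ler01.
have Mb0 : 0 <= Mb by apply: le_trans (hMb 0 _); rewrite ?nsq_ge0// lerN10 ler01.
have Mc0 : 0 <= Mc by apply: le_trans (hMc 0 _); rewrite ?nsq_ge0// lexx ltW.
have Md0 : 0 <= Md by apply: le_trans (hMd 0 _); rewrite ?nsq_ge0// lexx ltW.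
pose A0 := (1 + Ma) + (1 + Mb) + C2 + C1^-1 + C3.
have C1V : 0 < C1^-1 by rewrite invr_gt0.
have A00 : 0 <= A0 by rewrite /A0; lra.
have [u1 [u2 [u3 [u4 u5]]]] : 1 + Ma <= A0 /\ 1 + Mb <= A0 /\ C2 <= A0 /\ C1^-1 <= A0 /\ C3 <= A0.
  by rewrite /A0; do !split; lra.
have s1 x : `|x| <= 1 -> normc (h2 x) <= A0.
  by rewrite ler_norml => /hMa h; apply: (le_trans (normc_le1D _)); apply: le_trans u1; rewrite lerD2l.
have s2 x : `|x| <= 1 -> normc (h2 x)^-1 <= A0.
  by rewrite ler_norml => /hMb h; apply: (le_trans (normc_le1D _)); apply: le_trans u2; rewrite lerD2l.
have l1 x : 1 < `|x| -> normc (h2 x) <= A0 * `|x| `^ (- d).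
  by move=> /hl /andP[_ h]; apply: (le_trans h); apply: ler_wpM2r; [exact: powR_ge0|].
have l2 x : 1 < `|x| -> normc (h2 x)^-1 <= A0 * `|x| `^ (- - d).
  move=> x1; have /andP[h _] := hl x x1.
  have p0 : 0 < `|x| `^ (- d) by rewrite powR_gt0// (lt_trans ltr01).
  rewrite normcV powRN; apply: (@le_trans _ _ (C1^-1 * (`|x| `^ (- d))^-1)).
    rewrite -invfM lef_pV2 ?posrE ?mulr_gt0//.
    by apply: lt_le_trans h; rewrite mulr_gt0.
  by apply: ler_wpM2r => //; rewrite invr_ge0 ltW.
have g1 := filter_growth A00 s1 l1; have g2 := filter_growth A00 s2 l2; rewrite normrN in g2.
(* The quotient of the filters is periodic, hence bounded everywhere, so that the growth of [h2]
   carries over to [h1]. *)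
pose Mr := Mc * M1 ^+ 2 + M1 ^+ 2 * Md.
have Mr0 : 0 <= Mr by rewrite addr_ge0// mulr_ge0// sqr_ge0.
have M1b x : 0 <= x <= 2 * pi -> nsq (h1 x) <= M1 ^+ 2 /\ nsq (h1 x)^-1 <= M1 ^+ 2.
  move=> /hM1[b1 b2]; rewrite -!normc_sqr; split; apply: lerXn2r => //; rewrite ?nnegrE ?normc_ge0//.
    by apply: le_trans b1; exact: normc_ge0.
  by apply: le_trans b1; exact: normc_ge0.
have r1 x : nsq (h2 x / h1 x) <= Mr.
  apply: (periodic_nsq_bound h21_per) => y yp; have [_ b] := M1b y yp.
  rewrite nsqM; apply: (@le_trans _ _ (Mc * M1 ^+ 2)); last by rewrite lerDl mulr_ge0// sqr_ge0.
  by apply: ler_pM; rewrite ?nsq_ge0// hMc.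
have h12_per x : h1 (x + 2 * pi) / h2 (x + 2 * pi) = h1 x / h2 x.
  by have := congr1 GRing.inv (h21_per x); rewrite !invf_div.
have r2 x : nsq (h1 x / h2 x) <= Mr.
  apply: (periodic_nsq_bound h12_per) => y yp; have [b _] := M1b y yp.
  rewrite nsqM; apply: (@le_trans _ _ (M1 ^+ 2 * Md)); last by rewrite lerDr mulr_ge0// sqr_ge0.
  by apply: ler_pM; rewrite ?nsq_ge0// hMd.
(* A single constant for all filters: the factor [1 + Mr] passes from [h2] to [h1], and the last
   term covers the trivial filter 1. *)
pose A := A0 * (1 + Mr) + 1.
have AA : A0 <= A by rewrite /A ler_wpDr// ler_peMr// lerDl.
have A1 : 0 <= A by exact: le_trans AA.
have Asq : [/\ A0 ^+ 2 <= A ^+ 2, Mr * A0 ^+ 2 <= A ^+ 2 & 1 <= A ^+ 2].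
  have q1 : 0 <= A0 * Mr by rewrite mulr_ge0.
  have A11 : 1 <= A by rewrite /A lerDr mulr_ge0// addr_ge0.
  split; [by apply: lerXn2r; rewrite ?nnegrE|rewrite /A|by rewrite exprn_ege1].
  apply: (@le_trans _ _ ((A0 * (1 + Mr)) ^+ 2)).
    rewrite exprMn mulrC; apply: ler_wpM2l; first exact: sqr_ge0.
    have sq : forall y : R, 0 <= y -> y <= (1 + y) ^+ 2 by move=> y y0; nra.
    exact: sq.
  have q2 : 0 <= A0 * (1 + Mr) by rewrite mulr_ge0// addr_ge0.
  by apply: lerXn2r; rewrite ?nnegrE ?lerDl// addr_ge0.
have [Asq1 Asq2 Asq3] := Asq.
pose G (x : R) : R := (1 + `|x|) `^ (2 * a); have G0 x : 0 <= G x by exact: powR_ge0.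
have n1 x : nsq (h2 x) <= A ^+ 2 * G x by apply: (le_trans (g1 x)); apply: ler_wpM2r.
have n2 x : nsq (h2 x)^-1 <= A ^+ 2 * G x by apply: (le_trans (g2 x)); apply: ler_wpM2r.
have n3 x : nsq (h1 x) <= A ^+ 2 * G x.
  rewrite -[h1 x](divfK (h2_neq0 x)) nsqM.
  apply: (le_trans (ler_pM (nsq_ge0 _) (nsq_ge0 _) (r2 x) (g1 x))).
  by rewrite mulrA; apply: ler_wpM2r.
have n4 x : nsq (h1 x)^-1 <= A ^+ 2 * G x.
  rewrite -[(h1 x)^-1](mulKf (h2_neq0 x)) nsqM mulrC.
  apply: (le_trans (ler_pM (nsq_ge0 _) (nsq_ge0 _) (r1 x) (g2 x))).
  by rewrite mulrA; apply: ler_wpM2r.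
have n5 x : nsq (1 : complex R) <= A ^+ 2 * G x.
  rewrite -[1]/(1%:C%C) nsq_real expr1n -[leLHS]mulr1; apply: ler_pM => //.
  apply: (@le_trans _ _ ((1 + `|x|) `^ 0)); first by rewrite powRr0.
  by apply: ler_powR => //; rewrite mulr_ge0// normr_ge0.
have sc1 : forall (j : nat) y, `|y| <= 1 -> y != 0 ->
    normc (h2 (2 ^+ j * y)) <= 2 `^ (- (j%:R * d)) * (A / `|y| ^+ (N - 2)).
  have := @scaled_filter_bound _ h2 h2 1 N d C3 A (le_trans u5 AA).
  rewrite mul1r; apply => [y|y y1|j x j1 x1 x0]; first by rewrite expr1z.
    exact: le_trans (s1 y y1) AA.
  exact: hs.
have sc2 : forall (j : nat) y, `|y| <= 1 -> y != 0 ->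
    normc (h2 (2 ^+ j * y))^-1 <= 2 `^ (- (j%:R * - d)) * (A / `|y| ^+ (N - 2)).
  have := @scaled_filter_bound _ h2 (fun x => (h2 x)^-1) (-1) N d C3 A (le_trans u5 AA).
  rewrite mulN1r; apply => [y|y y1|j x j1 x1 x0]; first by rewrite exprN1.
    exact: le_trans (s2 y y1) AA.
  exact: hs.
have la1 x : 1 < `|x| -> normc (h2 x) <= A * `|x| `^ (- d).
  by move=> /l1 h; apply: (le_trans h); apply: ler_wpM2r => //; exact: powR_ge0.
have la2 x : 1 < `|x| -> normc (h2 x)^-1 <= A * `|x| `^ (- - d).
  by move=> /l2 h; apply: (le_trans h); apply: ler_wpM2r => //; exact: powR_ge0.
have mk (h : R -> complex R) : cmeasurable h -> cmeasurable (dual_filter h).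
  by move=> mh; apply: cmeas_conj; exact: cmeas_inv.
have dom1 g (mg : cmeasurable g) (ng : forall x, nsq (g x) <= A ^+ 2 * G x) :=
  dominated_of_bounds hN2 A1 K0 (erefl a) mg mh2 mp mq ng sc1 la1 pb qb qN sB1 sB2.
have dom2 g (mg : cmeasurable g) (ng : forall x, nsq (g x) <= A ^+ 2 * G x) :
    dominated g (dual_filter h2) (fourier phi) (fourier psi) (- d)
      (fun y => 4 * (A * K) * bump y) (A ^+ 2 * K ^+ 2 * B1) (4 * (A * K) * B2) (4 * (A * K) * (4 / 3)).
  apply: (dominated_of_bounds hN2 A1 K0 (normrN d) mg (mk _ mh2) mp mq ng _ _ pb qb qN sB1 sB2).
    by move=> j y y1 y0; rewrite /dual_filter normc_conj; exact: sc2.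
  by move=> x x1; rewrite /dual_filter normc_conj; exact: la2.
have pS x m : \sum_(i < m) nsq (fourier phi (x + i%:R * (2 * pi))) <= A ^+ 2 * K ^+ 2 * B1.
  have := low_periodization n5 pb sB1 x m.
  by under eq_bigr => i _ do rewrite mul1r.
have nd (h : R -> complex R) x : nsq (dual_filter h x) = nsq (h x)^-1 by rewrite /dual_filter nsq_conj.
have e1 (h : R -> complex R) x : h x != 0 -> h x * conjc (dual_filter h x) = 1.
  by move=> h0; rewrite /dual_filter conjcK divff.
have e2 (h : R -> complex R) x : h x != 0 -> dual_filter h x * conjc (h x) = 1.
  by move=> h0; rewrite /dual_filter -conjcM mulVf// conjc1.
have q1 x : h1 x * conjc (dual_filter h2 x) = h1 x / h2 x by rewrite /dual_filter conjcK.
have q2 x : dual_filter h1 x * conjc (h2 x) = conjc (h2 x / h1 x).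
  by rewrite /dual_filter -conjcM mulrC.
have loc n : exists M : R, forall x, window n x -> nsq (h2 x) <= M /\ nsq (dual_filter h2 x) <= M.
  have nn : - n%:R <= n%:R :> R by rewrite lerNl -subr_ge0 opprK addr_ge0.
  have [Me hMe] := continuous_nsq_bound nn cr ci; have [Mf hMf] := continuous_nsq_bound nn cr' ci'.
  have Me0 : 0 <= Me by apply: le_trans (hMe n%:R _); rewrite ?nsq_ge0// nn lexx.
  have Mf0 : 0 <= Mf by apply: le_trans (hMf n%:R _); rewrite ?nsq_ge0// nn lexx.
  exists (Me + Mf) => x; rewrite windowP ler_norml => xn; rewrite nd; split.
    by apply: (le_trans (hMe x xn)); rewrite lerDl.
  by apply: (le_trans (hMf x xn)); rewrite lerDr.
have dn (h : R -> complex R) (nh : forall x, nsq (h x)^-1 <= A ^+ 2 * G x) x : nsq (dual_filter h x) <= A ^+ 2 * G x.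
  by rewrite nd.
split.
  apply: (riesz_basis_filtered lphi lpsi onb (fun x => e1 h1 x (h1_neq0 x)) (fun x => e1 h2 x (h2_neq0 x))
    (dom1 _ h1_meas n3) (dom2 _ (mk _ h1_meas) (dn _ n4)) (dom1 _ mh2 n1) (dom2 _ (mk _ mh2) (dn _ n2)) pS _ _ _ _ loc).
  - by move=> x; rewrite q1; exact: r2.
  - by move=> x; rewrite !q1.
  - by move=> x; rewrite q2 nsq_conj; exact: r1.
  - by move=> x; rewrite !q2 h21_per.
have loc' n : exists M : R, forall x, window n x -> nsq (dual_filter h2 x) <= M /\ nsq (h2 x) <= M.
  by have [M hM] := loc n; exists M => x /hM[].
have dom1' g mg ng := dom1 g mg ng; rewrite -{1}[d]opprK in dom1'.
apply: (riesz_basis_filtered lphi lpsi onb (fun x => e2 h1 x (h1_neq0 x)) (fun x => e2 h2 x (h2_neq0 x))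
    (dom2 _ (mk _ h1_meas) (dn _ n4)) (dom1' _ h1_meas n3) (dom2 _ (mk _ mh2) (dn _ n2)) (dom1' _ mh2 n1) pS _ _ _ _ loc').
- by move=> x; rewrite q2 nsq_conj; exact: r1.
- by move=> x; rewrite !q2 h21_per.
- by move=> x; rewrite q1; exact: r2.
- by move=> x; rewrite !q1.
Qed.
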